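(* Let $d\ge1$, $a_1,\dots,a_d>0$, and let $H$ be the Hamiltonian on the $d$-dimensional hyperrectangular lattice graph with edge lengths $a_1,\dots,a_d$ and $\delta$ couplings of strength $\alpha<0$ at all vertices. Then: (1) every spectral gap of $H$ has its upper endpoint equal to $\left(\frac{m\pi}{a_j}\right)^2$ for some $j\in\{1,\dots,d\}$ and some $m\in\mathbb{N}$; (2) for $\ell\in\{1,\dots,d\}$ and $m\in\mathbb{N}$, there is a spectral gap with upper endpoint $\left(\frac{m\pi}{a_\ell}\right)^2$ if and only if $$\frac{2m\pi}{a_{\ell}}\sum_{j=1}^d\tan\left(\frac{\pi}{2}\left(\left\lceil m\frac{a_j}{a_{\ell}}\right\rceil-m\frac{a_j}{a_{\ell}}\right)\right)<|\alpha|.$$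
   Context: The lattice graph $\Gamma$ has vertex set $\{(n_1a_1,\dots,n_da_d): n_i\in\mathbb{Z}\}\subset\mathbb{R}^d$, with an edge (segment of length $a_j$) between two vertices iff they differ by $a_je_j$ for some $j$. $H$ is the self-adjoint operator on $L^2(\Gamma)$ acting as $\psi\mapsto-\psi''$ on each edge, with domain consisting of functions $H^2$ on each edge satisfying at every vertex $v$: $\psi$ is continuous at $v$, and the sum over the $2d$ incident edges of the derivatives at $v$ taken in the direction away from $v$ equals $\alpha\psi(v)$. A spectral gap is an open interval $(E_1,E_2)$ with $E_1<E_2$, $E_1,E_2\in\sigma(H)$ and $(E_1,E_2)\cap\sigma(H)=\emptyset$. $\lceil\cdot\rceil$ is the ceiling function, $\mathbb{N}=\{1,2,\dots\}$. *)

(* Defs.v *)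
From HB Require Import structures.
From mathcomp Require Import all_boot all_order all_algebra.
From mathcomp Require Import all_classical all_reals all_analysis.
Set Implicit Arguments. Unset Strict Implicit. Unset Printing Implicit Defensive.
Import Order.TTheory GRing.Theory Num.Theory.
Local Open Scope classical_set_scope.
Local Open Scope ring_scope.

(* The lattice graph with edge lengths a_1..a_d.
   Vertices: Z^d (vertex v stands for the point (v_1 a_1, ..., v_d a_d)).
   Edges: pairs (v, j); edge (v, j) is the segment from v to v + e_j,
   parametrized by t in [0, a_j], t = 0 at v and t = a_j at v + e_j.
   A function on the graph is psi : edge -> R -> R (only values on [0,a_j] matter). *)
Section Lattice.
Variables (R : realType) (d : nat) (a : 'I_d -> R) (alpha : R).

Definition vertex := {ffun 'I_d -> int}.
Definition edge := (vertex * 'I_d)%type.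
Definition gfun := edge -> R -> R.

Definition shiftm (v : vertex) (j : 'I_d) : vertex :=
  [ffun i => v i - (i == j)%:Z].

Definition edge_L2sq (f : R -> R) (l : R) : \bar R :=
  (\int[@lebesgue_measure R]_(t in `[0%R, l]) ((f t) ^+ 2)%:E)%E.

Definition L2sq (psi : gfun) : \bar R :=
  (\esum_(e in [set: edge]) edge_L2sq (psi e) (a e.2))%E.

Definition inL2 (psi : gfun) : Prop :=
  (forall e : edge, measurable_fun `[0, a e.2] (psi e)) /\ (L2sq psi < +oo)%E.

(* Graph of H: H_graph psi phi  <->  psi \in Dom(H) and H psi = phi.
   Dom(H): psi in H^2 on each edge with sum of H^2 norms finite
   (psi, psi', psi'' in L^2(Gamma)), continuity at vertices and the
   delta coupling condition of strength alpha.  Here p is psi' (an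
   absolutely continuous function with p' = psi'' = -phi a.e.). *)
Definition H_graph (psi phi : gfun) : Prop :=
  inL2 psi /\ inL2 phi /\
  exists p : gfun, inL2 p /\
    (forall (e : edge) (t : R), 0 <= t <= a e.2 ->
       (psi e t)%:E = ((psi e 0)%:E
                       + \int[@lebesgue_measure R]_(s in `[0%R, t]) (p e s)%:E)%E
       /\ (p e t)%:E = ((p e 0)%:E
                       - \int[@lebesgue_measure R]_(s in `[0%R, t]) (phi e s)%:E)%E)
    /\ exists u : vertex -> R, forall v : vertex,
         (forall j : 'I_d, psi (v, j) 0 = u v /\ psi (shiftm v j, j) (a j) = u v)
         /\ \sum_(j < d) (p (v, j) 0 - p (shiftm v j, j) (a j)) = alpha * u v.

Definition in_resolvent (lam : R) : Prop :=
  (forall psi : gfun, H_graph psi (fun e t => lam * psi e t) ->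
     forall (e : edge) (t : R), 0 <= t <= a e.2 -> psi e t = 0)
  /\ exists C : R, forall f : gfun, inL2 f ->
       exists psi : gfun, H_graph psi (fun e t => lam * psi e t + f e t)
                          /\ (L2sq psi <= C%:E * L2sq f)%E.

Definition in_spectrum (lam : R) : Prop := ~ in_resolvent lam.

Definition spectral_gap (E1 E2 : R) : Prop :=
  E1 < E2 /\ in_spectrum E1 /\ in_spectrum E2 /\
  forall E, E1 < E < E2 -> ~ in_spectrum E.

End Lattice.

(* Main.v *)
Require Import Defs.
From HB Require Import structures.
From mathcomp Require Import all_boot all_order all_algebra.
From mathcomp Require Import all_classical all_reals all_analysis.
From mathcomp Require Import measurable_realfun ring lra.
Set Implicit Arguments. Unset Strict Implicit. Unset Printing Implicit Defensive.
Import Order.TTheory GRing.Theory Num.Theory numFieldNormedType.Exports.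
Local Open Scope classical_set_scope.
Local Open Scope ring_scope.

(* Writing [c j, s j] for the values at [a j] of the solutions of [- y'' = E y] with
   Cauchy data (1, 0) and (0, 1), the vertex conditions turn [H psi = E psi] into the
   difference equation [\sum_j (u (v + e_j) + u (v - e_j)) / s j = A u v] on [Z^d], with
   [A = alpha + 2 \sum_j c j / s j]. If [`|A| > 2 \sum_j `|s j|^-1] this equation is
   diagonally dominant and [E] is in the resolvent set. Otherwise a product of cosines,
   or functions vanishing at all vertices when some [s j = 0], give a bounded
   generalized eigenfunction, whose cut-offs by slowly varying exponential weights are
   approximate eigenfunctions at every energy near [E]. So the spectrum is closed and is
   exactly the set where dominance fails. For [E = k^2 > 0] the criterion
   reads [`|alpha| <= 2 k \sum_j tan (pi / 2 (ceil x_j - x_j))], [x_j = k a_j / pi]; the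
   right-hand side decreases in [k] between consecutive points [m pi / a_j], all of which
   are in the spectrum, so a gap can only end at such a point. *)

(** [in_resolvent] asks for injectivity and a bounded solution operator on all L2 sources, so no
    spectral theorem intervenes. Dominance yields that operator by a Neumann series on the vertices;
    conversely its bound [C] alone fixes a distance to [E] within which no bounded generalized
    eigenfunction exists, which settles [E] itself and closedness together. Exponential weights have
    neighbour ratios uniformly close to 1, so the cut-off error is small against the function edge
    by edge and no boundary has to be counted. Failure of dominance is a pair of inequalities,
    [A <= B] and [- B <= A] with [B = 2 \sum_j |s j|^-1]. For [E >= 0] the first holds because
    [alpha < 0]; for [E <= 0] the two are monotone in opposite senses, so no gap ends at or below 0.
    The tangents come from [(1 - cos 2y) / sin 2y = tan y]. As [k] increases through [m pi / a_j]
    the tangent jumps from 0 to infinity; a gap ending there sees the limit from the left, which is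
    why the ceiling appears. The lower end of such a gap is a supremum of spectrum, and a negative
    point of the spectrum makes it a supremum over a nonempty set. *)

Section Calculus.
Variable R : realType.
Implicit Types (f g : R -> R) (t l : R).

Lemma derD f g t (a b : R) : is_derive t 1 f a -> is_derive t 1 g b ->
  is_derive t 1 (fun x => f x + g x) (a + b).
Proof. exact: is_deriveD. Qed.

Lemma derN f t (a : R) : is_derive t 1 f a -> is_derive t 1 (fun x => - f x) (- a).
Proof. exact: is_deriveN. Qed.

Lemma derB f g t (a b : R) : is_derive t 1 f a -> is_derive t 1 g b ->
  is_derive t 1 (fun x => f x - g x) (a - b).
Proof. exact: is_deriveB. Qed.

Lemma derM f g t (a b : R) : is_derive t 1 f a -> is_derive t 1 g b ->
  is_derive t 1 (fun x => f x * g x) (f t * b + g t * a).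
Proof. exact: is_deriveM. Qed.

Lemma derZ f t (k a : R) : is_derive t 1 f a -> is_derive t 1 (fun x => k * f x) (k * a).
Proof. exact: is_deriveZ. Qed.

Lemma derid t : is_derive t 1 (fun x : R => x) 1.
Proof. exact: is_derive_id. Qed.

Lemma dercst t (k : R) : is_derive t 1 (fun _ : R => k) 0.
Proof. exact: is_derive_cst. Qed.

Lemma der_continuous f t a : is_derive t 1 f a -> {for t, continuous f}.
Proof. by move=> [df _]; apply: differentiable_continuous; exact/derivable1_diffP. Qed.

Lemma continuous_within_cc f l : (forall t, 0 <= t <= l -> {for t, continuous f}) ->
  {within `[0, l], continuous f}.
Proof.
move=> cf; apply/continuous_in_subspaceT => t; rewrite inE/= in_itv/= => tl.
exact: cf.
Qed.

Lemma ftc2 f g l : 0 <= l -> (forall t, 0 <= t <= l -> is_derive t 1 f (g t)) ->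
  (forall t, 0 <= t <= l -> {for t, continuous g}) ->
  (\int[@lebesgue_measure R]_(s in `[0%R, l]) (g s)%:E)%E = (f l - f 0)%:E.
Proof.
rewrite le_eqVlt => /predU1P[<- _ _|l0 df cg].
  by rewrite set_itv1 integral_set1 subrr.
rewrite (@continuous_FTC2 R g f)//; first exact: continuous_within_cc.
- split.
  + by move=> x /[!in_itv]/= /andP[/ltW x0 /ltW xl]; apply: ex_derive; apply: df; rewrite x0.
  + apply: cvg_at_right_filter; apply: (@der_continuous _ _ (g 0)); apply: df.
    by rewrite lexx ltW.
  + apply: cvg_at_left_filter; apply: (@der_continuous _ _ (g l)); apply: df.
    by rewrite lexx ltW.
- move=> x /[!in_itv]/= /andP[/ltW x0 /ltW xl]; rewrite derive1E.
  by apply: derive_val; apply: df; rewrite x0.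
Qed.

Lemma continuous_integrable f l : (forall t, 0 <= t <= l -> {for t, continuous f}) ->
  (@lebesgue_measure R).-integrable `[0, l] (EFin \o f).
Proof.
move=> cf; apply: continuous_compact_integrable; first exact: segment_compact.
exact: continuous_within_cc.
Qed.

Lemma continuous_bounded f l : (forall t, 0 <= t <= l -> {for t, continuous f}) ->
  exists2 M, 0 < M & forall t, 0 <= t <= l -> `|f t| <= M.
Proof.
move=> cf; have /compact_bounded[M [_ mrt]] :=
  continuous_compact (@continuous_within_cc f l cf) (@segment_compact R 0 l).
exists (`|M| + 1); first by rewrite ltr_wpDl.
move=> t tl; apply: (mrt (`|M| + 1)); last by exists t => //=; rewrite in_itv.
by rewrite (le_lt_trans (ler_norm _))// ltrDl.
Qed.

Lemma is_derive_nonneg_le f g l : 0 <= l ->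
  (forall t, 0 <= t <= l -> is_derive t 1 f (g t)) ->
  (forall t, 0 <= t <= l -> 0 <= g t) -> f 0 <= f l.
Proof.
rewrite le_eqVlt => /predU1P[<- //|l0] df g0.
have [x] : exists2 c, c \in `]0, l[ & f l - f 0 = g c * (l - 0).
  apply: MVT => //.
    by move=> x /[!in_itv]/= /andP[/ltW x0 /ltW xl]; apply: df; rewrite x0.
  apply: continuous_within_cc => t tl; exact: (der_continuous (df t tl)).
rewrite in_itv/= subr0 => /andP[/ltW x0 /ltW xl] e.
by rewrite -subr_ge0 e; apply: mulr_ge0; [apply: g0; rewrite x0|exact: ltW].
Qed.

(** Grönwall's inequality: [f] times the integrating factor [expR (- B * t)] does not increase. The
    factor -1 in the proof turns this into a monotone growth. *)
Lemma is_derive_sq_le f g l B : 0 <= l ->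
  (forall t, 0 <= t <= l -> is_derive t 1 f (g t)) ->
  (forall t, 0 <= t <= l -> g t <= B * f t) -> f l <= expR (B * l) * f 0.
Proof.
move=> l0 df gB.
have h : expR (- B * 0) * f 0 * -1 <= expR (- B * l) * f l * -1.
  pose F t := expR (- B * t) * f t * -1.
  pose G t := (B * f t - g t) * expR (- B * t).
  apply: (@is_derive_nonneg_le F G l) => // t tl; last first.
    by rewrite /G mulr_ge0 ?expR_ge0// subr_ge0; exact: gB.
  have dE : is_derive t 1 (fun x => expR (- B * x)) (expR (- B * t) * (- B * 1)).
    exact: (@is_derive1_comp R expR (fun x => - B * x) _ _ _ (is_derive_expR _)
      (derZ (- B) (derid t))).
  have := derM (derM dE (df t tl)) (dercst t (-1)).
  by move=> H; apply: (is_derive_eq H); rewrite /G; ring.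
have {h}: expR (- B * l) * f l <= f 0.
  by move: h; rewrite mulr0 expR0 mul1r !mulrN1 lerN2.
by move=> /(ler_wpM2l (expR_ge0 (B * l))); rewrite mulrA -expRD -mulrDl subrr mul0r expR0 mul1r.
Qed.

End Calculus.

(** * Fundamental solutions of the edge equation for all signs of the energy *)

Section Solutions.
Variable R : realType.
Implicit Types E t k : R.

Definition coshR t : R := (expR t + expR (- t)) / 2.
Definition sinhR t : R := (expR t - expR (- t)) / 2.

(* [csol E] and [ssol E] solve [- y'' = E y] with Cauchy data (1, 0) and (0, 1) at 0. *)
Definition csol E t : R :=
  if E == 0 then 1 else
  if 0 < E then cos (Num.sqrt E * t) else coshR (Num.sqrt (- E) * t).
Definition ssol E t : R :=
  if E == 0 then t else
  if 0 < E then sin (Num.sqrt E * t) / Num.sqrt E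
  else sinhR (Num.sqrt (- E) * t) / Num.sqrt (- E).

Lemma csol_pos k t : 0 < k -> csol (k ^+ 2) t = cos (k * t).
Proof.
by move=> k0; rewrite /csol sqrf_eq0 gt_eqF// exprn_gt0// sqrtr_sqr gtr0_norm.
Qed.

Lemma ssol_pos k t : 0 < k -> ssol (k ^+ 2) t = sin (k * t) / k.
Proof.
by move=> k0; rewrite /ssol sqrf_eq0 gt_eqF// exprn_gt0// sqrtr_sqr gtr0_norm.
Qed.

Lemma csol_neg k t : 0 < k -> csol (- k ^+ 2) t = coshR (k * t).
Proof.
move=> k0; rewrite /csol oppr_eq0 sqrf_eq0 gt_eqF// oppr_gt0.
by rewrite ltNge exprn_ge0 ?ltW//= opprK sqrtr_sqr gtr0_norm.
Qed.

Lemma ssol_neg k t : 0 < k -> ssol (- k ^+ 2) t = sinhR (k * t) / k.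
Proof.
move=> k0; rewrite /ssol oppr_eq0 sqrf_eq0 gt_eqF// oppr_gt0.
by rewrite ltNge exprn_ge0 ?ltW//= opprK sqrtr_sqr gtr0_norm.
Qed.

Lemma csolE0 t : csol 0 t = 1. Proof. by rewrite /csol eqxx. Qed.
Lemma ssolE0 t : ssol 0 t = t. Proof. by rewrite /ssol eqxx. Qed.

Lemma energy_cases E :
  E = 0 \/ (exists2 k, 0 < k & E = k ^+ 2) \/ exists2 k, 0 < k & E = - k ^+ 2.
Proof.
have [E0|E0|->] := ltgtP E 0; last by left.
- right; right; exists (Num.sqrt (- E)); first by rewrite sqrtr_gt0 oppr_gt0.
  by rewrite sqr_sqrtr ?opprK// oppr_ge0 ltW.
- right; left; exists (Num.sqrt E); first by rewrite sqrtr_gt0.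
  by rewrite sqr_sqrtr// ltW.
Qed.

Lemma is_derive_scale (f : R -> R) a k t :
  is_derive (k * t) 1 f a -> is_derive t 1 (fun x => f (k * x)) (k * a).
Proof.
move=> df.
have := @is_derive1_comp R f (fun x => k * x) t _ _ df (derZ k (derid t)).
by move=> H; apply: (is_derive_eq H); rewrite mulr1 mulrC.
Qed.

Lemma is_derive_coshR t : is_derive t 1 coshR (sinhR t).
Proof.
have dN : is_derive t 1 (fun x => expR (-1 * x)) (-1 * expR (-1 * t)).
  exact: is_derive_scale.
have := derM (derD (is_derive_expR t) dN) (dercst t 2^-1).
have -> : (fun x => (expR x + expR (-1 * x)) * 2^-1) = coshR.
  by apply/funext => x; rewrite /coshR mulN1r.
by move=> H; apply: (is_derive_eq H); rewrite /sinhR mulN1r; ring.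
Qed.

Lemma is_derive_sinhR t : is_derive t 1 sinhR (coshR t).
Proof.
have dN : is_derive t 1 (fun x => expR (-1 * x)) (-1 * expR (-1 * t)).
  exact: is_derive_scale.
have := derM (derB (is_derive_expR t) dN) (dercst t 2^-1).
have -> : (fun x => (expR x - expR (-1 * x)) * 2^-1) = sinhR.
  by apply/funext => x; rewrite /sinhR mulN1r.
by move=> H; apply: (is_derive_eq H); rewrite /coshR mulN1r; ring.
Qed.

Lemma coshR0 : coshR 0 = 1.
Proof. by rewrite /coshR oppr0 expR0; field. Qed.

Lemma sinhR0 : sinhR 0 = 0.
Proof. by rewrite /sinhR oppr0 subrr mul0r. Qed.

Lemma csol0 E : csol E 0 = 1.
Proof. by rewrite /csol !mulr0 cos0 coshR0; case: ifP => //; case: ifP. Qed.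

Lemma ssol0 E : ssol E 0 = 0.
Proof. by rewrite /ssol !mulr0 sin0 sinhR0 !mul0r; case: ifP => //; case: ifP. Qed.

Lemma is_derive_csol E t : is_derive t 1 (csol E) (- E * ssol E t).
Proof.
have [->|[[k k0 ->]|[k k0 ->]]] := energy_cases E.
- have -> : csol 0 = fun=> 1 by apply/funext => x; rewrite csolE0.
  by rewrite oppr0 mul0r; exact: dercst.
- have -> : csol (k ^+ 2) = fun x => cos (k * x) by apply/funext => x; rewrite csol_pos.
  apply: (is_derive_eq (is_derive_scale (is_derive_cos (k * t)))).
  by rewrite ssol_pos//; field; rewrite gt_eqF.
- have -> : csol (- k ^+ 2) = fun x => coshR (k * x) by apply/funext => x; rewrite csol_neg.
  apply: (is_derive_eq (is_derive_scale (is_derive_coshR (k * t)))).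
  by rewrite ssol_neg//; field; rewrite gt_eqF.
Qed.

Lemma is_derive_ssol E t : is_derive t 1 (ssol E) (csol E t).
Proof.
have [->|[[k k0 ->]|[k k0 ->]]] := energy_cases E.
- have -> : ssol 0 = fun x => x by apply/funext => x; rewrite ssolE0.
  by rewrite csolE0; exact: derid.
- have -> : ssol (k ^+ 2) = fun x => k^-1 * sin (k * x).
    by apply/funext => x; rewrite ssol_pos// mulrC.
  apply: (is_derive_eq (derZ k^-1 (is_derive_scale (is_derive_sin (k * t))))).
  by rewrite csol_pos//; field; rewrite gt_eqF.
- have -> : ssol (- k ^+ 2) = fun x => k^-1 * sinhR (k * x).
    by apply/funext => x; rewrite ssol_neg// mulrC.
  apply: (is_derive_eq (derZ k^-1 (is_derive_scale (is_derive_sinhR (k * t))))).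
  by rewrite csol_neg//; field; rewrite gt_eqF.
Qed.

Lemma coshR2_sinhR2 t : coshR t ^+ 2 - sinhR t ^+ 2 = 1.
Proof.
rewrite /coshR /sinhR expRN; have : expR t != 0 by rewrite gt_eqF ?expR_gt0.
by move: (expR t) => e e0; field.
Qed.

(** The transfer matrix with rows [(c, s)] and [(- E s, c)] has determinant 1. This lets Cauchy data
    be inverted and transported later without splitting on the sign of [E]. *)
Lemma csol2_ssol2 E t : csol E t ^+ 2 + E * ssol E t ^+ 2 = 1.
Proof.
have [->|[[k k0 ->]|[k k0 ->]]] := energy_cases E.
- by rewrite csolE0 mul0r addr0 expr1n.
- by rewrite csol_pos// ssol_pos// -(cos2Dsin2 (k * t)); field; rewrite gt_eqF.
- by rewrite csol_neg// ssol_neg// -(coshR2_sinhR2 (k * t)); field; rewrite gt_eqF.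
Qed.

End Solutions.

(** * Square-integrable functions on one edge *)

Section EdgeL2.
Variable R : realType.
Implicit Types (f g : R -> R) (t l : R).
Local Notation mu := (@lebesgue_measure R).

Lemma edge_L2sq_ge0 f l : (0 <= edge_L2sq f l)%E.
Proof. by apply: integral_ge0 => x _; rewrite lee_fin sqr_ge0. Qed.

Lemma measurable_sqr f (D : set R) : measurable_fun D f ->
  measurable_fun D (EFin \o (fun x => f x ^+ 2)).
Proof. by move=> mf; apply/measurable_EFinP; exact: measurable_funX. Qed.

Lemma lebesgue_measure_cc0 l : 0 <= l -> mu `[0, l]%classic = l%:E.
Proof.
move=> l0; have [l1|l1] := eqVneq l 0.
  by rewrite l1 set_itv1 lebesgue_measure_set1.
by rewrite lebesgue_measure_itv/= lte_fin lt_neqAle eq_sym l1 l0 oppr0 adde0.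
Qed.

Lemma le_edge_L2sq f g l : measurable_fun `[0, l] f -> measurable_fun `[0, l] g ->
  (forall t, 0 <= t <= l -> f t ^+ 2 <= g t ^+ 2) ->
  (edge_L2sq f l <= edge_L2sq g l)%E.
Proof.
move=> mf mg fg; apply: ge0_le_integral => //=.
- by move=> x _; rewrite lee_fin sqr_ge0.
- exact: measurable_sqr.
- exact: measurable_sqr.
Qed.

Lemma edge_L2sq_scale f l k : measurable_fun `[0, l] f ->
  edge_L2sq (fun t => k * f t) l = ((k ^+ 2)%:E * edge_L2sq f l)%E.
Proof.
move=> mf; rewrite /edge_L2sq -ge0_integralZl_EFin//.
- by apply: eq_integral => x _; rewrite exprMn EFinM.
- by move=> x _; rewrite lee_fin sqr_ge0.
- exact: measurable_sqr.
- exact: sqr_ge0.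
Qed.

Lemma edge_L2sq_cst l k : 0 <= l -> edge_L2sq (fun _ : R => k) l = (k ^+ 2 * l)%:E.
Proof.
by move=> l0; rewrite /edge_L2sq integral_cst//= lebesgue_measure_cc0.
Qed.

Lemma edge_L2sq_le_cst f l M : 0 <= l -> measurable_fun `[0, l] f ->
  (forall t, 0 <= t <= l -> f t ^+ 2 <= M) -> (edge_L2sq f l <= (M * l)%:E)%E.
Proof.
move=> l0 mf fM; have M0 : 0 <= M.
  by apply: le_trans (fM 0 _); rewrite ?sqr_ge0// lexx.
rewrite -(sqr_sqrtr M0) -edge_L2sq_cst//; apply: le_edge_L2sq => //.
by move=> t tl; rewrite sqr_sqrtr//; exact: fM.
Qed.

Lemma continuous_measurable_cc f l : (forall t, 0 <= t <= l -> {for t, continuous f}) ->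
  measurable_fun `[0, l] f.
Proof.
move=> cf; apply: subspace_continuous_measurable_fun => //.
exact: continuous_within_cc.
Qed.

Lemma edge_L2sqD f g l : measurable_fun `[0, l] f -> measurable_fun `[0, l] g ->
  (edge_L2sq (fun t => f t + g t)%R l <= 2%:E * edge_L2sq f l + 2%:E * edge_L2sq g l)%E.
Proof.
move=> mf mg; rewrite /edge_L2sq -!ge0_integralZl_EFin//; last 4 first.
- by move=> x _; rewrite lee_fin sqr_ge0.
- exact: measurable_sqr.
- by move=> x _; rewrite lee_fin sqr_ge0.
- exact: measurable_sqr.
rewrite -ge0_integralD//; last 4 first.
- by move=> x _; rewrite -EFinM lee_fin mulr_ge0// sqr_ge0.
- apply: emeasurable_funM => //; exact: measurable_sqr.
- by move=> x _; rewrite -EFinM lee_fin mulr_ge0// sqr_ge0.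
- apply: emeasurable_funM => //; exact: measurable_sqr.
apply: ge0_le_integral => //=.
- by move=> x _; rewrite lee_fin sqr_ge0.
- by apply: measurable_sqr; exact: measurable_funD.
- by apply: emeasurable_funD; apply: emeasurable_funM => //; exact: measurable_sqr.
move=> x _; rewrite -!EFinM -EFinD lee_fin -subr_ge0.
have -> : 2 * f x ^+ 2 + 2 * g x ^+ 2 - (f x + g x) ^+ 2 = (f x - g x) ^+ 2 by ring.
exact: sqr_ge0.
Qed.

Lemma L2_integrable_sqr f l : measurable_fun `[0, l] f -> (edge_L2sq f l < +oo)%E ->
  mu.-integrable `[0, l] (EFin \o (fun x => f x ^+ 2)).
Proof.
move=> mf foo; apply/integrableP; split; first exact: measurable_sqr.
apply: le_lt_trans foo; apply: ge0_le_integral => //=.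
- apply/measurable_EFinP; apply: measurableT_comp => //; exact: measurable_funX.
- exact: measurable_sqr.
- by move=> x _; rewrite lee_fin ger0_norm ?sqr_ge0.
Qed.

(** The edge has finite length, so the bound [|f| <= 1 + f ^+ 2] is enough. *)
Lemma L2_integrable f l : measurable_fun `[0, l] f -> (edge_L2sq f l < +oo)%E ->
  mu.-integrable `[0, l] (EFin \o f).
Proof.
move=> mf foo.
have int1 : mu.-integrable `[0, l] (EFin \o (fun _ : R => 1)).
  by apply: continuous_integrable => t _; exact: cst_continuous.
apply: le_integrable (integrableD _ int1 (L2_integrable_sqr mf foo)) => //=.
  exact/measurable_EFinP.
move=> x _; rewrite lee_fin [leRHS]ger0_norm ?addr_ge0 ?sqr_ge0//.
rewrite -[f x ^+ 2]real_normK ?num_real//; move: `|f x| (normr_ge0 (f x)) => y y0.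
have [y1|/ltW y1] := leP y 1; first by rewrite (le_trans y1)// lerDl sqr_ge0.
by rewrite expr2 (le_trans (ler_peMl y0 y1))// lerDr.
Qed.

Lemma integrable_subitv f t l : t <= l -> mu.-integrable `[0, l] (EFin \o f) ->
  mu.-integrable `[0, t] (EFin \o f).
Proof.
move=> tl; apply: integrableS => //.
by move=> x /=; rewrite !in_itv/= => /andP[-> /le_trans]; apply.
Qed.

(** Cauchy-Schwarz, from the nonnegative integral of [(f - c) ^+ 2]. Both the length and the norm
    are taken on the whole edge, to have one bound for every [t]. *)
Lemma sqr_Rintegral_le f t l (N : R) : 0 < l -> 0 <= t <= l ->
  measurable_fun `[0, l] f -> edge_L2sq f l = N%:E ->
  (\int[mu]_(s in `[0, t]) f s) ^+ 2 <= l * N.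
Proof.
move=> l0 /andP[t0 tl] mf fN; set I := \int[mu]_(s in _) f s.
have foo : (edge_L2sq f l < +oo)%E by rewrite fN ltry.
have i1 := integrable_subitv tl (L2_integrable mf foo).
have i2 : mu.-integrable `[0, t] (EFin \o (fun x => f x ^+ 2)).
  by apply: (integrable_subitv tl); exact: L2_integrable_sqr.
(* This value minimizes [N + (c ^+ 2 * l - 2 * c * I)], with minimum [N - I ^+ 2 / l]. *)
pose c := I / l.
have ic : mu.-integrable `[0, t] (EFin \o (fun x => c ^+ 2)).
  by apply: continuous_integrable => s _; exact: cst_continuous.
have ifc : mu.-integrable `[0, t] (EFin \o (fun x => 2 * c * f x)).
  have -> : EFin \o (fun x => 2 * c * f x) = (fun x => (2 * c)%:E * (EFin \o f) x)%E.
    by apply/funext => x /=; rewrite EFinM.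
  exact: integrableZl.
have ifc2 : mu.-integrable `[0, t] (EFin \o (fun x => c ^+ 2 - 2 * c * f x)).
  have -> : EFin \o (fun x => c ^+ 2 - 2 * c * f x) =
    ((EFin \o (fun x => c ^+ 2)%R) \- (EFin \o (fun x => 2 * c * f x)%R))%E.
    by apply/funext => x /=; rewrite EFinB.
  exact: integrableB.
have ec : \int[mu]_(s in `[0, t]) (c ^+ 2) = c ^+ 2 * t.
  rewrite Rintegral_cst//; congr (_ * _).
  exact: (congr1 fine (lebesgue_measure_cc0 t0)).
have : 0 <= \int[mu]_(s in `[0, t]) ((f s ^+ 2) + (c ^+ 2 - 2 * c * f s)).
  apply: Rintegral_ge0 => s _.
  have -> : f s ^+ 2 + (c ^+ 2 - 2 * c * f s) = (f s - c) ^+ 2 by ring.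
  exact: sqr_ge0.
rewrite RintegralD// RintegralB// ec RintegralZl// -/I.
set J := \int[mu]_(x in _) f x ^+ 2 => H.
have JN : J <= N.
  rewrite -lee_fin -fN /J /Rintegral fineK; last exact: integrable_fin_num.
  apply: ge0_subset_integral => //.
  - exact: measurable_sqr.
  - by move=> x _; rewrite lee_fin sqr_ge0.
  - by move=> x /=; rewrite !in_itv/= => /andP[-> /le_trans]; apply.
have {}H : 0 <= N + (c ^+ 2 * l - 2 * c * I).
  apply: le_trans H _; apply: lerD => //; rewrite lerD2r.
  by rewrite ler_wpM2l// sqr_ge0.
have e : N + (c ^+ 2 * l - 2 * c * I) = N - I ^+ 2 / l.
  by rewrite /c; field; rewrite gt_eqF.
by move: H; rewrite e subr_ge0 ler_pdivrMr// mulrC.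
Qed.

End EdgeL2.

(** * Cauchy problem on an edge: growth and coercivity, uniform in the energy *)

Section EdgeSolutions.
Variable R : realType.
Implicit Types (E x y t l : R).
Local Notation mu := (@lebesgue_measure R).

Definition esol E x y t : R := x * csol E t + y * ssol E t.
Definition desol E x y t : R := y * csol E t - E * x * ssol E t.

Lemma is_derive_esol E x y t : is_derive t 1 (esol E x y) (desol E x y t).
Proof.
apply: (is_derive_eq (derD (derZ x (is_derive_csol E t)) (derZ y (is_derive_ssol E t)))).
by rewrite /desol; ring.
Qed.

Lemma is_derive_desol E x y t : is_derive t 1 (desol E x y) (- E * esol E x y t).
Proof.
apply: (is_derive_eq (derB (derZ y (is_derive_csol E t)) (derZ (E * x) (is_derive_ssol E t)))).
by rewrite /esol; ring.
Qed.

Lemma esol0 E x y : esol E x y 0 = x.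
Proof. by rewrite /esol csol0 ssol0 mulr1 mulr0 addr0. Qed.

Lemma desol0 E x y : desol E x y 0 = y.
Proof. by rewrite /desol csol0 ssol0 mulr1 mulr0 subr0. Qed.

Lemma esol_continuous E x y t : {for t, continuous (esol E x y)}.
Proof. exact: der_continuous (is_derive_esol E x y t). Qed.

Lemma desol_continuous E x y t : {for t, continuous (desol E x y)}.
Proof. exact: der_continuous (is_derive_desol E x y t). Qed.

(** Grönwall applied to [psi^2 + psi'^2]: its derivative [2 (1 - E) psi psi'] is at most [1 + |E|]
    times the quantity itself. *)
Lemma esol_energy E x y t : 0 <= t ->
  esol E x y t ^+ 2 + desol E x y t ^+ 2 <= expR ((1 + `|E|) * t) * (x ^+ 2 + y ^+ 2).
Proof.
move=> t0.
pose F t := esol E x y t * esol E x y t + desol E x y t * desol E x y t.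
suff : F t <= expR ((1 + `|E|) * t) * F 0 by rewrite /F esol0 desol0 -!expr2.
apply: (@is_derive_sq_le R F (fun t => 2 * (1 - E) * (esol E x y t * desol E x y t))) => // s _.
  have d1 := is_derive_esol E x y s; have d2 := is_derive_desol E x y s.
  by apply: (is_derive_eq (derD (derM d1 d1) (derM d2 d2))); ring.
rewrite /F; set p := esol _ _ _ _; set q := desol _ _ _ _.
have hE : `|1 - E| <= 1 + `|E| by rewrite (le_trans (ler_normB _ _))// normr1.
have hpq : `|2 * (p * q)| <= p * p + q * q.
  rewrite ler_norml -subr_ge0 -[X in _ && X]subr_ge0.
  have -> : 2 * (p * q) - - (p * p + q * q) = (p + q) ^+ 2 by ring.
  have -> : p * p + q * q - 2 * (p * q) = (p - q) ^+ 2 by ring.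
  by rewrite !sqr_ge0.
have -> : 2 * (1 - E) * (p * q) = (1 - E) * (2 * (p * q)) by ring.
by rewrite (le_trans (ler_norm _))// normrM ler_pM.
Qed.

(* Test the equation against a polynomial [p] vanishing to second order at [l]:
   integrating [psi p'' - psi'' p] leaves only the boundary terms at 0. *)
Lemma esol_test_poly l (M : R) (p : {poly R}) : 0 < l -> p.[l] = 0 -> p^`().[l] = 0 ->
  exists2 K, 0 < K & forall E, `|E| <= M -> forall x y N,
    edge_L2sq (esol E x y) l = N%:E -> (y * p.[0] - x * p^`().[0]) ^+ 2 <= K * N.
Proof.
move=> l0 pl dpl.
have cont (q : {poly R}) t : {for t, continuous (horner q)}.
  exact: der_continuous (is_derive_poly q t).
have [B1 B10 hB1] := @continuous_bounded R (horner p) l (fun t _ => cont p t).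
have [B2 B20 hB2] := @continuous_bounded R (horner p^`()^`()) l (fun t _ => cont _ t).
pose B := B2 + `|M| * B1.
have B0 : 0 < B by rewrite ltr_wpDr// mulr_ge0// ltW.
exists (l * B ^+ 2) => [|E EM x y N hN]; first by rewrite mulr_gt0// exprn_gt0.
pose psi := esol E x y; pose dpsi := desol E x y.
pose W t := psi t * p^`().[t] - dpsi t * p.[t].
pose G t := psi t * (p^`()^`().[t] + E * p.[t]).
have dW t : is_derive t 1 W (G t).
  apply: (is_derive_eq (derB (derM (is_derive_esol E x y t) (is_derive_poly p^`() t))
    (derM (is_derive_desol E x y t) (is_derive_poly p t)))).
  by rewrite /G /psi; ring.
have cG t : {for t, continuous G}.
  have dG := derM (is_derive_esol E x y t)
    (derD (is_derive_poly p^`()^`() t) (derZ E (is_derive_poly p t))).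
  exact: der_continuous dG.
have intG : (\int[mu]_(s in `[0%R, l]) (G s)%:E)%E = (W l - W 0)%:E.
  by apply: ftc2 => [|t _]; [exact: ltW|exact: cG].
have WE : W l - W 0 = y * p.[0] - x * p^`().[0].
  by rewrite /W pl dpl /psi /dpsi esol0 desol0; ring.
have mG : measurable_fun `[0, l] G.
  by apply: continuous_measurable_cc => t _; exact: cG.
have mpsi : measurable_fun `[0, l] psi.
  by apply: continuous_measurable_cc => t _; exact: esol_continuous.
have hG : (edge_L2sq G l <= (B ^+ 2 * N)%:E)%E.
  rewrite EFinM -hN -edge_L2sq_scale//; apply: le_edge_L2sq => //.
    by apply: measurable_funM => //.
  move=> t tl; rewrite /G [B * _]mulrC !exprMn ler_wpM2l ?sqr_ge0//.
  rewrite -[leLHS]real_normK ?num_real// ler_pXn2r ?nnegrE ?normr_ge0//; last exact: ltW.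
  rewrite (le_trans (ler_normD _ _))// lerD ?hB2// normrM ler_pM ?normr_ge0 ?hB1//.
  by rewrite (le_trans EM)// ler_norm.
have Gfin : edge_L2sq G l = (fine (edge_L2sq G l))%:E.
  rewrite fineK// ge0_fin_numE ?edge_L2sq_ge0//.
  by rewrite (le_lt_trans hG)// ltry.
have ll : 0 <= l <= l by rewrite lexx ltW.
have := @sqr_Rintegral_le R G l l _ l0 ll mG Gfin.
rewrite {1}/Rintegral intG /= WE => /le_trans; apply.
by rewrite -mulrA ler_wpM2l ?(ltW l0)// -lee_fin -Gfin.
Qed.

(** At a single energy this is equivalence of norms on a two-dimensional space. Test polynomials
    that do not depend on [E] make the constant uniform for [|E| <= M], as needed when the energy
    varies. *)
Lemma esol_coercive l (M : R) : 0 < l ->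
  exists2 K, 0 < K & forall E, `|E| <= M -> forall x y N,
    edge_L2sq (esol E x y) l = N%:E -> x ^+ 2 + y ^+ 2 <= K * N.
Proof.
move=> l0; have ln0 : l != 0 by rewrite gt_eqF.
pose u : {poly R} := 1%:P - l^-1 *: 'X.
have du : u^`() = (- l^-1)%:P by rewrite /u derivB derivC derivZ derivX sub0r alg_polyC polyCN.
(* The factor [u ^+ 2] is the double zero at [l]. At 0 the value and slope are [(0, 1)] for [p],
   which isolates [x], and [(1, 0)] for [q], which isolates [y]. *)
pose p := 'X * u ^+ 2; pose q := (1%:P + (2 / l) *: 'X) * u ^+ 2.
have [K1 K10 h1] : exists2 K, 0 < K & forall E, `|E| <= M -> forall x y N,
    edge_L2sq (esol E x y) l = N%:E -> (y * p.[0] - x * p^`().[0]) ^+ 2 <= K * N.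
  apply: esol_test_poly => //.
    by rewrite /p !hornerE /=; field.
  by rewrite /p expr2 !derivM du derivX !hornerE /=; field.
have [K2 K20 h2] : exists2 K, 0 < K & forall E, `|E| <= M -> forall x y N,
    edge_L2sq (esol E x y) l = N%:E -> (y * q.[0] - x * q^`().[0]) ^+ 2 <= K * N.
  apply: esol_test_poly => //.
    by rewrite /q !hornerE /=; field.
  by rewrite /q expr2 !derivM du derivD derivC derivZ derivX !hornerE /=; field.
exists (K1 + K2) => [|E EM x y N hN]; first exact: addr_gt0.
rewrite mulrDl; apply: lerD.
  move: (h1 E EM x y N hN).
  rewrite /p expr2 !derivM du derivX !hornerE /=.
  by congr (_ <= _); ring.
move: (h2 E EM x y N hN).
rewrite /q expr2 !derivM du derivD derivC derivZ derivX !hornerE /=.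
by congr (_ <= _); field.
Qed.

End EdgeSolutions.

(** * Uniqueness for the edge equation in integrated form *)

Section EdgeEquation.
Variable R : realType.
Implicit Types (E x y t l : R) (f g psi p : R -> R).
Local Notation mu := (@lebesgue_measure R).

Lemma is_derive_primitive f l x : mu.-integrable `[0, l] (EFin \o f) -> 0 < x < l ->
  {for x, continuous f} -> is_derive x 1 (fun t => \int[mu]_(s in `[0, t]) f s) (f x).
Proof.
move=> fi /andP[x0 xl] cf.
have [df ddf] := continuous_FTC1_closed xl fi x0 cf.
by apply: (DeriveDef df); rewrite -derive1E ddf.
Qed.

Lemma withinD (A : set R) f g : {within A, continuous f} -> {within A, continuous g} ->
  {within A, continuous (fun x => f x + g x)}.
Proof. by move=> cf cg x; apply: cvgD; [exact: cf|exact: cg]. Qed.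

Lemma withinB (A : set R) f g : {within A, continuous f} -> {within A, continuous g} ->
  {within A, continuous (fun x => f x - g x)}.
Proof. by move=> cf cg x; apply: cvgB; [exact: cf|exact: cg]. Qed.

Lemma withinM (A : set R) f g : {within A, continuous f} -> {within A, continuous g} ->
  {within A, continuous (fun x => f x * g x)}.
Proof. by move=> cf cg x; apply: cvgM; [exact: cf|exact: cg]. Qed.

Lemma within_cst (A : set R) (k : R) : {within A, continuous (fun _ : R => k)}.
Proof. by move=> x; exact: cvg_cst. Qed.

Lemma within_is_derive0_eq f t : 0 < t -> (forall x, x \in `]0, t[ -> is_derive x 1 f 0) ->
  {within `[0, t], continuous f} -> f t = f 0.
Proof.
move=> t0 df cf; have [x _] := MVT t0 df cf.
by rewrite mul0r => /eqP; rewrite subr_eq0 => /eqP.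
Qed.

(** The hypotheses are integral equations with L2 integrands, so continuity and then
    differentiability must be gained before any Wronskian argument. *)
Lemma edge_eq_unique psi p l E : 0 < l ->
  measurable_fun `[0, l] psi -> measurable_fun `[0, l] p ->
  (edge_L2sq psi l < +oo)%E -> (edge_L2sq p l < +oo)%E ->
  (forall t, 0 <= t <= l ->
     (psi t)%:E = ((psi 0)%:E + \int[mu]_(s in `[0%R, t]) (p s)%:E)%E /\
     (p t)%:E = ((p 0)%:E - \int[mu]_(s in `[0%R, t]) (E * psi s)%:E)%E) ->
  forall t, 0 <= t <= l -> psi t = esol E (psi 0) (p 0) t /\ p t = desol E (psi 0) (p 0) t.
Proof.
move=> l0 mpsi mp ipsi ip heq t /andP[t0 tl].
have Ipsi := L2_integrable mpsi ipsi; have Ip := L2_integrable mp ip.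
have IEpsi : mu.-integrable `[0, l] (EFin \o (fun s => E * psi s)).
  have -> : EFin \o (fun s => E * psi s) = (fun s => E%:E * (EFin \o psi) s)%E.
    by apply/funext => s /=; rewrite EFinM.
  exact: integrableZl.
(* [psi] and [p] are constrained only on [[0, l]]. Their regularity is read off these primitives,
   which coincide with them there. *)
pose P s := psi 0 + \int[mu]_(r in `[0, s]) p r.
pose Q s := p 0 - \int[mu]_(r in `[0, s]) (E * psi r).
have PE s : 0 <= s <= l -> psi s = P s.
  move=> sl; have [+ _] := heq s sl; rewrite /P /Rintegral => /(congr1 fine) /= ->.
  rewrite fineD//; apply: integrable_fin_num => //.
  by apply: (integrable_subitv _ Ip); case/andP: sl.
have QE s : 0 <= s <= l -> p s = Q s.
  move=> sl; have [_ +] := heq s sl; rewrite /Q /Rintegral => /(congr1 fine) /= ->.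
  rewrite fineB//; apply: integrable_fin_num => //.
  by apply: (integrable_subitv _ IEpsi); case/andP: sl.
have cP : {within `[0, l], continuous P}.
  apply: withinD; first exact: within_cst.
  exact: (parameterized_integral_continuous (ltW l0) Ip).
have cQ : {within `[0, l], continuous Q}.
  apply: withinB; first exact: within_cst.
  exact: (parameterized_integral_continuous (ltW l0) IEpsi).
have oocc s : s \in `]0, l[ -> 0 <= s <= l by rewrite in_itv/= => /andP[/ltW -> /ltW ->].
have nearE (g h : R -> R) s : s \in `]0, l[ -> (forall r, 0 <= r <= l -> g r = h r) ->
    {within `[0, l], continuous h} -> {for s, continuous g}.
  move=> sl gh ch; have := ch; rewrite (continuous_within_itvP _ l0) => -[cio _ _].
  have nl : \forall r \near s, h r = g r.
    have := near_in_itvoo sl; apply: filterS => r rl; apply/esym/gh; exact: oocc.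
  have e : g s = h s by apply: gh; exact: oocc.
  rewrite /prop_for /continuous_at e.
  by apply: cvg_trans (cio s sl); apply: near_eq_cvg.
have dP s : s \in `]0, l[ -> is_derive s 1 P (Q s).
  move=> sl; rewrite -QE ?oocc//.
  have := derD (dercst s (psi 0)) (is_derive_primitive Ip _ (nearE p Q s sl QE cQ)).
  by rewrite add0r; apply; move: sl; rewrite in_itv.
have dQ s : s \in `]0, l[ -> is_derive s 1 Q (- E * P s).
  move=> sl; rewrite -PE ?oocc//.
  have cE : {for s, continuous (fun r => E * psi r)}.
    by apply: cvgM; [exact: cvg_cst|exact: (nearE psi P)].
  have := derB (dercst s (p 0)) (is_derive_primitive IEpsi _ cE).
  by rewrite sub0r mulNr; apply; move: sl; rewrite in_itv.
clearbody P Q.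
have c0 := csol0 E; have s0 := ssol0 E.
have P0 : P 0 = psi 0 by rewrite -PE// lexx ltW.
have Q0 : Q 0 = p 0 by rewrite -QE// lexx ltW.
have [t00|t0'] := eqVneq t 0; first by rewrite t00 esol0 desol0.
have {t0 t0'}t0 : 0 < t by rewrite lt_neqAle eq_sym t0'.
have sub0t : `[0, t] `<=` `[0, l].
  by move=> s /=; rewrite !in_itv/= => /andP[-> /le_trans]; apply.
have cP' := continuous_subspaceW sub0t cP; have cQ' := continuous_subspaceW sub0t cQ.
have tlo s : s \in `]0, t[ -> s \in `]0, l[.
  by rewrite !in_itv/= => /andP[-> /lt_le_trans]; apply.
have cin (g : R -> R) : continuous g -> {within `[0, t], continuous g}.
  exact: continuous_subspaceT.
have cc : continuous (csol E) by move=> s; exact: der_continuous (is_derive_csol E s).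
have cs : continuous (ssol E) by move=> s; exact: der_continuous (is_derive_ssol E s).
(* [W1] and [W2] apply the inverse transfer matrix to [(P, Q)]. Both expressions have zero
   derivative and keep the initial data; determinant 1 then recovers [P t] and [Q t]. *)
have W1 : P t * csol E t - Q t * ssol E t = psi 0.
  have <- : P 0 * csol E 0 - Q 0 * ssol E 0 = psi 0.
    by rewrite c0 s0 P0 mulr1 mulr0 subr0.
  have dW s : s \in `]0, t[ -> is_derive s 1 (fun s => P s * csol E s - Q s * ssol E s) 0.
    move=> st; have sl := tlo s st.
    have H := derB (derM (dP s sl) (is_derive_csol E s)) (derM (dQ s sl) (is_derive_ssol E s)).
    by apply: (is_derive_eq H); ring.
  apply: (within_is_derive0_eq t0 dW).
  by apply: withinB; apply: withinM => //; exact: cin.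
have W2 : Q t * csol E t + E * (P t * ssol E t) = p 0.
  have <- : Q 0 * csol E 0 + E * (P 0 * ssol E 0) = p 0.
    by rewrite c0 s0 Q0 mulr1 !mulr0 addr0.
  have dW s : s \in `]0, t[ ->
      is_derive s 1 (fun s => Q s * csol E s + E * (P s * ssol E s)) 0.
    move=> st; have sl := tlo s st.
    have H := derD (derM (dQ s sl) (is_derive_csol E s))
      (derZ E (derM (dP s sl) (is_derive_ssol E s))).
    by apply: (is_derive_eq H); ring.
  apply: (within_is_derive0_eq t0 dW).
  apply: withinD; first by apply: withinM => //; exact: cin.
  apply: withinM; first exact: within_cst.
  by apply: withinM => //; exact: cin.
rewrite (PE t) ?(QE t) ?(ltW t0)//; have h1 := csol2_ssol2 E t.
rewrite /esol /desol -W1 -W2; split.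
  by rewrite -[LHS]mulr1 -h1; ring.
by rewrite -[LHS]mulr1 -h1; ring.
Qed.

End EdgeEquation.

(** * The inhomogeneous Cauchy problem on an edge with an L2 source *)

Section EdgeResolvent.
Variable R : realType.
Implicit Types (E x y t l : R) (f g h w q : R -> R).
Local Notation mu := (@lebesgue_measure R).

(** The derivative is two-sided even at 0 and [l]. Hence the integral starts at -1, its domain goes
    on to [l + 1/2], and the primitive is renormalized to vanish at 0. *)
Lemma primitive_exists h (m l : R) : m < -1 -> 0 < l ->
  (forall t, m < t < l + 1 -> {for t, continuous h}) ->
  exists2 H : R -> R, H 0 = 0 & forall t, 0 <= t <= l -> is_derive t 1 H (h t).
Proof.
move=> m1 l0 ch; pose u := l + 2^-1.
have hi : mu.-integrable `[-1, u] (EFin \o h).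
  apply: continuous_compact_integrable; first exact: segment_compact.
  apply/continuous_in_subspaceT => t; rewrite inE/= in_itv/= => /andP[t1 tu].
  by apply: ch; rewrite (lt_le_trans m1)//= (le_lt_trans tu)// ltrD2l invf_lt1// ltr1n.
pose H t := \int[mu]_(s in `[-1, t]) h s.
exists (fun t => H t - H 0) => [|t /andP[t0 tl]]; first by rewrite subrr.
have [dH dHE] : derivable H t 1 /\ derive1 H t = h t.
  apply: (continuous_FTC1_closed _ hi).
  - by rewrite (le_lt_trans tl)// ltrDl invr_gt0.
  - by rewrite (lt_le_trans _ t0)// ltrN10.
  - apply: ch; rewrite (lt_le_trans _ t0) ?(lt_trans m1) ?ltrN10//=.
    by rewrite (le_lt_trans tl)// ltrDl.
have dH' : is_derive t 1 H (h t) by apply: (DeriveDef dH); rewrite -derive1E dHE.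
by have := derB dH' (dercst t (H 0)); rewrite subr0.
Qed.

Lemma is_derive_norm_le f g t M : 0 <= t -> f 0 = 0 ->
  (forall s, 0 <= s <= t -> is_derive s 1 f (g s)) ->
  (forall s, 0 <= s <= t -> `|g s| <= M) -> `|f t| <= M * t.
Proof.
move=> t0 f0 df gM; rewrite ler_norml; apply/andP; split.
  have d s : 0 <= s <= t -> is_derive s 1 (fun r => M * r + f r) (M * 1 + g s).
    by move=> st; exact: derD (derZ M (derid s)) (df s st).
  have : M * 0 + f 0 <= M * t + f t.
    apply: (is_derive_nonneg_le t0 d) => s st.
    by have := gM s st; rewrite ler_norml => /andP[? ?]; lra.
  by rewrite mulr0 f0; lra.
have d s : 0 <= s <= t -> is_derive s 1 (fun r => M * r - f r) (M * 1 - g s).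
  by move=> st; exact: derB (derZ M (derid s)) (df s st).
have : M * 0 - f 0 <= M * t - f t.
  apply: (is_derive_nonneg_le t0 d) => s st.
  by have := gM s st; rewrite ler_norml => /andP[? ?]; lra.
by rewrite mulr0 f0; lra.
Qed.

(** Extending [f] by zero and integrating from -2 makes the primitive continuous beyond both ends of
    the edge, the form that [primitive_exists] consumes. *)
Lemma L2_primitive_continuous f l : 0 < l -> measurable_fun `[0, l] f ->
  (edge_L2sq f l < +oo)%E -> exists Phi : R -> R,
    (forall t, 0 <= t <= l -> Phi t = \int[mu]_(s in `[0, t]) f s) /\
    forall t, -2 < t < l + 1 -> {for t, continuous Phi}.
Proof.
move=> l0 mf foo; have fi := L2_integrable mf foo.
pose f1 : R -> R := f \_ `[0, l].
pose Phi t := \int[mu]_(s in `[-2, t]) f1 s.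
have f1i : mu.-integrable `[-2, l + 1] (EFin \o f1).
  have : mu.-integrable (`[-2, l + 1] `&` `[0, l]) (EFin \o f).
    by apply: (integrableS _ _ _ fi) => //; (exact: measurableI || exact: subIsetr).
  by move/integrable_restrict; rewrite restrict_EFin; apply.
exists Phi; split=> [t /andP[t0 tl]|t tl].
  rewrite /Phi /f1 -Rintegral_mkcondr; congr Rintegral.
  apply/seteqP; split=> s /=; rewrite !in_itv/=; first by move=> [/andP[_ ->] /andP[-> _]].
  by move=> /andP[s0 st]; split; apply/andP; split; lra.
have ml : -2 < l + 1 by lra.
have := parameterized_integral_continuous (ltW ml) f1i.
by rewrite (continuous_within_itvP _ ml) => -[+ _ _]; apply; rewrite in_itv.
Qed.

(* Variation of parameters. With [Phi] the primitive of [f], integrating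
   [- int_0^t s(t - r) f(r) dr] by parts gives [w = - int_0^t c(t - r) Phi(r) dr],
   which only involves continuous integrands. *)
Lemma edge_solve l E : 0 < l -> exists2 K, 0 <= K &
  forall f N, measurable_fun `[0, l] f -> edge_L2sq f l = N%:E ->
  exists w q : R -> R,
    [/\ w 0 = 0 /\ q 0 = 0,
        forall t, 0 <= t <= l -> {for t, continuous w} /\ {for t, continuous q},
        forall t, 0 <= t <= l ->
          (w t)%:E = (\int[mu]_(s in `[0%R, t]) (q s)%:E)%E /\
          (q t)%:E = (- \int[mu]_(s in `[0%R, t]) (E * w s + f s)%:E)%E &
        forall t, 0 <= t <= l -> w t ^+ 2 <= K * N /\ q t ^+ 2 <= K * N].
Proof.
move=> l0.
have dc := is_derive_csol E; have ds := is_derive_ssol E.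
have cc t : {for t, continuous (csol E)} := der_continuous (dc t).
have cs t : {for t, continuous (ssol E)} := der_continuous (ds t).
have [M1 M10 hM1] := @continuous_bounded R (csol E) l (fun t _ => cc t).
have [M2 M20 hM2] := @continuous_bounded R (ssol E) l (fun t _ => cs t).
pose k1 := M1 * (M1 * l) + `|E| * (M2 * (M2 * l)).
pose k2 := 1 + `|E| * (M2 * (M1 * l) + M1 * (M2 * l)).
have [k10 k20] : 0 <= k1 /\ 0 <= k2.
  by split; rewrite !addr_ge0// !mulr_ge0// ?addr_ge0// ?mulr_ge0// ltW.
exists ((k1 + k2) ^+ 2 * l) => [|f N mf fN].
  by rewrite mulr_ge0 ?sqr_ge0// ltW.
have foo : (edge_L2sq f l < +oo)%E by rewrite fN ltry.
have fi := L2_integrable mf foo.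
have N0 : 0 <= N by rewrite -lee_fin -fN edge_L2sq_ge0.
have [Phi [PhiE cPhi]] := L2_primitive_continuous l0 mf foo.
have cPhil t : 0 <= t <= l -> {for t, continuous Phi}.
  move=> /andP[t0 tl]; apply: cPhi.
  apply/andP; split; lra.
(* By Cauchy-Schwarz this bounds [Phi] on the whole edge; all later bounds are multiples of it. *)
pose B := Num.sqrt (l * N).
have B0 : 0 <= B by exact: sqrtr_ge0.
have BE : B ^+ 2 = l * N by rewrite sqr_sqrtr// mulr_ge0// ltW.
have PhiB t : 0 <= t <= l -> `|Phi t| <= B.
  move=> tl; rewrite -ler_sqr ?nnegrE// BE real_normK ?num_real// PhiE//.
  exact: (sqr_Rintegral_le l0 tl mf fN).
have Phi0 : Phi 0 = 0.
  by rewrite PhiE ?lexx ?ltW// set_itv1 Rintegral_set1.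
have m1 : (-2 : R) < -1 by rewrite ltrN2 ltr1n.
have [C C0 dC] : exists2 C : R -> R, C 0 = 0 &
    forall t, 0 <= t <= l -> is_derive t 1 C (csol E t * Phi t).
  apply: (primitive_exists m1) => // t tl; apply: cvgM; [exact: cc|exact: cPhi].
have [S S0 dS] : exists2 C : R -> R, C 0 = 0 &
    forall t, 0 <= t <= l -> is_derive t 1 C (ssol E t * Phi t).
  apply: (primitive_exists m1) => // t tl; apply: cvgM; [exact: cs|exact: cPhi].
have subl t s : 0 <= t <= l -> 0 <= s <= t -> 0 <= s <= l.
  by move=> /andP[_ tl] /andP[-> /le_trans]; apply.
have CB t : 0 <= t <= l -> `|C t| <= M1 * l * B.
  move=> tl; have /andP[t0 tl'] := tl.
  apply: le_trans (is_derive_norm_le t0 C0 (fun s st => dC s (subl t s tl st)) _) _.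
    move=> s st; have sl := subl t s tl st; rewrite normrM.
    by apply: ler_pM (hM1 s sl) (PhiB s sl).
  by rewrite mulrAC ler_wpM2r// ler_wpM2l// ltW.
have SB t : 0 <= t <= l -> `|S t| <= M2 * l * B.
  move=> tl; have /andP[t0 tl'] := tl.
  apply: le_trans (is_derive_norm_le t0 S0 (fun s st => dS s (subl t s tl st)) _) _.
    move=> s st; have sl := subl t s tl st; rewrite normrM.
    by apply: ler_pM (hM2 s sl) (PhiB s sl).
  by rewrite mulrAC ler_wpM2r// ler_wpM2l// ltW.
(* The addition formulas [c(t - r) = c(t) c(r) + E s(t) s(r)] and [s(t - r) = s(t) c(r) - c(t) s(r)]
   separate the variables. Only [z] is differentiable in general; [q] is no more regular than
   [Phi]. *)
pose w t := - (csol E t * C t + E * (ssol E t * S t)).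
pose z t := E * (ssol E t * C t - csol E t * S t).
pose q t := z t - Phi t.
have dw t : 0 <= t <= l -> is_derive t 1 w (q t).
  move=> tl.
  have H := derN (derD (derM (dc t) (dC t tl)) (derZ E (derM (ds t) (dS t tl)))).
  apply: (is_derive_eq H); rewrite /q /z -[X in _ = _ - X]mulr1 -(csol2_ssol2 E t).
  by ring.
have dz t : 0 <= t <= l -> is_derive t 1 z (- (E * w t)).
  move=> tl.
  have H := derZ E (derB (derM (ds t) (dC t tl)) (derM (dc t) (dS t tl))).
  by apply: (is_derive_eq H); rewrite /w; ring.
have cw t : 0 <= t <= l -> {for t, continuous w}.
  by move=> tl; exact: der_continuous (dw t tl).
have cz t : 0 <= t <= l -> {for t, continuous z}.
  by move=> tl; exact: der_continuous (dz t tl).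
have cq t : 0 <= t <= l -> {for t, continuous q}.
  by move=> tl; apply: cvgB; [exact: cz|exact: cPhil].
have w0 : w 0 = 0 by rewrite /w C0 S0 !mulr0 addr0 oppr0.
have z0 : z 0 = 0 by rewrite /z C0 S0 !mulr0 subr0 mulr0.
exists w, q; split.
- by split => //; rewrite /q z0 Phi0 subr0.
- by move=> t tl; split; [exact: cw|exact: cq].
- move=> t tl; have /andP[t0 tl'] := tl; split.
    have -> := ftc2 t0 (fun s st => dw s (subl t s tl st)) (fun s st => cq s (subl t s tl st)).
    by rewrite w0 subr0.
  have dNz s : 0 <= s <= t -> is_derive s 1 (fun r => - z r) (E * w s).
    by move=> st; have := derN (dz s (subl t s tl st)); rewrite opprK.
  have cEw s : 0 <= s <= t -> {for s, continuous (fun r => E * w r)}.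
    by move=> st; apply: cvgM; [exact: cvg_cst|apply: cw; exact: subl st].
  have iEw := continuous_integrable cEw.
  under eq_integral do rewrite EFinD.
  rewrite integralD//=; last exact: (integrable_subitv tl' fi).
  have -> := ftc2 t0 dNz cEw.
  have <- : (Phi t)%:E = (\int[mu]_(s in `[0%R, t]) (f s)%:E)%E.
    rewrite PhiE// /Rintegral fineK//; apply: integrable_fin_num => //.
    exact: (integrable_subitv tl' fi).
  by rewrite z0 oppr0 subr0 -EFinD -EFinN opprD opprK.
- have wB t : 0 <= t <= l -> `|w t| <= k1 * B.
    move=> tl; rewrite /w normrN (le_trans (ler_normD _ _))// !normrM /k1 mulrDl lerD//.
      by rewrite -mulrA ler_pM ?hM1 ?CB.
    by rewrite -!mulrA ler_wpM2l// mulrA -mulrA ler_pM ?hM2// mulrA SB.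
  have qB t : 0 <= t <= l -> `|q t| <= k2 * B.
    move=> tl; rewrite /q addrC (le_trans (ler_normD _ _))// normrN /k2 mulrDl mul1r.
    rewrite lerD ?PhiB// /z normrM -mulrA ler_wpM2l// (le_trans (ler_normB _ _))//.
    rewrite !normrM mulrDl lerD//.
      by rewrite -mulrA ler_pM ?hM2 ?CB.
    by rewrite -mulrA ler_pM ?hM1 ?SB.
  move=> t tl.
  have -> : (k1 + k2) ^+ 2 * l * N = ((k1 + k2) * B) ^+ 2 by rewrite exprMn BE mulrA.
  have kB : 0 <= (k1 + k2) * B by rewrite mulr_ge0// addr_ge0.
  split; rewrite -[leLHS]real_normK ?num_real// ler_sqr ?nnegrE//.
    by rewrite (le_trans (wB t tl))// ler_wpM2r// lerDl.
  by rewrite (le_trans (qB t tl))// ler_wpM2r// lerDr.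
Qed.

End EdgeResolvent.

(** * Lattice shifts and sums over vertices and edges *)

Section Lattice.
Variables (R : realType) (d : nat).
Local Notation vertex := (vertex d).
Local Notation edge := (edge d).
Implicit Types (v : vertex) (j : 'I_d) (k : R).

Definition shiftp v j : vertex := [ffun i => v i + (i == j)%:Z].

Lemma shiftpK j : cancel (fun v => shiftp v j) (fun v => shiftm v j).
Proof. by move=> v; apply/ffunP => i; rewrite !ffunE addrK. Qed.

Lemma shiftmK j : cancel (fun v => shiftm v j) (fun v => shiftp v j).
Proof. by move=> v; apply/ffunP => i; rewrite !ffunE subrK. Qed.

Lemma esum_reindex (T : choiceType) (f g : T -> T) (h : T -> \bar R) :
  cancel f g -> cancel g f ->
  (\esum_(x in [set: T]) h (f x) = \esum_(x in [set: T]) h x)%E.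
Proof.
move=> fg gf; rewrite -(@reindex_esum R T T setT setT f h)//; split=> //.
- by move=> x y _ _ /(can_inj fg).
- by move=> x _; exists (g x).
Qed.

Lemma esum_shiftp j (h : vertex -> \bar R) :
  (\esum_(v in [set: vertex]) h (shiftp v j) = \esum_(v in [set: vertex]) h v)%E.
Proof. exact: (esum_reindex h (shiftpK j) (shiftmK j)). Qed.

Lemma esum_shiftm j (h : vertex -> \bar R) :
  (\esum_(v in [set: vertex]) h (shiftm v j) = \esum_(v in [set: vertex]) h v)%E.
Proof. exact: (esum_reindex h (shiftmK j) (shiftpK j)). Qed.

Lemma esum_le_bound (T : choiceType) (h : T -> \bar R) (M : \bar R) :
  (forall X : set T, finite_set X -> \sum_(x \in X) h x <= M)%E ->
  (\esum_(x in [set: T]) h x <= M)%E.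
Proof. by move=> hM; apply: ge_ereal_sup => _ [X [Xfin _] <-]; exact: hM. Qed.

Lemma fsum_le_esum (T : choiceType) (h : T -> \bar R) (X : set T) : finite_set X ->
  (\sum_(x \in X) h x <= \esum_(x in [set: T]) h x)%E.
Proof. by move=> Xfin; apply: esum_ge; exists X. Qed.

Lemma le_esum1 (T : choiceType) (h : T -> \bar R) x : (0 <= h x)%E ->
  (h x <= \esum_(x in [set: T]) h x)%E.
Proof.
by move=> hx; apply: esum_ge; exists [set x]; [split|rewrite fsbig_set1].
Qed.

Lemma esumZ_le (T : choiceType) k (h : T -> \bar R) : 0 <= k ->
  (forall x, 0 <= h x)%E ->
  (\esum_(x in [set: T]) (k%:E * h x) <= k%:E * \esum_(x in [set: T]) h x)%E.
Proof.
move=> k0 h0; apply: esum_le_bound => X Xfin.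
rewrite fsbig_finite//= -ge0_sume_distrr//; apply: lee_wpmul2l; first by rewrite lee_fin.
by rewrite -fsbig_finite//; exact: fsum_le_esum.
Qed.

(** Edges are sorted by direction, so that shift invariance of vertex sums can be used on each. *)
Lemma esum_edge (h : edge -> \bar R) : (forall e, 0 <= h e)%E ->
  (\esum_(e in [set: edge]) h e = \sum_(j < d) \esum_(v in [set: vertex]) h (v, j))%E.
Proof.
move=> h0; rewrite -esum_sum//.
have := @esum_esum R _ _ [set: vertex] (fun=> [set: 'I_d]) (fun v j => h (v, j)).
have -> : [set: vertex] `*`` (fun=> [set: 'I_d]) = [set: edge].
  by apply/seteqP; split.
move=> H; rewrite (eq_esum (b := fun e => h (e.1, e.2))); last by case.
have fin : finite_set [set: 'I_d] by exact: finite_finset.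
rewrite -H//; apply: eq_esum => v _; rewrite esum_fset//.
rewrite fsbig_finite//= [RHS]big_mkcond/= -big_enum/=.
apply: perm_big; apply: uniq_perm; rewrite ?finmap.fset_uniq ?enum_uniq// => j.
by rewrite mem_enum in_fset_set //; rewrite [LHS](mem_set (u := j) I).
Qed.

End Lattice.

(** * The diagonally dominant difference equation on the lattice *)

Section NeighborEquation.
Variables (R : realType) (d : nat).
Local Notation vertex := (vertex d).
Implicit Types (v : vertex) (j : 'I_d) (u g : vertex -> R) (c : 'I_d -> R).

Definition neighbor_sum c u v : R := \sum_(j < d) c j * (u (shiftp v j) + u (shiftm v j)).

Lemma cvg_sum_seq (T : Type) (s : seq T) (f : T -> nat -> R) (l : T -> R) :
  (forall i, f i n @[n --> \oo] --> l i) ->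
  (\sum_(i <- s) f i n) @[n --> \oo] --> \sum_(i <- s) l i.
Proof.
move=> fl; elim: s => [|i s ih].
  by rewrite big_nil; under eq_fun do rewrite big_nil; exact: cvg_cst.
rewrite big_cons; under eq_fun do rewrite big_cons.
by apply: cvgD; [exact: fl|exact: ih].
Qed.

Lemma neighbor_sum_norm_le c u v M : (forall w, `|u w| <= M) ->
  `|neighbor_sum c u v| <= 2 * (\sum_(j < d) `|c j|) * M.
Proof.
move=> uM; rewrite (le_trans (ler_norm_sum _ _ _))// mulr_sumr mulr_suml.
apply: ler_sum => j _; rewrite normrM.
have -> : 2 * `|c j| * M = `|c j| * (M + M) by ring.
by rewrite ler_wpM2l// (le_trans (ler_normD _ _))// lerD.
Qed.

(* Jensen's inequality for the square and the weights [|c j|] (taken twice)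
   and [1 - rho]. *)
Lemma neighbor_sum_sqr_le c u v (x : R) : 2 * (\sum_(j < d) `|c j|) < 1 ->
  (neighbor_sum c u v + x) ^+ 2 <=
  \sum_(j < d) `|c j| * (u (shiftp v j) ^+ 2 + u (shiftm v j) ^+ 2)
  + (1 - 2 * \sum_(j < d) `|c j|)^-1 * x ^+ 2.
Proof.
set r := 2 * _ => r1; have r0 : 0 < 1 - r by rewrite subr_gt0.
set m := neighbor_sum c u v + x.
pose s j := Num.sg (c j).
have cs j : c j = `|c j| * s j by rewrite mulrC -numEsg.
have cs2 j : `|c j| * s j ^+ 2 = `|c j|.
  have [->|c0] := eqVneq (c j) 0; first by rewrite normr0 mul0r.
  by rewrite /s sqr_sg c0 mulr1.
pose S := \sum_(j < d) `|c j| * (u (shiftp v j) ^+ 2 + u (shiftm v j) ^+ 2).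
pose Q := \sum_(j < d) `|c j| * ((s j * u (shiftp v j) - m) ^+ 2 +
    (s j * u (shiftm v j) - m) ^+ 2).
have QE : Q = S - 2 * m * neighbor_sum c u v + r * m ^+ 2.
  rewrite /Q /S /neighbor_sum /r 2!mulr_sumr mulr_suml -sumrB -big_split/=.
  apply: eq_bigr => j _; move: (s j) (cs j) (cs2 j) => sj.
  set k := `|c j|; move=> -> e2.
  transitivity (k * sj ^+ 2 * (u (shiftp v j) ^+ 2 + u (shiftm v j) ^+ 2)
    - 2 * m * (k * sj * (u (shiftp v j) + u (shiftm v j))) + 2 * k * m ^+ 2); first by ring.
  by rewrite e2.
have H : 0 <= Q + (1 - r) * (x / (1 - r) - m) ^+ 2.
  apply: addr_ge0; last by apply: mulr_ge0; [exact: ltW|exact: sqr_ge0].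
  by apply: sumr_ge0 => j _; rewrite mulr_ge0// addr_ge0// sqr_ge0.
rewrite -/S; move: H; rewrite QE => H.
rewrite -subr_ge0; apply: le_trans H _; rewrite le_eqVlt; apply/orP; left; apply/eqP.
have -> : neighbor_sum c u v = m - x by rewrite /m addrK.
by field; rewrite gt_eqF.
Qed.

(** A Neumann series used in two norms: the contraction in the supremum norm gives pointwise
    convergence of the iterates, the weighted Jensen bound keeps them in a fixed ball of l2, and the
    limit inherits the ball. *)
Lemma neighbor_solve c : 2 * (\sum_(j < d) `|c j|) < 1 -> exists2 C, 0 <= C &
  forall g G, (\esum_(v in [set: vertex]) (g v ^+ 2)%:E)%E = G%:E ->
  exists2 u, forall v, u v = neighbor_sum c u v + g v &
    (\esum_(v in [set: vertex]) (u v ^+ 2)%:E <= (C * G)%:E)%E.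
Proof.
move=> r1; set r := 2 * _ in r1.
have r0 : 0 <= r by rewrite mulr_ge0// sumr_ge0.
have r1' : 0 < 1 - r by rewrite subr_gt0.
exists ((1 - r)^-1 ^+ 2); first by rewrite sqr_ge0.
move=> g G gG.
have g2 v : g v ^+ 2 <= G.
  rewrite -lee_fin -gG; apply: (@le_esum1 R _ (fun v => (g v ^+ 2)%:E)).
  by rewrite lee_fin sqr_ge0.
have G0 : 0 <= G by apply: le_trans (g2 [ffun=> 0]); exact: sqr_ge0.
pose M := Num.sqrt G.
have M0 : 0 <= M by exact: sqrtr_ge0.
have gM v : `|g v| <= M.
  by rewrite -ler_sqr ?nnegrE// real_normK ?num_real// sqr_sqrtr.
pose U := fix U n v : R := if n is k.+1 then neighbor_sum c (U k) v + g v else 0.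
have US n v : U n.+1 v = neighbor_sum c (U n) v + g v by [].
have dU n v : `|U n.+1 v - U n v| <= M * r ^+ n.
  elim: n v => [|n ih] v.
    rewrite /= subr0 expr0 mulr1 /neighbor_sum big1 => [|j _].
      by rewrite add0r; exact: gM.
    by rewrite addr0 mulr0.
  have -> : U n.+2 v - U n.+1 v = neighbor_sum c (fun w => U n.+1 w - U n w) v.
    rewrite (US n.+1 v) (US n v) /neighbor_sum opprD addrACA subrr addr0.
    by rewrite -sumrB; apply: eq_bigr => j _; ring.
  rewrite (le_trans (neighbor_sum_norm_le c v ih))// -/r exprS.
  by rewrite le_eqVlt; apply/orP; left; apply/eqP; ring.
have cU v : cvgn (fun n => U n v).
  have -> : (fun n => U n v) = series (telescope (fun n => U n v)).
    by rewrite telescopeK; apply/funext => n /=; rewrite subr0.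
  apply: normed_cvg; apply: (@series_le_cvg _ _ (geometric M r)) => //.
  - by move=> n /=; exact: normr_ge0.
  - by move=> n; rewrite /geometric/= mulr_ge0// exprn_ge0.
  - by move=> n; exact: dU.
  - by apply: is_cvg_geometric_series; rewrite ger0_norm.
pose u v := limn (fun n => U n v).
have Uu v : U n v @[n --> \oo] --> u v by exact: cU.
exists u => [v|].
  have := Uu v; rewrite -cvg_shiftS /= => /cvg_lim <- //.
  apply: cvg_lim => //; apply: cvgD; last exact: cvg_cst.
  rewrite /neighbor_sum; apply: cvg_sum_seq => j.
  by apply: cvgM; [exact: cvg_cst|apply: cvgD; exact: Uu].
(* [K] is the fixed point of [K = r * K + (1 - r)^-1 * G], the recursion that one iteration produces
   for the squared norm. *)
set K := (1 - r)^-1 ^+ 2 * G.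
have SU n : (\esum_(v in [set: vertex]) (U n v ^+ 2)%:E <= K%:E)%E.
  elim: n => [|n ih].
    rewrite esum1 => [|v _]; last by rewrite /= expr0n.
    by rewrite lee_fin mulr_ge0// sqr_ge0.
  pose F j v := (`|c j|%:E * ((U n (shiftp v j) ^+ 2)%:E + (U n (shiftm v j) ^+ 2)%:E))%E.
  have F0 j v : (0 <= F j v)%E 
    by apply: mule_ge0; [rewrite lee_fin|apply: adde_ge0; rewrite lee_fin sqr_ge0].
  have EF j : (\esum_(v in [set: vertex]) F j v <= `|c j|%:E * (K%:E + K%:E))%E.
    have s0 (f : vertex -> vertex) v : (0 <= (U n (f v) ^+ 2)%:E)%E by rewrite lee_fin sqr_ge0.
    apply: (le_trans (esumZ_le (normr_ge0 _) _)) => [v|].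
      by rewrite adde_ge0 ?(s0 (fun v => shiftp v j)) ?(s0 (fun v => shiftm v j)).
    apply: lee_wpmul2l; first by rewrite lee_fin.
    rewrite esumD => [|v _|v _]; last 2 first.
      exact: (s0 (fun v => shiftp v j)).
      exact: (s0 (fun v => shiftm v j)).
    by rewrite (esum_shiftp j (fun v => (U n v ^+ 2)%:E))
      (esum_shiftm j (fun v => (U n v ^+ 2)%:E)) leeD.
  apply: (@le_trans _ _ (\esum_(v in [set: vertex])
      (\sum_(j < d) F j v + (1 - r)^-1%:E * (g v ^+ 2)%:E))%E).
    apply: le_esum => v _; rewrite -EFinM.
    under eq_bigr do rewrite /F -EFinD -EFinM.
    by rewrite sumEFin -EFinD lee_fin /=; exact: neighbor_sum_sqr_le.
  rewrite esumD; last 2 first.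
  - by move=> v _; apply: sume_ge0.
  - by move=> v _; rewrite mule_ge0// lee_fin ?sqr_ge0// invr_ge0 ltW.
  have -> : K = (\sum_(j < d) `|c j| * (K + K)) + (1 - r)^-1 * G.
    rewrite -mulr_suml; apply/eqP; rewrite -subr_eq0; apply/eqP.
    have -> : \sum_(j < d) `|c j| = r / 2 by rewrite /r mulrC mulKf.
    by rewrite /K; field; rewrite gt_eqF.
  rewrite EFinD; apply: leeD; last first.
    rewrite EFinM -gG; apply: esumZ_le => [|v]; first by rewrite invr_ge0 ltW.
    by rewrite lee_fin sqr_ge0.
  rewrite esum_sum// -sumEFin; apply: lee_sum => j _.
  by rewrite EFinM EFinD; exact: EF.
(* Fatou's argument: finite partial sums pass to the pointwise limit. *)
have key (s : seq vertex) : (forall n, \sum_(v <- s) U n v ^+ 2 <= K) ->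
    \sum_(v <- s) u v ^+ 2 <= K.
  move=> sK.
  have cX : (\sum_(v <- s) U n v ^+ 2) @[n --> \oo] --> \sum_(v <- s) u v ^+ 2.
    apply: cvg_sum_seq => v; rewrite expr2; under eq_fun do rewrite expr2.
    by apply: cvgM; exact: Uu.
  by apply: (ler_cvg_to cX (cvg_cst K)); apply: nearW => n; exact: sK.
apply: esum_le_bound => X Xfin; rewrite fsbig_finite//= sumEFin lee_fin.
apply: key => n; rewrite -lee_fin -sumEFin; apply: le_trans (SU n).
by rewrite -fsbig_finite//; exact: fsum_le_esum.
Qed.

End NeighborEquation.

(** * The Dirichlet problem on an edge and its outgoing slopes *)

Section EdgeBoundaryValue.
Variable R : realType.
Implicit Types (E x y t l : R) (f g : R -> R).
Local Notation mu := (@lebesgue_measure R).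

Lemma sqrD_le (p q : R) : (p + q) ^+ 2 <= 2 * (p ^+ 2 + q ^+ 2).
Proof.
rewrite -subr_ge0; have -> : 2 * (p ^+ 2 + q ^+ 2) - (p + q) ^+ 2 = (p - q) ^+ 2 by ring.
exact: sqr_ge0.
Qed.

Lemma sqrD3_le (p q r : R) : (p + q + r) ^+ 2 <= 4 * (p ^+ 2 + q ^+ 2 + r ^+ 2).
Proof.
apply: le_trans (sqrD_le _ _) _; have := sqrD_le p q; have := sqr_ge0 r; lra.
Qed.

(** Shooting: as [ssol E l] is nonzero, a unique initial slope [y] reaches the value [x'] at [l].
    The source changes the end slopes by [b] and [b'], which do not depend on [x] and [x']. The
    order of the quantifiers records this, since these corrections must be known before the vertex
    values are. *)
Lemma edge_bvp l E : 0 < l -> ssol E l != 0 -> exists2 K, 0 <= K &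
  forall f N, measurable_fun `[0, l] f -> edge_L2sq f l = N%:E ->
  exists b b' : R, [/\ b ^+ 2 <= K * N, b' ^+ 2 <= K * N &
  forall x x' : R, exists psi p : R -> R,
    [/\ forall t, 0 <= t <= l -> {for t, continuous psi} /\ {for t, continuous p},
        psi 0 = x /\ psi l = x',
        p 0 = (x' - csol E l * x) / ssol E l + b /\
        p l = (csol E l * x' - x) / ssol E l + b',
        forall t, 0 <= t <= l ->
         (psi t)%:E = ((psi 0)%:E + \int[mu]_(s in `[0%R, t]) (p s)%:E)%E /\
         (p t)%:E = ((p 0)%:E - \int[mu]_(s in `[0%R, t]) (E * psi s + f s)%:E)%E &
        forall t, 0 <= t <= l -> psi t ^+ 2 <= K * (x ^+ 2 + x' ^+ 2 + N) /\
          p t ^+ 2 <= K * (x ^+ 2 + x' ^+ 2 + N)]].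
Proof.
move=> l0 sl0; have [K0 K00 hK0] := edge_solve E l0.
set c := csol E l; set s := ssol E l.
pose M := expR ((1 + `|E|) * l); have M0 : 0 <= M := expR_ge0 _.
pose S := 1 + 4 * (s^-1 ^+ 2 * (1 + c ^+ 2)).
have S1 : 1 <= S by rewrite lerDl mulr_ge0// mulr_ge0 ?sqr_ge0// addr_ge0 ?sqr_ge0.
pose S' := 2 * (s^-1 ^+ 2 + (c / s) ^+ 2 + 1).
have S'0 : 0 <= S' by rewrite mulr_ge0// !addr_ge0 ?sqr_ge0.
pose K := 2 * (M * S * (1 + K0) + K0) + S' * K0.
have MS0 : 0 <= M * S by rewrite mulr_ge0// (le_trans _ S1).
have K0K : S' * K0 <= K by rewrite lerDr mulr_ge0// addr_ge0// mulr_ge0// addr_ge0.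
exists K => [|f N mf fN]; first by rewrite (le_trans _ K0K)// mulr_ge0.
have N0 : 0 <= N by rewrite -lee_fin -fN edge_L2sq_ge0.
have [w [q [[w0 q0] cwq heq hB]]] := hK0 f N mf fN.
have ll : 0 <= l <= l by rewrite lexx ltW.
have [wB qB] := hB l ll.
exists (- w l / s), (q l - c / s * w l); split.
- apply: le_trans (ler_wpM2r N0 K0K); rewrite mulNr sqrrN exprMn [leLHS]mulrC -[leRHS]mulrA.
  apply: ler_pM => //; rewrite ?sqr_ge0// /S'.
  have := sqr_ge0 (c / s); have := sqr_ge0 s^-1.
  by move: (s^-1 ^+ 2) ((c / s) ^+ 2) => z1 z2; lra.
- apply: le_trans (ler_wpM2r N0 K0K); apply: le_trans (sqrD_le _ _) _.
  rewrite sqrrN exprMn.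
  have h1 : (c / s) ^+ 2 * w l ^+ 2 <= (c / s) ^+ 2 * (K0 * N) by rewrite ler_wpM2l// sqr_ge0.
  have h2 : 0 <= s^-1 ^+ 2 * (K0 * N) by apply: mulr_ge0; [exact: sqr_ge0|exact: mulr_ge0].
  have -> : S' * K0 * N = 2 * (s^-1 ^+ 2 * (K0 * N) + (c / s) ^+ 2 * (K0 * N) + K0 * N).
    by rewrite /S'; ring.
  lra.
move=> x x'; pose y := (x' - c * x - w l) / s.
pose psi t := esol E x y t + w t; pose p t := desol E x y t + q t.
have sub t r : 0 <= t <= l -> 0 <= r <= t -> 0 <= r <= l.
  by move=> /andP[_ tl] /andP[-> /le_trans]; apply.
have iw t : 0 <= t <= l -> mu.-integrable `[0, t] (EFin \o (fun s => E * w s)).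
  move=> tl; apply: continuous_integrable => r rt; apply: cvgM; first exact: cvg_cst.
  exact: (cwq r (sub t r tl rt)).1.
exists psi, p; split.
- move=> t tl; have [cw cq] := cwq t tl; split; apply: cvgD => //.
    exact: esol_continuous.
  exact: desol_continuous.
- rewrite /psi esol0 w0 addr0; split => //.
  by rewrite /esol -/c -/s /y; field.
- rewrite /p desol0 q0 addr0; split; first by rewrite /y; field.
  rewrite /desol -/c -/s.
  have -> : c * x' - x = c * x' - (c ^+ 2 + E * s ^+ 2) * x by rewrite csol2_ssol2 mul1r.
  by rewrite /y; field.
- move=> t tl; have /andP[t0 tl'] := tl; have [h1 h2] := heq t tl.
  have de r (_ : 0 <= r <= t) := is_derive_esol E x y r.
  have dd r (_ : 0 <= r <= t) : is_derive r 1 (fun r => - desol E x y r) (E * esol E x y r).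
    by have := derN (is_derive_desol E x y r); rewrite mulNr opprK.
  have cd r (_ : 0 <= r <= t) : {for r, continuous (desol E x y)} := desol_continuous (t:=r).
  have ce r : 0 <= r <= t -> {for r, continuous (fun r => E * esol E x y r)}.
    by move=> _; apply: cvgM; [exact: cvg_cst|exact: esol_continuous].
  rewrite /psi /p esol0 desol0 w0 q0 !addr0; split.
    under eq_integral do rewrite EFinD.
    rewrite integralD//=; last 2 first.
    - exact: continuous_integrable.
    - by apply: continuous_integrable => r rt; exact: (cwq r (sub t r tl rt)).2.
    rewrite (ftc2 t0 de cd) -h1 esol0 -!EFinD; congr (_%:E); ring.
  have -> : (\int[mu]_(s in `[0%R, t]) (E * (esol E x y s + w s) + f s)%:E =
     \int[mu]_(s in `[0%R, t]) ((E * esol E x y s)%:E + (E * w s + f s)%:E))%E.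
    by apply: eq_integral => r _; rewrite -EFinD mulrDr addrA.
  have fi := integrable_subitv tl' (L2_integrable mf (eq_ind_r (fun z => z < +oo)%E (ltry N) fN)).
  rewrite integralD//=; last 2 first.
  - exact: continuous_integrable.
  - have := integrableD _ (iw t tl) fi; apply=> //.
  rewrite (ftc2 t0 dd ce) desol0 oppeD//.
  rewrite addeA -h2 -EFinN -!EFinD; congr (_%:E); ring.
move=> t tl; have /andP[t0 tl'] := tl; have [wt qt] := hB t tl.
have hM : expR ((1 + `|E|) * t) <= M.
  by rewrite ler_expR ler_wpM2l// addr_ge0.
have hy : y ^+ 2 <= 4 * (s^-1 ^+ 2 * (1 + c ^+ 2)) * (x ^+ 2 + x' ^+ 2 + K0 * N).
  have -> : y = s^-1 * x' + (- (s^-1 * (c * x))) + - (s^-1 * w l) by rewrite /y; field.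
  apply: le_trans (sqrD3_le _ _ _) _; rewrite -mulrA ler_wpM2l// !sqrrN !exprMn.
  rewrite -!mulrDr -mulrA ler_wpM2l ?sqr_ge0//.
  rewrite !(mulrDl 1) mul1r.
  have -> : x' ^+ 2 + c ^+ 2 * x ^+ 2 + w l ^+ 2 = c ^+ 2 * x ^+ 2 + x' ^+ 2 + w l ^+ 2 by ring.
  rewrite !mulrDr.
  have := sqr_ge0 x; have : 0 <= c ^+ 2 * x' ^+ 2 by rewrite mulr_ge0 ?sqr_ge0.
  have : 0 <= c ^+ 2 * (K0 * N) by apply: mulr_ge0; [exact: sqr_ge0|exact: mulr_ge0].
  lra.
have Q0 : 0 <= x ^+ 2 + y ^+ 2 by rewrite addr_ge0 ?sqr_ge0.
pose Z := x ^+ 2 + x' ^+ 2 + N.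
have Z0 : 0 <= Z by rewrite !addr_ge0 ?sqr_ge0.
have hZ : x ^+ 2 + x' ^+ 2 + K0 * N <= (1 + K0) * Z.
  rewrite /Z mulrDl mul1r !mulrDr; have := N0.
  have : 0 <= K0 * x ^+ 2 by rewrite mulr_ge0 ?sqr_ge0.
  have : 0 <= K0 * x' ^+ 2 by rewrite mulr_ge0 ?sqr_ge0.
  lra.
have hQ : x ^+ 2 + y ^+ 2 <= S * ((1 + K0) * Z).
  apply: (@le_trans _ _ (S * (x ^+ 2 + x' ^+ 2 + K0 * N))); last first.
    by rewrite ler_wpM2l// (le_trans _ S1).
  rewrite /S mulrDl mul1r lerD//.
  by have := sqr_ge0 x'; have : 0 <= K0 * N by [rewrite mulr_ge0]; lra.
have hE : expR ((1 + `|E|) * t) * (x ^+ 2 + y ^+ 2) <= M * (S * ((1 + K0) * Z)).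
  by rewrite ler_pM// expR_ge0.
have KZ : 2 * (M * (S * ((1 + K0) * Z)) + K0 * Z) <= K * Z.
  have -> : 2 * (M * (S * ((1 + K0) * Z)) + K0 * Z) =
    (2 * (M * S * (1 + K0) + K0)) * Z by ring.
  by rewrite ler_wpM2r// lerDl mulr_ge0.
have NZ : K0 * N <= K0 * Z.
  by rewrite ler_wpM2l// lerDr addr_ge0 ?sqr_ge0.
have hes := le_trans (esol_energy E x y t0) hE.
split; apply: le_trans (le_trans (sqrD_le _ _) _) KZ; rewrite ler_wpM2l//; apply: lerD;
  try exact: (le_trans _ NZ); apply: le_trans hes; by rewrite ?lerDl ?lerDr sqr_ge0.
Qed.

End EdgeBoundaryValue.

(** * Dominance puts the energy in the resolvent set *)

Section ResolventSet.
Variables (R : realType) (d : nat) (a : 'I_d -> R) (alpha E : R).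
Hypothesis ha : forall j, 0 < a j.
Local Notation vertex := (vertex d).
Local Notation edge := (edge d).
Local Notation mu := (@lebesgue_measure R).
Implicit Types (v : vertex) (j : 'I_d) (psi f : gfun R d).

Lemma edge_L2sq_le_L2sq psi (e : edge) : (edge_L2sq (psi e) (a e.2) <= L2sq a psi)%E.
Proof.
apply: (@le_esum1 R _ (fun e : edge => edge_L2sq (psi e) (a e.2))).
exact: edge_L2sq_ge0.
Qed.

Lemma inL2_edge psi (e : edge) : inL2 a psi -> (edge_L2sq (psi e) (a e.2) < +oo)%E.
Proof. by move=> [_]; apply: le_lt_trans; exact: edge_L2sq_le_L2sq. Qed.

(** Iterating the contraction gives [r ^+ n * M] as a bound for every [n]. Uniqueness among bounded
    functions suffices, because bounded vertex values are what the L2 condition will provide. *)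
Lemma neighbor_unique (c : 'I_d -> R) (u : vertex -> R) (M : R) :
  2 * (\sum_(j < d) `|c j|) < 1 -> (forall v, `|u v| <= M) ->
  (forall v, u v = neighbor_sum c u v) -> forall v, u v = 0.
Proof.
set r := 2 * _ => r1 uM uE.
have r0 : 0 <= r by rewrite mulr_ge0// sumr_ge0.
have ur n v : `|u v| <= r ^+ n * M.
  elim: n v => [|n ih] v; first by rewrite expr0 mul1r.
  by rewrite uE (le_trans (neighbor_sum_norm_le c v ih))// -/r mulrA -exprS.
move=> v; apply/eqP; rewrite -normr_eq0 eq_le normr_ge0 andbT.
have c0 : (r ^+ n * M) @[n --> \oo] --> 0 * M.
  by apply: cvgM; [apply: cvg_expr; rewrite ger0_norm|exact: cvg_cst].
rewrite -(mul0r M); apply: (ler_cvg_to (cvg_cst _) c0).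
by apply: nearW => n; exact: ur.
Qed.

Lemma inL2_lin psi f (k : R) : inL2 a psi -> inL2 a f ->
  inL2 a (fun e t => k * psi e t + f e t).
Proof.
move=> [mpsi Lpsi] [mf Lf]; split=> [e|].
  apply: measurable_funD => //; apply: measurable_funM => //.
have h (e : edge) : (edge_L2sq (fun t => k * psi e t + f e t)%R (a e.2) <=
    (2 * k ^+ 2)%:E * edge_L2sq (psi e) (a e.2) + 2%:E * edge_L2sq (f e) (a e.2))%E.
  apply: (le_trans (edge_L2sqD _ (mf e))).
    by apply: measurable_funM => //; exact: mpsi.
  by rewrite edge_L2sq_scale// EFinM muleA.
have k0 : 0 <= 2 * k ^+ 2 by rewrite mulr_ge0// sqr_ge0.
have pos (x : R) (g : R -> R) (l : R) : 0 <= x -> (0 <= x%:E * edge_L2sq g l)%E.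
  by move=> x0; rewrite mule_ge0 ?lee_fin// edge_L2sq_ge0.
apply: (le_lt_trans (le_esum (fun e _ => h e))).
rewrite esumD => [|e _|e _]; [|exact: pos|exact: pos].
have lt1 (x : R) (g : gfun R d) : 0 <= x -> (L2sq a g < +oo)%E ->
    (\esum_(e in [set: edge]) (x%:E * edge_L2sq (g e) (a e.2)) < +oo)%E.
  move=> x0 gL; apply: le_lt_trans (esumZ_le x0 _) _ => [e|]; first exact: edge_L2sq_ge0.
  have gfin : L2sq a g \is a fin_num.
    by rewrite ge0_fin_numE//; apply: esum_ge0 => e _; exact: edge_L2sq_ge0.
  by rewrite -[X in (_ * X)%E](fineK gfin) -EFinM ltry.
apply: lte_add_pinfty; [exact: (lt1 _ psi)|exact: (lt1 _ f)].
Qed.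

Lemma inL2_fin psi : inL2 a psi -> L2sq a psi = (fine (L2sq a psi))%:E.
Proof.
move=> [_ L]; rewrite fineK// ge0_fin_numE//.
by apply: esum_ge0 => e _; exact: edge_L2sq_ge0.
Qed.

(** Each vertex is an end of [2 d] edges, whence [d%:R * (S + S)]. With [U] the squared vertex
    values this is the resolvent estimate; with [U = 0] it will measure cut-off functions. *)
Lemma L2sq_le psi (U : vertex -> R) (N : edge -> R) (k S T : R) :
  (forall e : edge, measurable_fun `[0, a e.2] (psi e)) -> 0 <= k ->
  (forall v, 0 <= U v) -> (forall e, 0 <= N e) ->
  (\esum_(v in [set: vertex]) (U v)%:E <= S%:E)%E ->
  (\esum_(e in [set: edge]) (N e)%:E <= T%:E)%E ->
  (forall (e : edge) t, 0 <= t <= a e.2 ->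
     psi e t ^+ 2 <= k * (U e.1 + U (shiftp e.1 e.2) + N e)) ->
  (L2sq a psi <= (k * (\sum_j a j) * ((d%:R * (S + S)) + T))%:E)%E.
Proof.
move=> mpsi k0 U0 N0 US NT hpsi.
have L0 : 0 <= \sum_j a j by apply: sumr_ge0 => j _; exact: ltW.
have aL j : a j <= \sum_j a j.
  by rewrite (bigD1 j)//= lerDl; apply: sumr_ge0 => i _; exact: ltW.
pose F (e : edge) := (U e.1 + U (shiftp e.1 e.2) + N e).
have F0 e : 0 <= F e by rewrite /F !addr_ge0.
have h (e : edge) : (edge_L2sq (psi e) (a e.2) <= (k * \sum_j a j)%:E * (F e)%:E)%E.
  apply: (le_trans (edge_L2sq_le_cst (ltW (ha _)) (mpsi e) (hpsi e))).
  by rewrite -EFinM lee_fin -/(F e) mulrAC ler_wpM2r// ler_wpM2l.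
apply: (le_trans (le_esum (fun e _ => h e))).
apply: (le_trans (esumZ_le _ _)) => [|e|]; [by rewrite mulr_ge0|by rewrite lee_fin|].
rewrite (EFinM (k * \sum_j a j)); apply: lee_wpmul2l; first by rewrite lee_fin mulr_ge0.
have -> : \esum_(e in [set: edge]) (F e)%:E =
  (\esum_(e in [set: edge]) ((U e.1)%:E + (U (shiftp e.1 e.2))%:E)
   + \esum_(e in [set: edge]) (N e)%:E)%E.
  by rewrite -esumD// => e _; rewrite ?lee_fin// addr_ge0.
rewrite EFinD; apply: leeD => //.
rewrite esum_edge => [|e]; last by rewrite lee_fin addr_ge0.
have -> : d%:R * (S + S) = \sum_(j < d) (S + S) by rewrite sumr_const card_ord mulr_natl.
rewrite -sumEFin; apply: lee_sum => j _ /=.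
rewrite esumD => [|v _|v _]; rewrite ?lee_fin// EFinD.
by rewrite (esum_shiftp j (fun v => (U v)%:E)) leeD.
Qed.

Local Notation s j := (ssol E (a j)).
Local Notation c j := (csol E (a j)).
Hypothesis s0 : forall j, s j != 0.
Let A := alpha + 2 * \sum_(j < d) c j / s j.
Hypothesis AB : 2 * (\sum_(j < d) `|s j|^-1) < `|A|.

(** Coefficients of the vertex equation divided by [A], the coefficient of [u v]; the dominance
    hypothesis [AB] becomes the contraction condition [w1]. *)
Let w j := (A * s j)^-1.

Let A0 : A != 0.
Proof.
rewrite -normr_gt0; apply: le_lt_trans AB.
by rewrite mulr_ge0// sumr_ge0// => j _; rewrite invr_ge0.
Qed.

Let w1 : 2 * (\sum_(j < d) `|w j|) < 1.
Proof.
have -> : \sum_(j < d) `|w j| = (\sum_(j < d) `|s j|^-1) / `|A|.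
  rewrite mulr_suml; apply: eq_bigr => j _.
  by rewrite /w normfV normrM invfM mulrC.
by rewrite mulrA ltr_pdivrMr ?normr_gt0// mul1r.
Qed.

(** The sum is the total outgoing derivative computed from the Dirichlet-to-Neumann maps of the
    incident edges; [A * g] leaves room for the slope corrections due to a source. *)
Let vertex_equation (u : vertex -> R) v (g : R) :
  \sum_(j < d) ((u (shiftp v j) - c j * u v) / s j
    - (c j * u v - u (shiftm v j)) / s j) + A * g = alpha * u v <->
  u v = neighbor_sum w u v + g.
Proof.
have e : \sum_(j < d) ((u (shiftp v j) - c j * u v) / s j
    - (c j * u v - u (shiftm v j)) / s j) =
    A * neighbor_sum w u v - (A - alpha) * u v.
  have -> : A - alpha = 2 * \sum_(j < d) c j / s j by rewrite /A addrC addKr.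
  rewrite /neighbor_sum !mulr_sumr mulr_suml -sumrB.
  by apply: eq_bigr => j _; rewrite /w; field; rewrite A0 s0.
rewrite e; split=> [h|h].
  apply: (mulfI A0); rewrite mulrDr; move: h; rewrite mulrBl => h; lra.
by move: h; move: (u v) (neighbor_sum w u v) => U N ->; ring.
Qed.

(** Coercivity bounds the vertex values by the L2 norm, the contraction then forces them to vanish,
    and the slopes vanish with them because [s j] is nonzero. *)
Lemma resolvent_injective psi : H_graph a alpha psi (fun e t => E * psi e t) ->
  forall (e : edge) t, 0 <= t <= a e.2 -> psi e t = 0.
Proof.
move=> [psiL [_ [p [pL [heq [u hu]]]]]].
have sol (e : edge) t : 0 <= t <= a e.2 ->
    psi e t = esol E (psi e 0) (p e 0) t /\ p e t = desol E (psi e 0) (p e 0) t.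
  apply: edge_eq_unique; first exact: ha.
  - exact: psiL.1.
  - exact: pL.1.
  - exact: inL2_edge.
  - exact: inL2_edge.
  - exact: heq.
have b0 j : 0 <= (0 : R) <= a j by rewrite lexx ltW.
have bl j : 0 <= a j <= a j by rewrite lexx ltW.
have psi0 v j : psi (v, j) 0 = u v by have [h _] := hu v; exact: (h j).1.
have psil v j : psi (v, j) (a j) = u (shiftp v j).
  by have [h _] := hu (shiftp v j); rewrite -(h j).2 shiftpK.
have yE v j : p (v, j) 0 = (u (shiftp v j) - c j * u v) / s j.
  have [+ _] := sol (v, j) (a j) (bl j); rewrite psil psi0 /esol /= => ->.
  by field.
have pl v j : p (shiftm v j, j) (a j) = (c j * u v - u (shiftm v j)) / s j.
  have [_ ->] := sol (shiftm v j, j) (a j) (bl j).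
  rewrite psi0 yE shiftmK /desol /=.
  have -> : c j * u v - u (shiftm v j) =
    c j * u v - (c j ^+ 2 + E * s j ^+ 2) * u (shiftm v j) by rewrite csol2_ssol2 mul1r.
  by field.
(* One incident edge per vertex is enough for the bound; the given edge supplies a direction. *)
move=> e t te; have j := e.2.
have [K K0 hK] := @esol_coercive R (a j) `|E| (ha j).
have Lfin : L2sq a psi = (fine (L2sq a psi))%:E.
  rewrite fineK// ge0_fin_numE ?psiL.2//; apply: esum_ge0 => x _; exact: edge_L2sq_ge0.
have uM v : `|u v| <= Num.sqrt (K * fine (L2sq a psi)).
  have efin : edge_L2sq (psi (v, j)) (a j) = (fine (edge_L2sq (psi (v, j)) (a j)))%:E.
    by rewrite fineK// ge0_fin_numE ?edge_L2sq_ge0//; exact: (inL2_edge (v, j) psiL).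
  have eE : edge_L2sq (esol E (u v) (p (v, j) 0)) (a j) = edge_L2sq (psi (v, j)) (a j).
    apply: eq_integral => x; rewrite inE/= in_itv/= => xl.
    by have [-> _] := sol (v, j) x xl; rewrite psi0.
  have h := hK E (lexx _) _ _ _ (etrans eE efin).
  have F0 : 0 <= fine (edge_L2sq (psi (v, j)) (a j)) by rewrite fine_ge0// edge_L2sq_ge0.
  have FL : fine (edge_L2sq (psi (v, j)) (a j)) <= fine (L2sq a psi).
    by rewrite -lee_fin -efin -Lfin; exact: (edge_L2sq_le_L2sq psi (v, j)).
  rewrite -sqrtr_sqr ler_sqrt ?mulr_ge0 ?(ltW K0) ?(le_trans F0)//.
  rewrite (@le_trans _ _ (u v ^+ 2 + p (v, j) 0 ^+ 2)) ?lerDl ?sqr_ge0//.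
  by rewrite (le_trans h)// ler_wpM2l// ltW.
have u0 v : u v = 0.
  apply: (neighbor_unique w1 uM) => {}v; rewrite -[RHS]addr0.
  apply/vertex_equation; rewrite mulr0 addr0.
  by have [_ <-] := hu v; apply: eq_bigr => i _; rewrite yE pl.
case: e te => v i /= te.
by have [-> _] := sol (v, i) t te; rewrite psi0 yE !u0 mulr0 subr0 mul0r /esol !mul0r addr0.
Qed.

(** A crude constant, obtained by iterating the case of two terms; it will depend on the dimension
    only. *)
Lemma sqr_sum_le (T : Type) (r : seq T) (x : T -> R) :
  (\sum_(i <- r) x i) ^+ 2 <= 2 ^+ size r * \sum_(i <- r) x i ^+ 2.
Proof.
elim: r => [|i r ih]; first by rewrite !big_nil expr0n mulr0.
rewrite !big_cons; apply: le_trans (sqrD_le _ _) _; rewrite /= (exprS 2) -mulrA ler_wpM2l//.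
rewrite mulrDr lerD// ler_peMl ?sqr_ge0//.
by apply: exprn_ege1; rewrite ler1n.
Qed.

Lemma resolvent_surjective : exists C : R, forall f, inL2 a f ->
  exists psi, H_graph a alpha psi (fun e t => E * psi e t + f e t)
              /\ (L2sq a psi <= C%:E * L2sq a f)%E.
Proof.
have /choice[Kf hKf] j : exists K, 0 <= K /\
    forall (f : R -> R) N, measurable_fun `[0, a j] f -> edge_L2sq f (a j) = N%:E ->
    exists b b' : R, [/\ b ^+ 2 <= K * N, b' ^+ 2 <= K * N &
    forall x x' : R, exists psi p : R -> R,
    [/\ forall t, 0 <= t <= a j -> {for t, continuous psi} /\ {for t, continuous p},
        psi 0 = x /\ psi (a j) = x',
        p 0 = (x' - c j * x) / s j + b /\ p (a j) = (c j * x' - x) / s j + b',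
        forall t, 0 <= t <= a j ->
         (psi t)%:E = ((psi 0)%:E + \int[mu]_(r in `[0%R, t]) (p r)%:E)%E /\
         (p t)%:E = ((p 0)%:E - \int[mu]_(r in `[0%R, t]) (E * psi r + f r)%:E)%E &
        forall t, 0 <= t <= a j -> psi t ^+ 2 <= K * (x ^+ 2 + x' ^+ 2 + N) /\
          p t ^+ 2 <= K * (x ^+ 2 + x' ^+ 2 + N)]].
  by have [K K0 hK] := edge_bvp (ha j) (s0 j); exists K.
have Kf0 j : 0 <= Kf j := (hKf j).1.
pose K := \sum_j Kf j.
have KK j : Kf j <= K by rewrite /K (bigD1 j)//= lerDl sumr_ge0.
have K0 : 0 <= K by rewrite sumr_ge0.
have [C0 C00 hC] := neighbor_solve w1.
pose D : R := 2 ^+ size (index_enum 'I_d).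
have D0 : 0 <= D by rewrite exprn_ge0.
pose k := A^-1 ^+ 2 * (D * (2 * K)).
have k0 : 0 <= k by rewrite mulr_ge0 ?sqr_ge0// mulr_ge0// mulr_ge0.
exists (K * (\sum_j a j) * (d%:R * (C0 * (2 * k) + C0 * (2 * k)) + 1)) => f fL.
pose N (e : edge) := fine (edge_L2sq (f e) (a e.2)).
have NE e : edge_L2sq (f e) (a e.2) = (N e)%:E.
  by rewrite fineK// ge0_fin_numE ?edge_L2sq_ge0//; exact: inL2_edge.
have N0 e : 0 <= N e by rewrite fine_ge0// edge_L2sq_ge0.
pose T := fine (L2sq a f).
have TE : L2sq a f = T%:E by exact: inL2_fin.
have NT : (\esum_(e in [set: edge]) (N e)%:E)%E = T%:E.
  by rewrite -TE; apply: eq_esum => e _; rewrite NE.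
(* The slope corrections are fixed edge by edge before [u] exists: they form the right-hand side of
   the equation that determines [u]. *)
have /choice[bb hbb] (e : edge) : exists z : R * R,
    [/\ z.1 ^+ 2 <= Kf e.2 * N e, z.2 ^+ 2 <= Kf e.2 * N e &
    forall x x' : R, exists pp : (R -> R) * (R -> R),
    [/\ forall t, 0 <= t <= a e.2 -> {for t, continuous pp.1} /\ {for t, continuous pp.2},
        pp.1 0 = x /\ pp.1 (a e.2) = x',
        pp.2 0 = (x' - c e.2 * x) / s e.2 + z.1 /\
        pp.2 (a e.2) = (c e.2 * x' - x) / s e.2 + z.2,
        forall t, 0 <= t <= a e.2 ->
         (pp.1 t)%:E = ((pp.1 0)%:E + \int[mu]_(r in `[0%R, t]) (pp.2 r)%:E)%E /\
         (pp.2 t)%:E = ((pp.2 0)%:E -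
            \int[mu]_(r in `[0%R, t]) (E * pp.1 r + f e r)%:E)%E &
        forall t, 0 <= t <= a e.2 ->
          pp.1 t ^+ 2 <= Kf e.2 * (x ^+ 2 + x' ^+ 2 + N e) /\
          pp.2 t ^+ 2 <= Kf e.2 * (x ^+ 2 + x' ^+ 2 + N e)]].
  have [_ /(_ (f e) (N e) (fL.1 e) (NE e))] := hKf e.2.
  move=> [b [b' [hb hb' hx]]]; exists (b, b'); split => // x x'.
  by have [psi [p hp]] := hx x x'; exists (psi, p).
pose G v := \sum_(j < d) ((bb (v, j)).1 - (bb (shiftm v j, j)).2).
pose g v := A^-1 * G v.
have gle v : g v ^+ 2 <= k * \sum_(j < d) (N (v, j) + N (shiftm v j, j)).
  rewrite /g /k exprMn -mulrA ler_wpM2l ?sqr_ge0//.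
  rewrite (le_trans (sqr_sum_le _ _))// -/D -mulrA ler_wpM2l// mulr_sumr.
  apply: ler_sum => j _; apply: le_trans (sqrD_le _ _) _; rewrite sqrrN -mulrA ler_wpM2l//.
  have [h1 _ _] := hbb (v, j); have [_ h2 _] := hbb (shiftm v j, j).
  rewrite mulrDr lerD//.
    by rewrite (le_trans h1)// ler_wpM2r.
  by rewrite (le_trans h2)// ler_wpM2r.
have gT : (\esum_(v in [set: vertex]) (g v ^+ 2)%:E <= (2 * k * T)%:E)%E.
  apply: (le_trans (le_esum (b := fun v => (k%:E *
     \sum_(j < d) ((N (v, j))%:E + (N (shiftm v j, j))%:E))%E) _)) => [v _|].
    by rewrite sumEFin -EFinM lee_fin.
  apply: (le_trans (esumZ_le _ _)) => // [v|].
    by apply: sume_ge0 => j _; rewrite lee_fin addr_ge0.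
  rewrite [2 * k]mulrC -mulrA (EFinM k); apply: lee_wpmul2l; first by rewrite lee_fin.
  rewrite esum_sum => [|v j _ _]; last by rewrite lee_fin addr_ge0.
  have -> : 2 * T = T + T by ring.
  rewrite EFinD -NT esum_edge => [|e]; last by rewrite lee_fin.
  rewrite -big_split/=; apply: lee_sum => j _.
  rewrite esumD => [|v _|v _]; rewrite ?lee_fin//.
  by rewrite (esum_shiftm j (fun v => (N (v, j))%:E)).
have gfin : (\esum_(v in [set: vertex]) (g v ^+ 2)%:E)%E =
    (fine (\esum_(v in [set: vertex]) (g v ^+ 2)%:E)%E)%:E.
  rewrite fineK// ge0_fin_numE; first by rewrite (le_lt_trans gT)// ltry.
  by apply: esum_ge0 => v _; rewrite lee_fin sqr_ge0.
have [u hu uT] := hC g _ gfin.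
have {uT} uT : (\esum_(v in [set: vertex]) (u v ^+ 2)%:E <= (C0 * (2 * k) * T)%:E)%E.
  by apply: (le_trans uT); rewrite lee_fin -mulrA ler_wpM2l// -lee_fin -gfin.
(* With [u] known, each edge is filled by its Dirichlet problem with the end values of [u]. *)
have [pp hpp] := choice (fun e => let: And3 _ _ h := hbb e in
  h (u e.1) (u (shiftp e.1 e.2))).
pose psi : gfun R d := fun e => (pp e).1; pose p : gfun R d := fun e => (pp e).2.
(* One estimate for both the solution and its derivative, since [H_graph] requires both in L2. *)
have bound (q : gfun R d) : (forall e t, 0 <= t <= a e.2 -> {for t, continuous (q e)}) ->
    (forall e t, 0 <= t <= a e.2 ->
       q e t ^+ 2 <= Kf e.2 * (u e.1 ^+ 2 + u (shiftp e.1 e.2) ^+ 2 + N e)) ->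
    (forall e : edge, measurable_fun `[0, a e.2] (q e)) /\ (L2sq a q <= (K * (\sum_j a j)
      * (d%:R * (C0 * (2 * k) + C0 * (2 * k)) + 1))%:E * L2sq a f)%E.
  move=> cq hq; have mq (e : edge) : measurable_fun `[0, a e.2] (q e).
    by apply: continuous_measurable_cc => t; exact: cq.
  split=> //; have NTle : (\esum_(e in [set: edge]) (N e)%:E <= T%:E)%E by rewrite NT.
  have U0 v : 0 <= u v ^+ 2 by exact: sqr_ge0.
  have := @L2sq_le q (fun v => u v ^+ 2) N K _ _ mq K0 U0 N0 uT NTle.
  rewrite TE -EFinM => H; apply: (le_trans (H _)) => [e t te|].
    rewrite (le_trans (hq e t te))// ler_wpM2r//.
    by rewrite !addr_ge0// ?sqr_ge0.
  by rewrite lee_fin le_eqVlt; apply/orP; left; apply/eqP; ring.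
have [mpsi Lpsi] : (forall e : edge, measurable_fun `[0, a e.2] (psi e)) /\
    (L2sq a psi <= (K * (\sum_j a j)
      * (d%:R * (C0 * (2 * k) + C0 * (2 * k)) + 1))%:E * L2sq a f)%E.
  apply: bound => e t te; first by have [h _ _ _ _] := hpp e; exact: (h t te).1.
  by have [_ _ _ _ h] := hpp e; exact: (h t te).1.
have [mp Lp] : (forall e : edge, measurable_fun `[0, a e.2] (p e)) /\
    (L2sq a p <= (K * (\sum_j a j)
      * (d%:R * (C0 * (2 * k) + C0 * (2 * k)) + 1))%:E * L2sq a f)%E.
  apply: bound => e t te; first by have [h _ _ _ _] := hpp e; exact: (h t te).2.
  by have [_ _ _ _ h] := hpp e; exact: (h t te).2.
have psiL : inL2 a psi by split=> //; rewrite (le_lt_trans Lpsi)// TE -EFinM ltry.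
have pL : inL2 a p by split=> //; rewrite (le_lt_trans Lp)// TE -EFinM ltry.
exists psi; split=> //; split=> //; split; first exact: inL2_lin.
exists p; split=> //; split=> [e t te|].
  by have [_ _ _ h _] := hpp e; exact: h.
have val0 v j : psi (v, j) 0 = u v by have [_ [h _] _ _ _] := hpp (v, j).
have vall v j : psi (v, j) (a j) = u (shiftp v j) by have [_ [_ h] _ _ _] := hpp (v, j).
have p0 v j : p (v, j) 0 = (u (shiftp v j) - c j * u v) / s j + (bb (v, j)).1.
  by have [_ _ [h _] _ _] := hpp (v, j).
have pl v j : p (v, j) (a j) = (c j * u (shiftp v j) - u v) / s j + (bb (v, j)).2.
  by have [_ _ [_ h] _ _] := hpp (v, j).
exists u => v; split=> [j|].
  by rewrite val0 vall shiftmK.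
rewrite -((vertex_equation u v (g v)).2 (hu v)).
rewrite /g mulrA divff// mul1r /G -big_split/=; apply: eq_bigr => j _.
by rewrite p0 pl shiftmK; ring.
Qed.

Lemma in_resolvent_of_dominant : in_resolvent a alpha E.
Proof. by split; [exact: resolvent_injective|exact: resolvent_surjective]. Qed.

End ResolventSet.

(** * Bounded generalized eigenfunctions where dominance fails *)

Section BoundedEigenfunctions.
Variables (R : realType) (d : nat) (a : 'I_d -> R) (alpha E : R).
Local Notation vertex := (vertex d).
Local Notation edge := (edge d).
Implicit Types (v : vertex) (j : 'I_d).

(* A nonzero bounded solution of [H psi = E psi], given on each edge by its
   Cauchy data [(x e, y e)] at the initial vertex. *)
Definition bounded_eigenfunction : Prop := exists x y : edge -> R,
  [/\ exists M, forall e, x e ^+ 2 + y e ^+ 2 <= M,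
      exists e, 0 < x e ^+ 2 + y e ^+ 2 &
      exists u : vertex -> R, forall v,
        (forall j, x (v, j) = u v /\
           esol E (x (shiftm v j, j)) (y (shiftm v j, j)) (a j) = u v) /\
        \sum_(j < d) (y (v, j) - desol E (x (shiftm v j, j)) (y (shiftm v j, j)) (a j))
          = alpha * u v].

Local Notation s j := (ssol E (a j)).
Local Notation c j := (csol E (a j)).

(** The function vanishes at all vertices and lives on the edges of direction [j0]. There [c j0] is
    1 or -1 and multiplies the slope along each edge, so the initial slope [c j0 ^ z] on the edge of
    index [z] makes the derivative continuous along every line. *)
Lemma bounded_eigenfunction_dirichlet j0 : s j0 = 0 -> bounded_eigenfunction.
Proof.
move=> s0; have c2 : c j0 ^+ 2 = 1.
  by have := csol2_ssol2 E (a j0); rewrite s0 expr0n mulr0 addr0.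
have c0 : c j0 != 0 by rewrite -sqrf_eq0 c2 oner_eq0.
have cz2 (z : int) : (c j0 ^ z) ^+ 2 = 1.
  by rewrite exprnP exprzAC -exprnP c2 exp1rz.
exists (fun=> 0), (fun e : edge => if e.2 == j0 then c j0 ^ (e.1 j0) else 0); split.
- exists 1 => e; rewrite expr0n add0r; case: ifP => _; first by rewrite cz2.
  by rewrite expr0n.
- by exists (0, j0); rewrite /= eqxx cz2 expr0n add0r ltr01.
exists (fun=> 0) => v; split=> [j|].
  split=> //; rewrite /esol mul0r add0r /=.
  by case: eqP => [->|_]; rewrite ?s0 ?mulr0 ?mul0r.
rewrite mulr0 big1// => j _; rewrite /desol !(mulr0, mul0r) subr0 /=.
case: eqP => [->|_]; last by rewrite mul0r subrr.
by rewrite ffunE eqxx expfzDr// -mulrA mulVf// mulr1 subrr.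
Qed.

(** A real form of a Bloch wave: [cos (n * th)] satisfies the recursion with factor [2 * cos th] in
    each coordinate. *)
Lemma bounded_eigenfunction_bloch : (0 < d)%N -> (forall j, s j != 0) ->
  `|alpha + 2 * \sum_(j < d) c j / s j| <= 2 * \sum_(j < d) `|s j|^-1 ->
  bounded_eigenfunction.
Proof.
move=> d0 s0; set A := alpha + _; set B := 2 * _ => AB.
have B0 : 0 < B.
  rewrite mulr_gt0// (bigD1 (Ordinal d0))//= ltr_pwDl ?invr_gt0 ?normr_gt0//.
  by apply: sumr_ge0 => j _; rewrite invr_ge0.
(* Since [sg (s j) / s j = |s j|^-1], these quasi-momenta give [\sum_j 2 * cos (th j) / s j = A / B
   * B = A]. The argument of [acos] is admissible exactly because [|A| <= B]. *)
pose th j := acos (A / B * Num.sg (s j)).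
have cth j : cos (th j) = A / B * Num.sg (s j).
  rewrite acosK// in_itv/= -ler_norml normrM normr_sg s0 mulr1 normrM normfV.
  by rewrite (gtr0_norm B0) ler_pdivrMr// mul1r.
pose u v := \prod_(j < d) cos ((v j)%:~R * th j).
have u1 v : `|u v| <= 1.
  rewrite /u normr_prod; apply: prodr_ile1 => j _.
  by rewrite normr_ge0 cos_max.
have nb v j : u (shiftp v j) + u (shiftm v j) = 2 * cos (th j) * u v.
  rewrite /u (bigD1 j)//= [X in _ + X](bigD1 j)//= [in RHS](bigD1 j)//=.
  rewrite !ffunE eqxx intrD intrB mulrDl mulrBl mul1r cosD cosB.
  set p := \prod_(i < d | _) _; set q := \prod_(i < d | _) _; set r := \prod_(i < d | _) _.
  have -> : p = r by apply: eq_bigr => i /negPf ij; rewrite ffunE ij addr0.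
  have -> : q = r by apply: eq_bigr => i /negPf ij; rewrite ffunE ij subr0.
  by ring.
exists (fun e : edge => u e.1), (fun e : edge => (u (shiftp e.1 e.2) - c e.2 * u e.1) / s e.2); split.
- exists (1 + \sum_(j < d) ((1 + `|c j|) / `|s j|) ^+ 2) => -[v j] /=; apply: lerD.
    by rewrite -real_normK ?num_real// -(expr1n _ 2) ler_sqr ?nnegrE// u1.
  rewrite (bigD1 j)//=; apply: ler_wpDr.
    by apply: sumr_ge0 => i _; exact: sqr_ge0.
  rewrite -real_normK ?num_real// ler_sqr ?nnegrE ?divr_ge0 ?addr_ge0//.
  rewrite normrM normfV ler_wpM2r ?invr_ge0// (le_trans (ler_normB _ _))//.
  by rewrite lerD// normrM ler_piMr.
- exists ([ffun=> 0], Ordinal d0) => /=.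
  have -> : u [ffun=> 0] = 1.
    by rewrite /u big1// => j _; rewrite ffunE mul0r cos0.
  by rewrite expr1n ltr_pwDl// sqr_ge0.
exists u => v; split=> [j|].
  by split=> //=; rewrite shiftmK /esol; field.
transitivity (\sum_(j < d) (2 * cos (th j) * u v / s j - 2 * (c j / s j) * u v)).
  apply: eq_bigr => j _; rewrite -nb /= shiftmK /desol.
  have e1 := csol2_ssol2 E (a j).
  have -> : (u v - c j * u (shiftm v j)) / s j * c j - E * u (shiftm v j) * s j =
    (c j * u v - (c j ^+ 2 + E * s j ^+ 2) * u (shiftm v j)) / s j by field.
  by rewrite e1 mul1r; field.
have -> : \sum_(j < d) (2 * cos (th j) * u v / s j - 2 * (c j / s j) * u v) =
    (A / B * B - 2 * \sum_(j < d) c j / s j) * u v.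
  transitivity (\sum_(j < d) (A / B * u v * (2 * `|s j|^-1) - u v * (2 * (c j / s j)))).
    apply: eq_bigr => j _; rewrite cth.
    have <- : Num.sg (s j) / s j = `|s j|^-1.
      by rewrite {2}[s j]numEsg invfM mulrA divff ?mul1r// sgr_eq0.
    by ring.
  by rewrite sumrB -!mulr_sumr -/B; ring.
by rewrite divfK ?gt_eqF// /A addrK.
Qed.

End BoundedEigenfunctions.

(** * Summable, slowly varying exponential weights *)

Section Weight.
Variables (R : realType) (d : nat).
Local Notation vertex := (vertex d).
Implicit Types (v : vertex) (j : 'I_d) (r : R).

Definition weight r v : R := \prod_(j < d) r ^+ `|v j|%N.

Lemma weight_gt0 r v : 0 < r -> 0 < weight r v.
Proof. by move=> r0; apply: prodr_gt0 => j _; exact: exprn_gt0. Qed.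

(** A step changes one exponent by one. Towards the hyperplane [v j = 0] the weight gains the factor
    [r^-1], with equality; away from it the relative loss [1 - r] is smaller than [r^-1 - 1]. *)
Lemma weight_shiftp r v j : 0 < r < 1 ->
  `|weight r (shiftp v j) - weight r v| <= (r^-1 - 1) * weight r v.
Proof.
move=> /andP[r0 r1]; rewrite /weight (bigD1 j)//= [X in _ - X](bigD1 j)//=.
rewrite [X in _ <= _ * X](bigD1 j)//=.
set p := \prod_(i < d | _) _; set q := \prod_(i < d | _) _.
have -> : p = q by apply: eq_bigr => i /negPf ij; rewrite ffunE ij addr0.
have q0 : 0 <= q by apply: prodr_ge0 => i _; rewrite exprn_ge0// ltW.
rewrite ffunE eqxx -mulrBl normrM (ger0_norm q0) mulrA ler_wpM2r//.
have ri : 1 < r^-1 by rewrite invf_gt1.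
have rV : r * r^-1 = 1 by rewrite divff// gt_eqF.
case: (v j) => n; last rewrite NegzE.
  have -> : `|(Posz n + 1)%R|%N = n.+1 by rewrite -PoszD addn1.
  rewrite exprS /=; have := exprn_ge0 n (ltW r0); move: (r ^+ n) => z z0.
  rewrite -[X in _ - X]mul1r -mulrBl normrM (ger0_norm z0) ler_wpM2r//.
  by rewrite ltr0_norm ?subr_lt0//; nra.
have -> : `|(- n.+1%:Z + 1)%R|%N = n by rewrite -addn1 PoszD opprD addrNK abszN.
rewrite abszN /= exprS; have := exprn_ge0 n (ltW r0); move: (r ^+ n) => z z0.
rewrite -{1}[z]mul1r -mulrBl normrM (ger0_norm z0) mulrA ler_wpM2r//.
rewrite ger0_norm ?subr_ge0 ?(ltW r1)//.
by rewrite mulrBl mul1r mulVf ?gt_eqF.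
Qed.

(** A finite set of vertices lies in a box, over which the sum factors into [d] geometric sums. *)
Lemma weight_sum_le r (s : seq vertex) : 0 < r < 1 -> uniq s ->
  \sum_(v <- s) weight r v <= (2 * (1 - r)^-1) ^+ d.
Proof.
move=> /andP[r0 r1] us; have r1' : 0 < 1 - r by rewrite subr_gt0.
have geo n : \sum_(k < n) r ^+ k <= (1 - r)^-1.
  rewrite -[leRHS]mul1r ler_pdivlMr// mulrC -opprB mulNr -subrX1 opprB.
  by rewrite gerBl exprn_ge0// ltW.
pose n := (\max_(v <- s) \max_(j < d) `|v j|)%N.
(* A coordinate is coded by absolute value and sign, whence the factor 2. Zero is coded twice, which
   is harmless for an upper bound. *)
pose F := {ffun 'I_d -> 'I_n.+1 * bool}.
pose phi (f : F) : vertex := [ffun j => if (f j).2 then (f j).1%:Z else - (f j).1%:Z].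
pose g v : F := [ffun j => (inord `|v j|%N, 0 <= v j)].
have phig v : v \in s -> phi (g v) = v.
  move=> vs; apply/ffunP => j; rewrite !ffunE /= inordK.
    by case: (lerP 0 (v j)) => vj; [rewrite gez0_abs|rewrite ltz0_abs// opprK].
  rewrite ltnS /n (leq_trans _ (leq_bigmax_seq _ vs _))//.
  exact: (@leq_bigmax _ (fun j => `|v j|%N)).
have -> : \sum_(v <- s) weight r v = \sum_(f <- map g s) weight r (phi f).
  by rewrite big_map; apply: eq_big_seq => v vs; rewrite phig.
have ug : uniq (map g s).
  by rewrite map_inj_in_uniq// => v w vs ws vw; rewrite -(phig v vs) vw phig.
rewrite big_uniq//; apply: (@le_trans _ _ (\sum_(f : F) weight r (phi f))).
  rewrite big_mkcond/=; apply: ler_sum => f _; case: ifP => // _.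
  by rewrite ltW// weight_gt0.
have -> : \sum_(f : F) weight r (phi f) =
    \prod_(j < d) \sum_(z : 'I_n.+1 * bool) r ^+ z.1.
  rewrite bigA_distr_bigA; apply: eq_bigr => f _; apply: eq_bigr => j _.
  by rewrite ffunE; case: (f j) => k []; rewrite ?abszN.
have -> : (2 * (1 - r)^-1) ^+ d = \prod_(j < d) (2 * (1 - r)^-1).
  by rewrite prodr_const card_ord.
apply: ler_prod => j _; rewrite sumr_ge0 => [|z _]; last by rewrite exprn_ge0// ltW.
rewrite -(pair_bigA _ (fun (k : 'I_n.+1) (b : bool) => r ^+ k))/=.
under eq_bigr do rewrite big_bool /= -mulr2n -mulr_natl.
by rewrite -mulr_sumr ler_wpM2l ?geo.
Qed.

Lemma esum_weight_le r : 0 < r < 1 ->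
  (\esum_(v in [set: vertex]) (weight r v)%:E <= ((2 * (1 - r)^-1) ^+ d)%:E)%E.
Proof.
move=> r01; apply: esum_le_bound => X Xfin.
rewrite fsbig_finite//= sumEFin lee_fin; apply: weight_sum_le => //.
exact: finmap.fset_uniq.
Qed.

Lemma weight_sqr r v : weight r v ^+ 2 = weight (r ^+ 2) v.
Proof. by rewrite /weight -prodrXl; apply: eq_bigr => j _; rewrite exprAC. Qed.

End Weight.

(** * Cutting off a solution along one edge *)

Section Cutoff.
Variable R : realType.
Implicit Types (E x y t l : R).
Local Notation mu := (@lebesgue_measure R).

(** The Hermite cubic [3 z^2 - 2 z^3] with [z = t / l]. Flatness at both ends keeps derivatives of
    the cut-off out of the vertex conditions. *)
Lemma cutoff_poly l : 0 < l -> exists p : {poly R},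
  [/\ p.[0] = 0, p.[l] = 1, p^`().[0] = 0, p^`().[l] = 0 &
      forall t, 0 <= t <= l -> 0 <= p.[t] <= 1].
Proof.
move=> l0; have ln0 : l != 0 by rewrite gt_eqF.
pose k := l^-1; have kl : k * l = 1 by rewrite /k mulVf.
pose p : {poly R} := (3 * k ^+ 2) *: 'X^2 - (2 * k ^+ 3) *: 'X^3.
have pE t : p.[t] = (k * t) ^+ 2 * (3 - 2 * (k * t)) by rewrite /p hornerD hornerN !hornerZ !hornerXn; ring.
have dpE t : p^`().[t] = 6 * k ^+ 2 * t * (1 - k * t).
  rewrite /p derivB !derivZ !derivXn /= hornerD hornerN !hornerZ !hornerMn !hornerXn.
  by ring.
exists p; split; rewrite ?pE ?dpE ?kl ?mulr0 ?mul0r ?expr0n ?mul0r//; try ring.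
move=> t /andP[t0 tl]; rewrite pE.
have : 0 <= k * t by rewrite mulr_ge0// invr_ge0 ltW.
have : k * t <= 1 by rewrite -kl ler_wpM2l// invr_ge0 ltW.
move: (k * t) => z z1 z0; rewrite mulr_ge0 ?sqr_ge0//=; last lra.
rewrite -subr_ge0; have -> : 1 - z ^+ 2 * (3 - 2 * z) = (1 - z) ^+ 2 * (1 + 2 * z) by ring.
by rewrite mulr_ge0 ?sqr_ge0//; lra.
Qed.

(* [phi] is the product of the solution with Cauchy data [(x, y)] and a cut-off
   going from [X] to [Y] which is flat at both ends. *)
Lemma edge_cutoff l E : 0 < l -> exists2 K, 0 < K &
  forall E' x y X Y eps, `|E' - E| <= 1 -> 0 <= eps <= 2^-1 -> 0 < X ->
  `|Y - X| <= eps * X ->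
  exists phi p f : R -> R,
    [/\ phi 0 = X * x /\ phi l = Y * esol E' x y l,
        p 0 = X * y /\ p l = Y * desol E' x y l,
        forall t, 0 <= t <= l ->
          [/\ {for t, continuous phi}, {for t, continuous p} & {for t, continuous f}],
        forall t, 0 <= t <= l ->
         (phi t)%:E = ((phi 0)%:E + \int[mu]_(r in `[0%R, t]) (p r)%:E)%E /\
         (p t)%:E = ((p 0)%:E - \int[mu]_(r in `[0%R, t]) (E * phi r + f r)%:E)%E &
        (forall t, 0 <= t <= l ->
          [/\ phi t ^+ 2 <= K * (X ^+ 2 * (x ^+ 2 + y ^+ 2)),
              p t ^+ 2 <= K * (X ^+ 2 * (x ^+ 2 + y ^+ 2)) &
              f t ^+ 2 <= K * ((E' - E) ^+ 2 + eps ^+ 2) * (X ^+ 2 * (x ^+ 2 + y ^+ 2))]) /\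
        ((X ^+ 2 * (x ^+ 2 + y ^+ 2))%:E <= K%:E * edge_L2sq phi l)%E].
Proof.
move=> l0; have [P [P0 Pl dP0 dPl P01]] := cutoff_poly l0.
have cpoly (q : {poly R}) t : {for t, continuous (horner q)}.
  exact: der_continuous (is_derive_poly q t).
have [M1 M10 hM1] := @continuous_bounded R (horner P^`()) l (fun t _ => cpoly _ t).
have [M2 M20 hM2] := @continuous_bounded R (horner P^`()^`()) l (fun t _ => cpoly _ t).
have [K1 K10 hK1] := @esol_coercive R l (`|E| + 1) l0.
pose M := expR ((2 + `|E|) * l); have M0 : 0 <= M := expR_ge0 _.
pose H := M1 + M2; have H0 : 0 <= H by rewrite addr_ge0 ?ltW.
(* [4 * K1] serves the lower bound of the norm, where the cut-off is at least [X / 2]; the rest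
   absorbs the constants of the pointwise upper bounds. *)
pose K := 4 * K1 + M * (20 * H ^+ 2 + 20).
have K0 : 0 < K.
  by rewrite ltr_pwDl ?mulr_gt0// mulr_ge0// addr_ge0// mulr_ge0// sqr_ge0.
exists K => // E' x y X Y eps EE' /andP[e0 e1] X0 YX.
have E'1 : `|E'| <= `|E| + 1.
  by rewrite -[E'](subrK E) addrC (le_trans (ler_normD _ _))// lerD2l.
set Q := x ^+ 2 + y ^+ 2; have Q0 : 0 <= Q by rewrite addr_ge0 ?sqr_ge0.
pose D := Y - X.
pose chi t := X + D * P.[t]; pose chi1 t := D * P^`().[t]; pose chi2 t := D * P^`()^`().[t].
pose psi := esol E' x y; pose dpsi := desol E' x y.
pose phi t := chi t * psi t; pose p t := chi1 t * psi t + chi t * dpsi t.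
(* This is [- phi'' - E phi]: the energy shift plus the commutator of the second derivative with
   [chi], which is of order [eps * X]. *)
pose f t := (E' - E) * chi t * psi t + (- (2 * chi1 t * dpsi t)) + (- (chi2 t * psi t)).
have dchi t : is_derive t 1 chi (chi1 t).
  by apply: (is_derive_eq (derD (dercst t X) (derZ D (is_derive_poly P t)))); rewrite add0r.
have dchi1 t : is_derive t 1 chi1 (chi2 t) by have := derZ D (is_derive_poly P^`() t).
have cchi2 t : {for t, continuous chi2}.
  exact: der_continuous (derZ D (is_derive_poly P^`()^`() t)).
have dpsiE t : is_derive t 1 psi (dpsi t) := is_derive_esol E' x y t.
have ddpsiE t : is_derive t 1 dpsi (- E' * psi t) := is_derive_desol E' x y t.
have dphi t : is_derive t 1 phi (p t).
  by apply: (is_derive_eq (derM (dchi t) (dpsiE t))); rewrite /p; ring.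
have dp1 t : is_derive t 1 p (- (E * phi t + f t)).
  apply: (is_derive_eq (derD (derM (dchi1 t) (dpsiE t)) (derM (dchi t) (ddpsiE t)))).
  by rewrite /f /phi; ring.
have dp t : is_derive t 1 (fun t => - p t) (E * phi t + f t).
  by have := derN (dp1 t); rewrite opprK.
have cphi t : {for t, continuous phi} := der_continuous (dphi t).
have cp t : {for t, continuous p} := der_continuous (dp1 t).
have cf t : {for t, continuous f}.
  have cchi : {for t, continuous chi} := der_continuous (dchi t).
  have cchi1 : {for t, continuous chi1} := der_continuous (dchi1 t).
  have cpsi : {for t, continuous psi} := der_continuous (dpsiE t).
  have cdpsi : {for t, continuous dpsi} := der_continuous (ddpsiE t).
  have cc (k : R) : {for t, continuous (fun _ : R => k)} by exact: cvg_cst.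
  have cM (g h : R -> R) : {for t, continuous g} -> {for t, continuous h} ->
      {for t, continuous (fun s => g s * h s)} by move=> cg ch; exact: cvgM cg ch.
  apply: cvgD; first apply: cvgD.
  - exact: cM (cM _ _ (cc _) cchi) cpsi.
  - apply: cvgN; exact: cM (cM _ _ (cc _) cchi1) cdpsi.
  - apply: cvgN; exact: cM (cchi2 t) cpsi.
exists phi, p, f; split.
- by rewrite /phi /chi P0 Pl /psi esol0 /D; split; ring.
- by rewrite /p /chi1 /chi dP0 dPl P0 Pl /psi /dpsi esol0 desol0 /D; split; ring.
- by move=> t _; split.
- move=> t /andP[t0 tl]; split.
    have -> := ftc2 t0 (fun s _ => dphi s) (fun s _ => cp s).
    by rewrite -EFinD addrC subrK.
  have cEf s (_ : 0 <= s <= t) : {for s, continuous (fun r => E * phi r + f r)}.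
    by apply: cvgD; [apply: cvgM; [exact: cvg_cst|exact: cphi]|exact: cf].
  have -> := ftc2 t0 (fun s _ => dp s) cEf.
  by rewrite -EFinB; congr (_%:E); ring.
have Dn : `|D| <= eps * X by [].
(* Here [eps <= 1/2] is needed: the weight may not lose more than half its size along an edge. *)
have chiB t : 0 <= t <= l -> X / 2 <= chi t <= 2 * X.
  move=> /P01 /andP[p0 p1].
  have : `|D * P.[t]| <= eps * X by rewrite normrM (ger0_norm p0) (le_trans (ler_piMr _ p1)).
  have : eps * X <= 2^-1 * X by rewrite ler_wpM2r// ltW.
  rewrite /chi ler_norml; move: (D * P.[t]) (eps * X) => z w; lra.
have psiB t : 0 <= t <= l -> psi t ^+ 2 + dpsi t ^+ 2 <= M * Q.
  move=> /andP[t0 tl]; apply: (le_trans (esol_energy E' x y t0)); rewrite ler_wpM2r//.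
  rewrite ler_expR ler_pM ?addr_ge0//.
  by move: E'1; lra.
split.
  move=> t tl; have /andP[c1 c2] := chiB t tl; have pB := psiB t tl.
  have chi0 : 0 <= chi t by apply: le_trans c1; rewrite divr_ge0// ltW.
  have hchi : chi t ^+ 2 <= 4 * X ^+ 2.
    by have -> : 4 * X ^+ 2 = (2 * X) ^+ 2 by [ring]; rewrite ler_sqr ?nnegrE// mulr_ge0// ltW.
  have sqn (z w : R) : `|z| <= w -> z ^+ 2 <= w ^+ 2.
    by move=> zw; rewrite -real_normK ?num_real// ler_sqr ?nnegrE// (le_trans _ zw).
  have hchi1 : chi1 t ^+ 2 <= eps ^+ 2 * X ^+ 2 * H ^+ 2.
    rewrite -!exprMn; apply: sqn; rewrite normrM ler_pM// (le_trans (hM1 t tl))//.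
    by rewrite lerDl ltW.
  have hchi2 : chi2 t ^+ 2 <= eps ^+ 2 * X ^+ 2 * H ^+ 2.
    rewrite -!exprMn; apply: sqn; rewrite normrM ler_pM// (le_trans (hM2 t tl))//.
    by rewrite lerDr ltW.
  have hpsi : psi t ^+ 2 <= M * Q by apply: le_trans pB; rewrite lerDl sqr_ge0.
  have hdpsi : dpsi t ^+ 2 <= M * Q by apply: le_trans pB; rewrite lerDr sqr_ge0.
  have MQ0 : 0 <= M * Q by exact: mulr_ge0.
  have X20 : 0 <= X ^+ 2 by exact: sqr_ge0.
  have H20 : 0 <= H ^+ 2 by exact: sqr_ge0.
  have e20 : 0 <= eps ^+ 2 by exact: sqr_ge0.
  have e21 : eps ^+ 2 <= 1.
    by rewrite -(expr1n _ 2) ler_sqr ?nnegrE//; move: e1; lra.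
  have b1 : chi t ^+ 2 * psi t ^+ 2 <= 4 * X ^+ 2 * (M * Q) by rewrite ler_pM ?sqr_ge0.
  have b2 : chi t ^+ 2 * dpsi t ^+ 2 <= 4 * X ^+ 2 * (M * Q) by rewrite ler_pM ?sqr_ge0.
  have b3 : chi1 t ^+ 2 * psi t ^+ 2 <= eps ^+ 2 * X ^+ 2 * H ^+ 2 * (M * Q).
    by rewrite ler_pM ?sqr_ge0.
  have b4 : chi1 t ^+ 2 * dpsi t ^+ 2 <= eps ^+ 2 * X ^+ 2 * H ^+ 2 * (M * Q).
    by rewrite ler_pM ?sqr_ge0.
  have b5 : chi2 t ^+ 2 * psi t ^+ 2 <= eps ^+ 2 * X ^+ 2 * H ^+ 2 * (M * Q).
    by rewrite ler_pM ?sqr_ge0.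
  pose Z := X ^+ 2 * Q; have Z0 : 0 <= Z by exact: mulr_ge0.
  have MZ0 : 0 <= M * Z by exact: mulr_ge0.
  have HMZ0 : 0 <= H ^+ 2 * (M * Z) by exact: mulr_ge0.
  have K1Z0 : 0 <= K1 * Z by rewrite mulr_ge0// ltW.
  have KZ : K * Z = 4 * (K1 * Z) + 20 * (H ^+ 2 * (M * Z)) + 20 * (M * Z).
    by rewrite /K; ring.
  have eHMZ : eps ^+ 2 * (H ^+ 2 * (M * Z)) <= H ^+ 2 * (M * Z) by exact: ler_piMl.
  have r1 : 4 * X ^+ 2 * (M * Q) = 4 * (M * Z) by rewrite /Z; ring.
  have r2 : eps ^+ 2 * X ^+ 2 * H ^+ 2 * (M * Q) = eps ^+ 2 * (H ^+ 2 * (M * Z)).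
    by rewrite /Z; ring.
  rewrite r1 in b1 b2; rewrite r2 in b3 b4 b5.
  clearbody chi chi1 chi2; rewrite -/Z; split.
  - rewrite KZ exprMn (le_trans b1)//.
    by move: MZ0 HMZ0 K1Z0; move: (M * Z) (H ^+ 2 * _) (K1 * Z) => ? ? ?; lra.
  - rewrite KZ; apply: le_trans (sqrD_le _ _) _; rewrite !exprMn.
    have aux (u1 u2 u3 u4 m k : R) : u1 <= u3 -> u2 <= 4 * m -> 0 <= m -> 0 <= u4 ->
      0 <= k -> u3 <= u4 -> 2 * (u1 + u2) <= 4 * k + 20 * u4 + 20 * m by lra.
    exact: (aux _ _ _ _ _ _ b3 b2 MZ0 HMZ0 K1Z0 eHMZ).
  apply: le_trans (sqrD3_le _ _ _) _; rewrite !sqrrN !exprMn.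
  have d20 : 0 <= (E' - E) ^+ 2 by exact: sqr_ge0.
  have -> : K * ((E' - E) ^+ 2 + eps ^+ 2) * Z =
    (E' - E) ^+ 2 * (K * Z) + eps ^+ 2 * (K * Z) by ring.
  have q1 : (E' - E) ^+ 2 * chi t ^+ 2 * psi t ^+ 2 <= (E' - E) ^+ 2 * (4 * (M * Z)).
    by rewrite -mulrA ler_wpM2l.
  have q2 : 4 * ((E' - E) ^+ 2 * (4 * (M * Z))) <= (E' - E) ^+ 2 * (K * Z).
    rewrite mulrCA ler_wpM2l// KZ.
    by move: MZ0 HMZ0 K1Z0; move: (M * Z) (H ^+ 2 * _) (K1 * Z) => ? ? ?; lra.
  have q3 : 20 * (eps ^+ 2 * (H ^+ 2 * (M * Z))) <= eps ^+ 2 * (K * Z).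
    rewrite mulrCA ler_wpM2l// KZ.
    by move: MZ0 HMZ0 K1Z0; move: (M * Z) (H ^+ 2 * _) (K1 * Z) => ? ? ?; lra.
  rewrite -[2 ^+ 2 * _ * _]mulrA.
  have aux (g A B u v w z : R) : g <= A -> 4 * A <= B -> 20 * u <= v -> w <= u -> z <= u ->
    4 * (g + 2 ^+ 2 * w + z) <= B + v by lra.
  exact: (aux _ _ _ _ _ _ _ q1 q2 q3 b4 b5).
have mpsi : measurable_fun `[0, l] psi.
  by apply: continuous_measurable_cc => t _; exact: esol_continuous.
have mphi : measurable_fun `[0, l] phi by apply: continuous_measurable_cc.
have hle : (edge_L2sq (fun t => X / 2 * psi t)%R l <= edge_L2sq phi l)%E.
  apply: le_edge_L2sq => //; first by apply: measurable_funM.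
  move=> t tl; have /andP[c1 _] := chiB t tl.
  rewrite /phi !exprMn ler_wpM2r ?sqr_ge0// -exprMn ler_sqr ?nnegrE ?divr_ge0 ?(ltW X0)//.
  by rewrite (le_trans _ c1)// divr_ge0// ltW.
have pfin : edge_L2sq psi l = (fine (edge_L2sq psi l))%:E.
  rewrite fineK// ge0_fin_numE ?edge_L2sq_ge0//.
  by apply: le_lt_trans (edge_L2sq_le_cst (ltW l0) mpsi (M := M * Q) _) (ltry _) => t tl;
    apply: le_trans (psiB t tl); rewrite lerDl sqr_ge0.
have hQ := hK1 E' E'1 x y _ pfin.
have N0 : 0 <= fine (edge_L2sq psi l) by rewrite fine_ge0// edge_L2sq_ge0.
apply: (@le_trans _ _ (K%:E * edge_L2sq (fun t => X / 2 * psi t)%R l)%E); last first.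
  by apply: lee_wpmul2l => //; rewrite lee_fin ltW.
rewrite edge_L2sq_scale// pfin -!EFinM lee_fin.
apply: (@le_trans _ _ (X ^+ 2 * (K1 * fine (edge_L2sq psi l)))).
  by rewrite ler_wpM2l// sqr_ge0.
have -> : K * ((X / 2) ^+ 2 * fine (edge_L2sq psi l)) =
  X ^+ 2 * ((K / 4) * fine (edge_L2sq psi l)) by field.
rewrite ler_wpM2l ?sqr_ge0// ler_wpM2r// ler_pdivlMr// mulrC lerDl.
by rewrite mulr_ge0// addr_ge0// mulr_ge0// sqr_ge0.
Qed.

End Cutoff.

(** * Approximate eigenfunctions against the resolvent bound *)

Section WeylSequence.
Variables (R : realType) (d : nat) (a : 'I_d -> R) (alpha : R).
Hypothesis ha : forall j, 0 < a j.
Local Notation vertex := (vertex d).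
Local Notation edge := (edge d).
Local Notation mu := (@lebesgue_measure R).
Implicit Types (v : vertex) (j : 'I_d) (psi phi : gfun R d).

Lemma inL2B psi phi : inL2 a psi -> inL2 a phi -> inL2 a (fun e t => psi e t - phi e t).
Proof.
move=> h1 h2; have := inL2_lin (-1) h2 h1.
by under eq_fun do under eq_fun do rewrite mulN1r addrC.
Qed.

(** Used to compare a cut-off function with the solution supplied by the resolvent: injectivity
    applies to their difference. *)
Lemma H_graphB psi1 phi1 psi2 phi2 :
  H_graph a alpha psi1 phi1 -> H_graph a alpha psi2 phi2 ->
  H_graph a alpha (fun e t => psi1 e t - psi2 e t) (fun e t => phi1 e t - phi2 e t).
Proof.
move=> [L1 [M1 [p1 [P1 [I1 [u1 hu1]]]]]] [L2 [M2 [p2 [P2 [I2 [u2 hu2]]]]]].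
split; first exact: inL2B.
split; first exact: inL2B.
exists (fun e t => p1 e t - p2 e t); split; first exact: inL2B.
have intB (f g : gfun R d) e t : inL2 a f -> inL2 a g -> 0 <= t <= a e.2 ->
    [/\ (\int[mu]_(s in `[0%R, t]) (f e s - g e s)%:E =
         \int[mu]_(s in `[0%R, t]) (f e s)%:E - \int[mu]_(s in `[0%R, t]) (g e s)%:E)%E,
      \int[mu]_(s in `[0%R, t]) (f e s)%:E \is a fin_num &
      \int[mu]_(s in `[0%R, t]) (g e s)%:E \is a fin_num]%E.
  move=> fL gL /andP[t0 ta].
  have fi := integrable_subitv ta (L2_integrable (fL.1 e) (inL2_edge e fL)).
  have gi := integrable_subitv ta (L2_integrable (gL.1 e) (inL2_edge e gL)).
  split; [|exact: integrable_fin_num|exact: integrable_fin_num].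
  by under eq_integral do rewrite EFinB; rewrite integralB.
split=> [e t te|].
  have [-> f1 f2] := intB _ _ e t P1 P2 te; have [-> g1 g2] := intB _ _ e t M1 M2 te.
  have [+ +] := I1 e t te; have [+ +] := I2 e t te.
  move: f1 f2 g1 g2 => /fineK <- /fineK <- /fineK <- /fineK <-.
  rewrite -!EFinB -!EFinD => -[->] [->] [->] [->].
  by split; congr (_%:E); ring.
exists (fun v => u1 v - u2 v) => v; have [h1 h1'] := hu1 v; have [h2 h2'] := hu2 v; split=> [j|].
  by rewrite (h1 j).1 (h1 j).2 (h2 j).1 (h2 j).2.
rewrite mulrBr -h1' -h2' -sumrB; apply: eq_bigr => j _; ring.
Qed.

(* A bounded solution of [H psi = E' psi], cut off by slowly varying exponential
   weights, is an approximate eigenfunction of [H] at [E]. *)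
Lemma resolvent_no_bounded_eigenfunction E : in_resolvent a alpha E ->
  exists2 delta, 0 < delta &
    forall E', `|E' - E| < delta -> ~ bounded_eigenfunction a alpha E'.
Proof.
(* Nothing is known about the sign of [C0]. *)
move=> [inj [C0 surj]]; pose C := `|C0|.
have /choice[Kf hKf] j : exists K, 0 < K /\
  forall E' x y X Y eps, `|E' - E| <= 1 -> 0 <= eps <= 2^-1 -> 0 < X ->
  `|Y - X| <= eps * X ->
  exists phi p f : R -> R,
    [/\ phi 0 = X * x /\ phi (a j) = Y * esol E' x y (a j),
        p 0 = X * y /\ p (a j) = Y * desol E' x y (a j),
        forall t, 0 <= t <= a j ->
          [/\ {for t, continuous phi}, {for t, continuous p} & {for t, continuous f}],
        forall t, 0 <= t <= a j ->
         (phi t)%:E = ((phi 0)%:E + \int[mu]_(r in `[0%R, t]) (p r)%:E)%E /\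
         (p t)%:E = ((p 0)%:E - \int[mu]_(r in `[0%R, t]) (E * phi r + f r)%:E)%E &
        (forall t, 0 <= t <= a j ->
          [/\ phi t ^+ 2 <= K * (X ^+ 2 * (x ^+ 2 + y ^+ 2)),
              p t ^+ 2 <= K * (X ^+ 2 * (x ^+ 2 + y ^+ 2)) &
              f t ^+ 2 <= K * ((E' - E) ^+ 2 + eps ^+ 2) * (X ^+ 2 * (x ^+ 2 + y ^+ 2))]) /\
        ((X ^+ 2 * (x ^+ 2 + y ^+ 2))%:E <= K%:E * edge_L2sq phi (a j))%E].
  by have [K K0 hK] := edge_cutoff E (ha j); exists K.
have Kf0 j : 0 <= Kf j by exact: ltW (hKf j).1.
pose K := \sum_j Kf j; have K0 : 0 <= K by exact: sumr_ge0.
have KK j : Kf j <= K by rewrite /K (bigD1 j)//= lerDl sumr_ge0.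
pose L := \sum_j a j; have L0 : 0 <= L by apply: sumr_ge0 => j _; exact: ltW.
(* [W] collects the constants of the chain of norm inequalities below. The source carries the factor
   [2 * eps ^+ 2], and [eps] is chosen so that [W * (2 * eps ^+ 2) < 1]. It depends on [E] and [C]
   but not on [E'], and it serves both as [delta] and as the variation of the weights. *)
pose W := K * (C * (K * L)).
have W0 : 0 <= W by apply: mulr_ge0 => //; apply: mulr_ge0; [exact: normr_ge0|exact: mulr_ge0].
pose eps := (2 * (1 + W))^-1.
have eps0 : 0 < eps by rewrite invr_gt0 mulr_gt0// ltr_pwDl.
have epsW : eps * (2 * (1 + W)) = 1 by rewrite /eps mulVf// gt_eqF// mulr_gt0// ltr_pwDl.
have eps2 : eps <= 2^-1.
  by rewrite /eps lef_pV2 ?posrE ?mulr_gt0 ?ltr_pwDl// ler_peMr// lerDl.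
exists eps => // E' EE' [x [y [[M hM] [e0 e0pos] [u hu]]]].
(* Then the relative variation [r^-1 - 1] of the weight is exactly [eps]. *)
pose r := (1 + eps)^-1.
have r01 : 0 < r < 1 by rewrite invr_gt0 invf_lt1 ?ltrDl ?eps0 addr_gt0.
have rE : r^-1 - 1 = eps by rewrite /r invrK addrC addKr.
pose X (v : vertex) : R := weight r v.
have X0 v : 0 < X v by apply: weight_gt0; case/andP: r01.
have XE (e : edge) : `|X (shiftp e.1 e.2) - X e.1| <= eps * X e.1.
  by rewrite -rE; exact: weight_shiftp.
have EE1 : `|E' - E| <= 1 by rewrite (le_trans (ltW EE'))// (le_trans eps2)// invf_le1 ?ler1n.
have eps02 : 0 <= eps <= 2^-1 by rewrite ltW.
have /choice[pp hpp] (e : edge) : exists q : (R -> R) * (R -> R) * (R -> R),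
    [/\ q.1.1 0 = X e.1 * x e /\ q.1.1 (a e.2) = X (shiftp e.1 e.2) * esol E' (x e) (y e) (a e.2),
        q.1.2 0 = X e.1 * y e /\ q.1.2 (a e.2) = X (shiftp e.1 e.2) * desol E' (x e) (y e) (a e.2),
        forall t, 0 <= t <= a e.2 ->
          [/\ {for t, continuous q.1.1}, {for t, continuous q.1.2} & {for t, continuous q.2}],
        forall t, 0 <= t <= a e.2 ->
         (q.1.1 t)%:E = ((q.1.1 0)%:E + \int[mu]_(r in `[0%R, t]) (q.1.2 r)%:E)%E /\
         (q.1.2 t)%:E = ((q.1.2 0)%:E -
           \int[mu]_(r in `[0%R, t]) (E * q.1.1 r + q.2 r)%:E)%E &
        (forall t, 0 <= t <= a e.2 ->
          [/\ q.1.1 t ^+ 2 <= Kf e.2 * (X e.1 ^+ 2 * (x e ^+ 2 + y e ^+ 2)),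
              q.1.2 t ^+ 2 <= Kf e.2 * (X e.1 ^+ 2 * (x e ^+ 2 + y e ^+ 2)) &
              q.2 t ^+ 2 <= Kf e.2 * ((E' - E) ^+ 2 + eps ^+ 2)
                                * (X e.1 ^+ 2 * (x e ^+ 2 + y e ^+ 2))]) /\
        ((X e.1 ^+ 2 * (x e ^+ 2 + y e ^+ 2))%:E <= (Kf e.2)%:E * edge_L2sq q.1.1 (a e.2))%E].
  have [_ h] := hKf e.2.
  have [phi [p [f hh]]] := h E' (x e) (y e) (X e.1) _ eps EE1 eps02 (X0 e.1) (XE e).
  by exists (phi, p, f).
pose phi : gfun R d := fun e => (pp e).1.1; pose p : gfun R d := fun e => (pp e).1.2.
pose f : gfun R d := fun e => (pp e).2.
pose F (e : edge) := X e.1 ^+ 2 * (x e ^+ 2 + y e ^+ 2).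
have F0 e : 0 <= F e by rewrite mulr_ge0 ?sqr_ge0// addr_ge0 ?sqr_ge0.
have M0 : 0 <= M by apply: le_trans (hM e0); rewrite addr_ge0 ?sqr_ge0.
have Ffin : (\esum_(e in [set: edge]) (F e)%:E < +oo)%E.
  apply: (@le_lt_trans _ _ (\esum_(e in [set: edge]) (M%:E * (X e.1 ^+ 2)%:E))%E).
    apply: le_esum => e _; rewrite -EFinM lee_fin /F mulrC ler_wpM2r ?sqr_ge0//.
  apply: le_lt_trans (esumZ_le M0 _) _ => [e|]; first by rewrite lee_fin sqr_ge0.
  rewrite esum_edge => [|e]; last by rewrite lee_fin sqr_ge0.
  have r201 : 0 < r ^+ 2 < 1.
    by case/andP: r01 => r0 r1; rewrite exprn_gt0//= exprn_ilt1// ltW.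
  have hw := esum_weight_le d r201.
  have wE : (\esum_(v in [set: vertex]) (X v ^+ 2)%:E =
      \esum_(v in [set: vertex]) (weight (r ^+ 2) v)%:E)%E.
    by apply: eq_esum => v _; rewrite weight_sqr.
  have wfin : (\esum_(v in [set: vertex]) (weight (r ^+ 2) v)%:E)%E \is a fin_num.
    rewrite ge0_fin_numE ?(le_lt_trans hw) ?ltry//.
    by apply: esum_ge0 => v _; rewrite lee_fin ltW// weight_gt0//; case/andP: r201.
  rewrite (eq_bigr (fun=> (fine (\esum_(v in [set: vertex]) (weight (r ^+ 2) v)%:E)%E)%:E)).
    by rewrite sumEFin -EFinM ltry.
  by move=> j _ /=; rewrite wE fineK.
pose S := fine (\esum_(e in [set: edge]) (F e)%:E)%E.
have SE : (\esum_(e in [set: edge]) (F e)%:E)%E = S%:E.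
  by rewrite /S fineK// ge0_fin_numE// esum_ge0// => e _; rewrite lee_fin.
have S0 : 0 < S.
  apply: (@lt_le_trans _ _ (F e0)); first by rewrite mulr_gt0 ?exprn_gt0.
  rewrite -lee_fin -SE; apply: (@le_esum1 R _ (fun e => (F e)%:E)).
  by rewrite lee_fin.
have bound (q : gfun R d) k : 0 <= k ->
    (forall e t, 0 <= t <= a e.2 -> {for t, continuous (q e)}) ->
    (forall e t, 0 <= t <= a e.2 -> q e t ^+ 2 <= k * F e) ->
    inL2 a q /\ (L2sq a q <= (k * L * S)%:E)%E.
  move=> k0 cq hq; have mq (e : edge) : measurable_fun `[0, a e.2] (q e).
    by apply: continuous_measurable_cc => t; exact: cq.
  suff h : (L2sq a q <= (k * L * S)%:E)%E.
    by split=> //; split=> //; rewrite (le_lt_trans h)// ltry.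
  have U0 : (\esum_(v in [set: vertex]) (0 : R)%:E <= (0 : R)%:E)%E by rewrite esum1.
  have FS : (\esum_(e in [set: edge]) (F e)%:E <= S%:E)%E by rewrite SE.
  have := @L2sq_le _ _ _ ha q (fun=> 0) F k 0 S mq k0 (fun=> lexx 0) F0 U0 FS.
  by rewrite !addr0 mulr0 add0r; apply=> e t te; rewrite add0r; exact: hq.
have [phiL _] : inL2 a phi /\ (L2sq a phi <= (K * L * S)%:E)%E.
  apply: bound => // e t te; have [_ _ hc _ [hb _]] := hpp e; first by case: (hc t te).
  by case: (hb t te) => h _ _; apply: (le_trans h); rewrite ler_wpM2r// F0.
have [pL _] : inL2 a p /\ (L2sq a p <= (K * L * S)%:E)%E.
  apply: bound => // e t te; have [_ _ hc _ [hb _]] := hpp e; first by case: (hc t te).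
  by case: (hb t te) => _ h _; apply: (le_trans h); rewrite ler_wpM2r// F0.
pose k2 := K * (2 * eps ^+ 2).
have k20 : 0 <= k2 by rewrite mulr_ge0// mulr_ge0// sqr_ge0.
have [fL fLS] : inL2 a f /\ (L2sq a f <= (k2 * L * S)%:E)%E.
  apply: bound => // e t te; have [_ _ hc _ [hb _]] := hpp e; first by case: (hc t te).
  case: (hb t te) => _ _ h; apply: (le_trans h); rewrite ler_wpM2r ?F0//.
  apply: ler_pM => //; first by rewrite addr_ge0 ?sqr_ge0.
  have : (E' - E) ^+ 2 <= eps ^+ 2.
    by rewrite -real_normK ?num_real// ler_sqr ?nnegrE// ltW.
  lra.
have Hphi : H_graph a alpha phi (fun e t => E * phi e t + f e t).
  split=> //; split; first exact: inL2_lin.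
  exists p; split=> //; split=> [e t te|].
    by have [_ _ _ h _] := hpp e; exact: h.
  have phi0 v j : phi (v, j) 0 = X v * x (v, j) by have [[h _] _ _ _ _] := hpp (v, j).
  have phil v j : phi (v, j) (a j) = X (shiftp v j) * esol E' (x (v, j)) (y (v, j)) (a j).
    by have [[_ h] _ _ _ _] := hpp (v, j).
  have p0 v j : p (v, j) 0 = X v * y (v, j) by have [_ [h _] _ _ _] := hpp (v, j).
  have pl v j : p (v, j) (a j) = X (shiftp v j) * desol E' (x (v, j)) (y (v, j)) (a j).
    by have [_ [_ h] _ _ _] := hpp (v, j).
  exists (fun v => X v * u v) => v; have [h1 h2] := hu v; split=> [j|].
    by rewrite phi0 phil shiftmK (h1 j).1 (h1 j).2.
  rewrite mulrCA -h2 mulr_sumr; apply: eq_bigr => j _.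
  by rewrite p0 pl shiftmK -mulrBr.
(* The resolvent bound concerns only the solution it provides; injectivity identifies that solution
   with [phi]. *)
have [phi' [Hphi' phi'le]] := surj f fL.
have eqphi e t : 0 <= t <= a e.2 -> phi e t = phi' e t.
  move=> te; apply/eqP; rewrite -subr_eq0; apply/eqP.
  apply: (inj (fun e t => phi e t - phi' e t)) => //.
  have := H_graphB Hphi Hphi'.
  rewrite (_ : (fun e t => E * phi e t + f e t - (E * phi' e t + f e t)) =
    (fun e t => E * (phi e t - phi' e t)))//.
  by apply/funext => e'; apply/funext => t'; ring.
have phile : (L2sq a phi <= (C * (k2 * L * S))%:E)%E.
  have -> : L2sq a phi = L2sq a phi'.
    apply: eq_esum => e _; apply: eq_integral => t.
    by rewrite inE/= in_itv/= => te; rewrite eqphi.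
  apply: (le_trans phi'le); rewrite (inL2_fin fL) -EFinM lee_fin.
  apply: (@le_trans _ _ (C * fine (L2sq a f))).
    rewrite ler_wpM2r ?ler_norm// fine_ge0// esum_ge0// => e _; exact: edge_L2sq_ge0.
  have : fine (L2sq a f) <= k2 * L * S by rewrite -lee_fin -(inL2_fin fL).
  by apply: ler_wpM2l; exact: normr_ge0.
(* The contradiction: [S] is at most [K] times the squared norm of [phi], which is at most [C] times
   that of [f], itself at most [2 * eps ^+ 2 * K * L * S]. *)
have SS : S <= W * (2 * eps ^+ 2) * S.
  rewrite -lee_fin -SE.
  apply: (@le_trans _ _ (K%:E * L2sq a phi)%E).
    apply: le_trans (esumZ_le K0 (fun e => edge_L2sq_ge0 (phi e) (a e.2))).
    apply: le_esum => e _; have [_ _ _ _ [_ h]] := hpp e; apply: (le_trans h).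
    by apply: lee_wpmul2r; rewrite ?edge_L2sq_ge0// lee_fin.
  apply: (@le_trans _ _ (K%:E * (C * (k2 * L * S))%:E)%E).
    by apply: lee_wpmul2l => //; rewrite lee_fin.
  rewrite -EFinM lee_fin le_eqVlt; apply/orP; left; apply/eqP.
  by rewrite /W /k2; ring.
have : W * (2 * eps ^+ 2) < 1.
  have -> : W * (2 * eps ^+ 2) = eps * (2 * W * eps) by ring.
  have h1 : 2 * W * eps <= 1.
    by move: epsW eps0; move: (eps) (W) => z w zw z0; lra.
  apply: (@le_lt_trans _ _ (eps * 1)); first by rewrite ler_wpM2l// ltW.
  by rewrite mulr1 (le_lt_trans eps2)// invf_lt1// ltr1n.
by move=> h; move: SS; rewrite -subr_ge0 -[X in _ - X]mul1r -mulrBl; nra.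
Qed.

End WeylSequence.

(** * The spectrum as two band inequalities *)

Section SpectrumCharacterization.
Variables (R : realType) (d : nat) (a : 'I_d -> R) (alpha : R).
Hypothesis ha : forall j, 0 < a j.
Hypothesis hd : (0 < d)%N.
Implicit Types (E : R) (j : 'I_d).

(** With [B = 2 \sum_j |s j|^-1], the inequality [- B <= A] reads [- alpha <= upper_band E], and
    [A <= B] reads [alpha <= lower_band E]. Inverses of 0 are 0 by convention, so energies with some
    [s j = 0] are treated separately. *)
Definition upper_band E : R :=
  2 * \sum_(j < d) (`|ssol E (a j)|^-1 + csol E (a j) / ssol E (a j)).

Definition lower_band E : R :=
  2 * \sum_(j < d) (`|ssol E (a j)|^-1 - csol E (a j) / ssol E (a j)).

Lemma band_normE E :
  (`|alpha + 2 * \sum_(j < d) csol E (a j) / ssol E (a j)| <=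
     2 * \sum_(j < d) `|ssol E (a j)|^-1) =
  (alpha <= lower_band E) && (- alpha <= upper_band E).
Proof.
rewrite /upper_band /lower_band sumrB big_split/= ler_norml andbC.
by congr (_ && _); apply/idP/idP; lra.
Qed.

Lemma bounded_eigenfunction_or E :
  (exists j, ssol E (a j) = 0) \/
    [/\ forall j, ssol E (a j) != 0, alpha <= lower_band E & - alpha <= upper_band E] ->
  bounded_eigenfunction a alpha E.
Proof.
move=> [[j]|[s0 h1 h2]]; first exact: bounded_eigenfunction_dirichlet.
by apply: bounded_eigenfunction_bloch => //; rewrite band_normE h1.
Qed.

Lemma spectrum_or E : in_spectrum a alpha E <->
  (exists j, ssol E (a j) = 0) \/
    [/\ forall j, ssol E (a j) != 0, alpha <= lower_band E & - alpha <= upper_band E].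
Proof.
split=> [spec|h res]; last first.
  have [delta delta0 /(_ E)] := resolvent_no_bounded_eigenfunction ha res.
  by rewrite subrr normr0 => /(_ delta0); apply; exact: bounded_eigenfunction_or.
have [[j hj]|nex] := pselect (exists j, ssol E (a j) = 0); first by left; exists j.
have s0 j : ssol E (a j) != 0 by apply/eqP => hj; apply: nex; exists j.
right; split=> //.
  have [//|h] := boolP (alpha <= lower_band E).
  exfalso; apply: spec; apply: in_resolvent_of_dominant => //.
  by rewrite ltNge band_normE negb_and h.
have [//|h] := boolP (- alpha <= upper_band E).
exfalso; apply: spec; apply: in_resolvent_of_dominant => //.
by rewrite ltNge band_normE negb_and h orbT.
Qed.

(** Every spectral energy carries a bounded generalized eigenfunction, and a point of the resolvent
    set keeps these at a positive distance. *)
Lemma spectrum_closed E : ~ in_spectrum a alpha E ->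
  exists2 delta, 0 < delta & forall E', `|E' - E| < delta -> ~ in_spectrum a alpha E'.
Proof.
move=> /contrapT res; have [delta delta0 h] := resolvent_no_bounded_eigenfunction ha res.
exists delta => // E' EE' /spectrum_or /bounded_eigenfunction_or; exact: h.
Qed.

End SpectrumCharacterization.

(** * Positive energies: the band function inside a cell *)

Section PositiveEnergy.
Variable R : realType.
Implicit Types (a k t x y z : R) (n : nat).

Lemma sin_natpiB n z : sin (n%:R * pi - z) = - (-1) ^+ n * sin z.
Proof.
elim: n => [|n ih]; first by rewrite mul0r sub0r sinN expr0 mulN1r.
have -> : n.+1%:R * pi - z = (n%:R * pi - z) + pi by rewrite -natr1; ring.
by rewrite sinDpi ih exprS; ring.
Qed.

Lemma cos_natpiB n z : cos (n%:R * pi - z) = (-1) ^+ n * cos z.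
Proof.
elim: n => [|n ih]; first by rewrite mul0r sub0r cosN expr0 mul1r.
have -> : n.+1%:R * pi - z = (n%:R * pi - z) + pi by rewrite -natr1; ring.
by rewrite cosDpi ih exprS; ring.
Qed.

Lemma sin_le_id x : 0 <= x -> sin x <= x.
Proof.
move=> x0; rewrite -subr_ge0; have -> : (0 : R) = 0 - sin 0 by rewrite sin0 subrr.
have d t : 0 <= t <= x -> is_derive t 1 (fun t => t - sin t) (1 - cos t).
  by move=> _; exact: derB (derid t) (is_derive_sin t).
apply: (is_derive_nonneg_le x0 d) => t _; rewrite subr_ge0.
by have := cos_max t; rewrite ler_norml => /andP[].
Qed.

Section Cell.
Variables (a k : R) (n : nat).
Hypothesis k0 : 0 < k.
Hypothesis cell : n%:R - 1 < k * a / pi < n%:R.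
Let y := pi / 2 * (n%:R - k * a / pi).

Let y_itv : 0 < y < pi / 2.
Proof.
have p0 := pi_gt0 R; rewrite /y; move: cell => /andP[h1 h2]; apply/andP; split.
  by rewrite mulr_gt0 ?divr_gt0// subr_gt0.
by rewrite gtr_pMr ?divr_gt0//; lra.
Qed.

Let ka : k * a = n%:R * pi - (y + y).
Proof. by have pn0 := lt0r_neq0 (pi_gt0 R); rewrite /y; move: (pi) pn0 => p pn0; field. Qed.

Let sy : 0 < sin y. Proof. exact: sin_gt0_pihalf. Qed.

Let cy : 0 < cos y.
Proof.
by apply: cos_gt0_pihalf; case/andP: y_itv => h1 ->; rewrite andbT; have := pi_gt0 R; lra.
Qed.

Lemma cell_ssol_neq0 : ssol (k ^+ 2) a != 0.
Proof.
rewrite ssol_pos// ka sin_natpiB sinD; apply: mulf_neq0; last by rewrite invr_eq0 gt_eqF.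
apply: mulf_neq0; first by rewrite oppr_eq0 expf_neq0// oppr_eq0 oner_eq0.
by apply: lt0r_neq0; apply: addr_gt0; exact: mulr_gt0.
Qed.

(** Since [k a = n pi - 2 y] with [0 < 2 y < pi], the parity sign cancels in the quotient and the
    sum is [k (1 - cos 2y) / sin 2y]. *)
Lemma cell_upper_band : `|ssol (k ^+ 2) a|^-1 + csol (k ^+ 2) a / ssol (k ^+ 2) a =
  k * tan y.
Proof.
rewrite ssol_pos// csol_pos// ka sin_natpiB cos_natpiB sinD cosD /tan.
rewrite !normrM normfV (gtr0_norm k0) normrN normrX normrN1 expr1n mul1r.
rewrite gtr0_norm ?addr_gt0 ?mulr_gt0//.
have := cos2Dsin2 y; move: sy cy; move: (sin y) (cos y) => s c s0 c0 e.
have : ((-1 : R) ^+ n) ^+ 2 = 1 by rewrite exprAC sqrrN expr1n expr1n.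
have : (-1 : R) ^+ n != 0 by rewrite expf_neq0// oppr_eq0 oner_eq0.
move: ((-1) ^+ n) => g g0 g2.
have ek : k = k * (c ^+ 2 + s ^+ 2) by rewrite e mulr1.
have -> : (s * c + c * s) / k = 2 * (s * c) / k by ring.
have -> : - g * (s * c + c * s) / k = - (g * (2 * (s * c) / k)) by ring.
apply/eqP; rewrite -subr_eq0; apply/eqP.
have -> : (2 * (s * c) / k)^-1 + g * (c * c - s * s) / - (g * (2 * (s * c) / k)) - k * (s / c)
  = k * (1 - (c ^+ 2 + s ^+ 2)) / (2 * (s * c)).
  by field; rewrite ?g0 ?(lt0r_neq0 s0) ?(lt0r_neq0 c0) ?(lt0r_neq0 k0).
by rewrite e subrr mulr0 mul0r.
Qed.

End Cell.

(** The factor [k] grows, but the decrease of the tangent wins. The derivative has the sign of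
    [sin y cos y - k a / 2], and [k a / 2 = n pi / 2 - y >= pi / 2 - y], while [2 sin y cos y = sin
    (pi - 2 y) <= pi - 2 y]. This is where [n >= 1] enters. *)
Lemma upper_band_antitone a n (k1 k2 : R) : 0 < a -> (0 < n)%N -> 0 < k1 -> k1 <= k2 ->
  n%:R - 1 < k1 * a / pi -> k2 * a / pi <= n%:R ->
  k2 * tan (pi / 2 * (n%:R - k2 * a / pi)) <= k1 * tan (pi / 2 * (n%:R - k1 * a / pi)).
Proof.
move=> a0 n0 k10 k12 h1 h2; have p0 := pi_gt0 R.
have pn0 : (pi : R) != 0 by rewrite gt_eqF.
have n1 : 1 <= n%:R :> R by rewrite ler1n.
pose y t : R := n%:R * (pi / 2) - (k1 + t) * (a / 2).
have yE t : pi / 2 * (n%:R - (k1 + t) * a / pi) = y t.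
  by rewrite /y; move: (pi) pn0 => p pn0; field.
have yb t : 0 <= t <= k2 - k1 -> 0 <= y t < pi / 2.
  move=> /andP[t0 t1]; rewrite -yE; apply/andP; split.
    rewrite mulr_ge0 ?divr_ge0 ?(ltW p0)// subr_ge0 (le_trans _ h2)//.
    by rewrite ler_pM2r ?invr_gt0// ler_pM2r//; lra.
  have : k1 * a / pi <= (k1 + t) * a / pi.
    by rewrite ler_pM2r ?invr_gt0// ler_pM2r//; lra.
  by move=> h; rewrite gtr_pMr ?divr_gt0//; lra.
have cy t : 0 <= t <= k2 - k1 -> 0 < cos (y t).
  by move=> /yb /andP[h3 h4]; apply: cos_gt0_pihalf; rewrite h4 andbT; lra.
have dy t : is_derive t 1 y (- (a / 2)).
  have H := derB (dercst t (n%:R * (pi / 2)))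
    (derM (derD (dercst t k1) (derid t)) (dercst t (a / 2))).
  by apply: (is_derive_eq H); ring.
pose g t := - ((k1 + t) * tan (y t)).
pose g' t := ((k1 + t) * (a / 2) - sin (y t) * cos (y t)) / cos (y t) ^+ 2.
have dg t : 0 <= t <= k2 - k1 -> is_derive t 1 g (g' t).
  move=> tk; have c0 : cos (y t) != 0 by rewrite gt_eqF// cy.
  have dt : is_derive t 1 (fun t => tan (y t)) ((cos (y t)) ^- 2 * (- (a / 2))).
    exact: (is_derive1_comp (is_derive_tan c0) (dy t)).
  have H := derN (derM (derD (dercst t k1) (derid t)) dt).
  by apply: (is_derive_eq H); rewrite /g' /tan; field.
have k21 : 0 <= k2 - k1 by rewrite subr_ge0.
have : g 0 <= g (k2 - k1).
  apply: (is_derive_nonneg_le k21 dg) => t tk; rewrite /g' divr_ge0 ?sqr_ge0//.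
  rewrite subr_ge0; have /andP[y0 y1] := yb t tk.
  have : sin (pi - (y t + y t)) <= pi - (y t + y t) by apply: sin_le_id; lra.
  have -> : pi - (y t + y t) = 1%:R * pi - (y t + y t) by rewrite mul1r.
  rewrite sin_natpiB expr1 opprK mul1r sinD.
  have : 0 <= (n%:R - 1) * pi :> R by apply: mulr_ge0; [rewrite subr_ge0|exact: ltW].
  have : (k1 + t) * (a / 2) = n%:R * (pi / 2) - y t by rewrite /y; ring.
  move: (y t) ((k1 + t) * (a / 2)) => u w; move: (sin u) (cos u) => su cu.
  by move: (pi) (n%:R) => p m; nra.
rewrite /g addr0 -!yE addr0 lerN2.
by have -> : k1 + (k2 - k1) = k2 by ring.
Qed.

End PositiveEnergy.

(** * Nonpositive energies: half-edge formulas and monotonicity *)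

Section NonpositiveEnergy.
Variable R : realType.
Implicit Types (E h t z k : R).

Lemma csol_double E t : csol E (t + t) = csol E t ^+ 2 - E * ssol E t ^+ 2.
Proof.
have [->|[[k k0 ->]|[k k0 ->]]] := energy_cases E.
- by rewrite !csolE0 mul0r subr0 expr1n.
- by rewrite !csol_pos// ssol_pos// mulrDr cosD; field; rewrite gt_eqF.
rewrite !csol_neg// ssol_neg// mulrDr /coshR /sinhR !expRN expRD.
have : expR (k * t) != 0 by rewrite gt_eqF ?expR_gt0.
by have kn0 := lt0r_neq0 k0; move: (expR _) => e e0; field; rewrite kn0 e0.
Qed.

Lemma ssol_double E t : ssol E (t + t) = 2 * ssol E t * csol E t.
Proof.
have [->|[[k k0 ->]|[k k0 ->]]] := energy_cases E.
- by rewrite !ssolE0 csolE0; ring.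
- by rewrite !ssol_pos// csol_pos// mulrDr sinD; field; rewrite gt_eqF.
rewrite !ssol_neg// csol_neg// mulrDr /coshR /sinhR !expRN expRD.
have : expR (k * t) != 0 by rewrite gt_eqF ?expR_gt0.
by have kn0 := lt0r_neq0 k0; move: (expR _) => e e0; field; rewrite kn0 e0.
Qed.

Lemma coshR_gt0 t : 0 < coshR t.
Proof. by rewrite divr_gt0// addr_gt0 ?expR_gt0. Qed.

Lemma csol_ge1 E t : E <= 0 -> 1 <= csol E t.
Proof.
move=> E0; have c0 : 0 <= csol E t.
  have [e|[[k k0 e]|[k k0 ->]]] := energy_cases E.
  - by rewrite e csolE0.
  - by move: E0; rewrite e leNgt exprn_gt0.
  - by rewrite csol_neg// ltW// coshR_gt0.
have : 1 <= csol E t ^+ 2.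
  rewrite -(csol2_ssol2 E t) gerDl mulr_le0_ge0 ?sqr_ge0//.
by rewrite -{1}(expr1n R 2) ler_sqr ?nnegrE.
Qed.

Lemma ssol_gt0 E t : E <= 0 -> 0 < t -> 0 < ssol E t.
Proof.
move=> E0 t0; apply: (lt_le_trans t0).
have d s : 0 <= s <= t -> is_derive s 1 (fun s => ssol E s - s) (csol E s - 1).
  by move=> _; exact: derB (is_derive_ssol E s) (derid s).
have : ssol E 0 - 0 <= ssol E t - t.
  by apply: (is_derive_nonneg_le (ltW t0) d) => s _; rewrite subr_ge0 csol_ge1.
by rewrite ssol0 subr0 subr_ge0.
Qed.

Lemma ssol_ge0 E t : E <= 0 -> 0 <= t -> 0 <= ssol E t.
Proof.
rewrite [0 <= t]le_eqVlt => E0 /predU1P[<-|t0]; first by rewrite ssol0.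
by rewrite ltW// ssol_gt0.
Qed.

(** Half-angle formula; for [E = - k^2] the value is [k coth (k h)], with [h] half an edge. *)
Lemma upper_term_half E h : E <= 0 -> 0 < h ->
  `|ssol E (h + h)|^-1 + csol E (h + h) / ssol E (h + h) = csol E h / ssol E h.
Proof.
move=> E0 h0; rewrite gtr0_norm ?ssol_gt0 ?addr_gt0//.
have s0 := lt0r_neq0 (ssol_gt0 E0 h0).
have c0 : csol E h != 0 by rewrite gt_eqF// (lt_le_trans ltr01)// csol_ge1.
rewrite ssol_double csol_double; have := csol2_ssol2 E h.
move: (csol E h) (ssol E h) s0 c0 => c s s0 c0 e.
have -> : E * s ^+ 2 = 1 - c ^+ 2 by rewrite -e; ring.
by field; rewrite s0 c0.
Qed.

(** The companion formula; for [E = - k^2] the value is [- k tanh (k h)]. *)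
Lemma lower_term_half E h : E <= 0 -> 0 < h ->
  `|ssol E (h + h)|^-1 - csol E (h + h) / ssol E (h + h) = E * ssol E h / csol E h.
Proof.
move=> E0 h0; rewrite gtr0_norm ?ssol_gt0 ?addr_gt0//.
have s0 := lt0r_neq0 (ssol_gt0 E0 h0).
have c0 : csol E h != 0 by rewrite gt_eqF// (lt_le_trans ltr01)// csol_ge1.
rewrite ssol_double csol_double; have := csol2_ssol2 E h.
move: (csol E h) (ssol E h) s0 c0 => c s s0 c0 e.
have -> : c ^+ 2 = 1 - E * s ^+ 2 by rewrite -e; ring.
by field; rewrite s0 c0.
Qed.

(* Both monotonicity statements integrate the Wronskian of two solutions. *)
Lemma upper_term_antitone E E' h : E <= E' -> E' <= 0 -> 0 < h ->
  csol E' h / ssol E' h <= csol E h / ssol E h.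
Proof.
move=> EE' E'0 h0; have E0 := le_trans EE' E'0.
rewrite ler_pdivrMr ?ssol_gt0// mulrAC ler_pdivlMr ?ssol_gt0//.
rewrite -subr_ge0.
have d t : 0 <= t <= h -> is_derive t 1
    (fun t => csol E t * ssol E' t - csol E' t * ssol E t) ((E' - E) * (ssol E t * ssol E' t)).
  move=> _; have H := derB (derM (is_derive_csol E t) (is_derive_ssol E' t))
    (derM (is_derive_csol E' t) (is_derive_ssol E t)).
  by apply: (is_derive_eq H); ring.
have := is_derive_nonneg_le (ltW h0) d; rewrite !ssol0 !mulr0 subrr; apply=> t /andP[t0 _].
by rewrite mulr_ge0 ?subr_ge0// mulr_ge0// ssol_ge0.
Qed.

Lemma lower_term_monotone E E' h : E <= E' -> E' <= 0 -> 0 < h ->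
  E * ssol E h / csol E h <= E' * ssol E' h / csol E' h.
Proof.
move=> EE' E'0 h0; have E0 := le_trans EE' E'0.
have c0 F t : F <= 0 -> 0 < csol F t by move=> F0; rewrite (lt_le_trans ltr01)// csol_ge1.
rewrite ler_pdivrMr ?c0// mulrAC ler_pdivlMr ?c0//.
rewrite -subr_ge0.
have d t : 0 <= t <= h -> is_derive t 1
    (fun t => E' * (ssol E' t * csol E t) - E * (ssol E t * csol E' t))
    ((E' - E) * (csol E t * csol E' t)).
  move=> _; have H := derB (derZ E' (derM (is_derive_ssol E' t) (is_derive_csol E t)))
    (derZ E (derM (is_derive_ssol E t) (is_derive_csol E' t))).
  by apply: (is_derive_eq H); ring.
have := is_derive_nonneg_le (ltW h0) d; rewrite !ssol0 !mul0r !mulr0 subrr !mulrA.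
apply=> t /andP[t0 _].
by rewrite mulr_ge0 ?subr_ge0// mulr_ge0// ltW// c0.
Qed.

(** The inequality [tanh <= coth], from [- E s^2 = c^2 - 1 <= c^2]. *)
Lemma lower_term_le_upper_term E h : E <= 0 -> 0 < h ->
  - (E * ssol E h / csol E h) <= csol E h / ssol E h.
Proof.
move=> E0 h0; have c0 : 0 < csol E h by rewrite (lt_le_trans ltr01)// csol_ge1.
rewrite -mulNr ler_pdivrMr// mulrAC ler_pdivlMr ?ssol_gt0//.
by have := csol2_ssol2 E h; move: (csol E h) (ssol E h) => c s; nra.
Qed.

(** The claim amounts to [expR (2 * z) >= 3], and [expR (2 * z) >= 1 + 2 * z]. *)
Lemma tanh_lower_bound z : 1 <= z -> 2^-1 <= sinhR z / coshR z.
Proof.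
move=> z1; rewrite ler_pdivlMr ?coshR_gt0// /sinhR /coshR.
have h : 1 + 2 * z <= expR z * expR z.
  have -> : expR z * expR z = expR (2 * z) by rewrite -expRD; congr expR; ring.
  exact: expR_ge1Dx.
have : expR z * expR (- z) = 1 by rewrite -expRD subrr expR0.
have := expR_gt0 z; have := expR_gt0 (- z).
move: (expR z) (expR (- z)) h => e e' h e'0 e0 ee'.
have : e' * (1 + 2 * z) <= e' * (e * e) by rewrite ler_wpM2l// ltW.
have -> : e' * (e * e) = e by rewrite mulrA (mulrC e') ee' mul1r.
have : e' * 2 <= e' * (2 * z) by rewrite ler_wpM2l ?(ltW e'0)//; lra.
by lra.
Qed.

End NonpositiveEnergy.

(** * The spectrum below zero: convexity and nonemptiness *)

Section NonpositiveSpectrum.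
Variables (R : realType) (d : nat) (a : 'I_d -> R) (alpha : R).
Hypothesis ha : forall j, 0 < a j.
Hypothesis hd : (0 < d)%N.
Hypothesis halpha : alpha < 0.
Implicit Types (E : R) (j : 'I_d).

Let half j : a j = a j / 2 + a j / 2. Proof. by rewrite -splitr. Qed.
Let half_gt0 j : 0 < a j / 2. Proof. by rewrite divr_gt0. Qed.

Lemma upper_band_half E : E <= 0 ->
  upper_band a E = 2 * \sum_(j < d) csol E (a j / 2) / ssol E (a j / 2).
Proof.
move=> E0; rewrite /upper_band; congr (_ * _); apply: eq_bigr => j _.
by rewrite {1 2 3}half upper_term_half.
Qed.

Lemma lower_band_half E : E <= 0 ->
  lower_band a E = 2 * \sum_(j < d) E * ssol E (a j / 2) / csol E (a j / 2).
Proof.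
move=> E0; rewrite /lower_band; congr (_ * _); apply: eq_bigr => j _.
by rewrite {1 2 3}half lower_term_half.
Qed.

(** [lower_band] increases and [upper_band] decreases, so [E] inherits the first inequality from
    [E1] and the second from [E2]. No [s j] vanishes at these energies. *)
Lemma spectrum_convex_nonpos E1 E E2 : E1 < E < E2 -> E2 <= 0 ->
  in_spectrum a alpha E1 -> in_spectrum a alpha E2 -> in_spectrum a alpha E.
Proof.
move=> /andP[h1 h2] E20; have E0 := ltW (lt_le_trans h2 E20).
have E10 := ltW (lt_le_trans h1 E0).
have nz F j : F <= 0 -> ssol F (a j) != 0 by move=> F0; rewrite gt_eqF// ssol_gt0.
move=> /(spectrum_or alpha ha hd)[[j /eqP]|[_ lo _]]; first by rewrite (negPf (nz _ _ E10)).
move=> /(spectrum_or alpha ha hd)[[j /eqP]|[_ _ up]]; first by rewrite (negPf (nz _ _ E20)).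
apply/(spectrum_or alpha ha hd); right; split; first by move=> j; exact: nz.
  rewrite (le_trans lo)// !lower_band_half// ler_wpM2l//; apply: ler_sum => j _.
  by apply: lower_term_monotone => //; exact: ltW.
rewrite (le_trans up)// !upper_band_half// ler_wpM2l//; apply: ler_sum => j _.
by apply: upper_term_antitone => //; exact: ltW.
Qed.

(** The intermediate value theorem solves [lower_band E = alpha], that is [A = B]; the other
    inequality then follows from [tanh <= coth]. The point found lies below every candidate upper
    endpoint of a gap. *)
Lemma negative_spectrum : exists2 E, E < 0 & in_spectrum a alpha E.
Proof.
pose h j := a j / 2.
pose T k := 2 * \sum_(j < d) k * (sinhR (k * h j) / coshR (k * h j)).
pose j0 := Ordinal hd; pose K := - alpha + (h j0)^-1.
have K0 : 0 < K by apply: addr_gt0; [rewrite oppr_gt0|rewrite invr_gt0; exact: half_gt0].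
have term0 k j : 0 <= k -> 0 <= k * (sinhR (k * h j) / coshR (k * h j)).
  move=> k0; rewrite mulr_ge0// divr_ge0 ?(ltW (coshR_gt0 _))// divr_ge0// subr_ge0.
  rewrite ler_expR; have : 0 <= k * h j by rewrite mulr_ge0// ltW// half_gt0.
  lra.
have TK : - alpha <= T K.
  rewrite /T (bigD1 j0)//= mulrDr; apply: ler_wpDr.
    by rewrite mulr_ge0// sumr_ge0// => j _; exact: term0 (ltW K0).
  (* The summand [(h j0)^-1] of [K] makes this hold, so the hyperbolic tangent is at least 1/2 and
     the [j0] term alone, doubled, reaches [K >= - alpha]. *)
  have z1 : 1 <= K * h j0.
    rewrite /K mulrDl mulVf ?gt_eqF ?half_gt0// lerDr mulr_ge0// ?oppr_ge0 ltW//.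
    exact: half_gt0.
  have : K * 2^-1 <= K * (sinhR (K * h j0) / coshR (K * h j0)).
    by rewrite ler_wpM2l ?(ltW K0)// tanh_lower_bound.
  have : - alpha <= K by rewrite lerDl invr_ge0 ltW// half_gt0.
  lra.
have cT : {within `[0, K], continuous T}.
  apply: continuous_within_cc => t _.
  have dterm j : {for t, continuous (fun k : R => k * (sinhR (k * h j) / coshR (k * h j)))}.
    have dh : is_derive t 1 (fun k : R => k * h j) (1 * h j).
      by apply: (is_derive_eq (derM (derid t) (dercst t (h j)))); ring.
    have cs := der_continuous (@is_derive1_comp R (@sinhR R) (fun k => k * h j) t _ _
      (is_derive_sinhR (t * h j)) dh).
    have cc := der_continuous (@is_derive1_comp R (@coshR R) (fun k => k * h j) t _ _
      (is_derive_coshR (t * h j)) dh).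
    apply: cvgM; first exact: cvg_id.
    by apply: cvgM; [exact: cs|apply: cvgV; [exact: lt0r_neq0 (coshR_gt0 _)|exact: cc]].
  apply: cvgM; first exact: cvg_cst.
  elim: (index_enum 'I_d) => [|j r ih].
    by rewrite big_nil; under eq_fun do rewrite big_nil; exact: cvg_cst.
  rewrite big_cons; under eq_fun do rewrite big_cons.
  by apply: cvgD; [exact: dterm|exact: ih].
have T0 : T 0 = 0 by rewrite /T big1 ?mulr0// => j _; rewrite mul0r.
have [|k /[!in_itv]/= /andP[k0 kK] Tk] := @IVT _ T 0 K (- alpha) (ltW K0) cT.
  by rewrite T0 ge_min le_max TK orbT oppr_ge0 (ltW halpha).
have {k0 kK} k0 : 0 < k.
  rewrite lt_neqAle k0 andbT; apply/eqP => k00; move: Tk; rewrite -k00 T0 => h0.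
  by move: halpha; rewrite -oppr_gt0 -h0 ltxx.
have E0 : - k ^+ 2 < 0 by rewrite oppr_lt0 exprn_gt0.
have lo : lower_band a (- k ^+ 2) = alpha.
  apply: oppr_inj; rewrite -Tk lower_band_half ?(ltW E0)// -mulrN -sumrN.
  congr (_ * _); apply: eq_bigr => j _; rewrite ssol_neg// csol_neg//.
  by field; rewrite !gt_eqF// coshR_gt0.
exists (- k ^+ 2) => //; apply/(spectrum_or alpha ha hd); right; split.
- by move=> j; rewrite gt_eqF// ssol_gt0// ltW.
- by rewrite lo.
rewrite -lo lower_band_half ?upper_band_half ?(ltW E0)// -mulrN -sumrN ler_wpM2l//.
by apply: ler_sum => j _; apply: lower_term_le_upper_term => //; exact: ltW.
Qed.

End NonpositiveSpectrum.

(** * Spectral gaps and their upper endpoints *)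

Section Gaps.
Variables (R : realType) (d : nat) (a : 'I_d -> R) (alpha : R).
Hypothesis ha : forall j, 0 < a j.
Hypothesis hd : (0 < d)%N.
Hypothesis halpha : alpha < 0.
Implicit Types (E k q : R) (j : 'I_d) (n : 'I_d -> nat).

(** For fixed [n] this is a single smooth branch of the band function. At [k a_j / pi = n j] its
    [j]-th term is 0, the limit from the left. *)
Definition cell_band n k : R :=
  2 * \sum_(j < d) k * tan (pi / 2 * ((n j)%:R - k * a j / pi)).

(** Closed on the right, so that [n j] is the ceiling of [k a_j / pi]. *)
Definition in_cell n k : Prop :=
  forall j, ((n j)%:R - 1 < k * a j / pi) /\ (k * a j / pi <= (n j)%:R).

Definition in_open_cell n k : Prop :=
  forall j, (n j)%:R - 1 < k * a j / pi < (n j)%:R.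

Lemma in_cell_ceil q : 0 < q -> exists n,
  [/\ forall j, (0 < n j)%N, in_cell n q &
      forall j, (Num.ceil (q * a j / pi))%:~R = (n j)%:R :> R].
Proof.
move=> q0; have x0 j : 0 < q * a j / pi by rewrite divr_gt0 ?pi_gt0// mulr_gt0.
exists (fun j => `|Num.ceil (q * a j / pi)|%N).
have e j : (Num.ceil (q * a j / pi))%:~R = (`|Num.ceil (q * a j / pi)|%N)%:R :> R.
  have c0 : 0 <= Num.ceil (q * a j / pi) by rewrite ltW// ceil_gt0.
  by rewrite -{1}(gez0_abs c0).
split=> [j|j|//]; first by rewrite absz_gt0 gt_eqF// ceil_gt0.
have /andP[h1 h2] := ceil_itv (q * a j / pi).
by rewrite -!e; split=> //; move: h1; rewrite intrB.
Qed.

Lemma upper_band_cell n k : 0 < k -> in_open_cell n k ->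
  (forall j, ssol (k ^+ 2) (a j) != 0) /\ upper_band a (k ^+ 2) = cell_band n k.
Proof.
move=> k0 hn; split=> [j|]; first exact: (cell_ssol_neq0 k0 (hn j)).
congr (_ * _); apply: eq_bigr => j _.
exact: (cell_upper_band k0 (hn j)).
Qed.

(** Here [|c j| <= 1]. For [alpha < 0] the inequality on [lower_band] thus holds at all nonnegative
    energies and only [upper_band] decides. *)
Lemma lower_band_ge0 E : 0 <= E -> 0 <= lower_band a E.
Proof.
move=> E0; rewrite mulr_ge0// sumr_ge0// => j _; rewrite subr_ge0.
rewrite (le_trans (ler_norm _))// normrM normfV ler_piMl ?invr_ge0//.
rewrite -(expr_le1 (n := 2))// real_normK ?num_real//.
by rewrite -(csol2_ssol2 E (a j)) lerDl mulr_ge0// sqr_ge0.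
Qed.

Lemma spectrum_cell n k : 0 < k -> in_open_cell n k ->
  in_spectrum a alpha (k ^+ 2) <-> - alpha <= cell_band n k.
Proof.
move=> k0 hn; have [s0 <-] := upper_band_cell k0 hn; split=> [/(spectrum_or alpha ha hd)|h].
  by move=> [[j /eqP]|[]//]; rewrite (negPf (s0 j)).
apply/(spectrum_or alpha ha hd); right; split => //.
by rewrite (le_trans (ltW halpha))// lower_band_ge0// sqr_ge0.
Qed.

(** Just to the left of [q] all ceilings keep their values at [q]; [k0] is the largest left end of
    the [d] intervals, or 0. *)
Lemma cell_left n q : 0 < q -> in_cell n q ->
  exists2 k0, 0 <= k0 < q & forall k, k0 < k < q -> in_open_cell n k.
Proof.
move=> q0 hn; have p0 := pi_gt0 R.
have apos j : 0 < a j / pi by rewrite divr_gt0.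
exists (\big[Num.max/0]_(j < d) (((n j)%:R - 1) / (a j / pi))).
  apply/andP; split; first exact: bigmax_ge_id.
  apply: bigmax_lt => // j _.
  by rewrite ltr_pdivrMr// mulrA; case: (hn j).
move=> k /andP[k0 kq] j; have [h1 h2] := hn j; apply/andP; split.
  rewrite -mulrA -ltr_pdivrMr//; apply: le_lt_trans k0.
  exact: (le_bigmax _ (fun j => ((n j)%:R - 1) / (a j / pi))).
by apply: lt_le_trans h2; rewrite -!mulrA ltr_pM2r.
Qed.

(** The branch decreases, so an inequality that holds at [q] also holds just to its left, and the
    spectrum accumulates at [q ^+ 2] from below. This excludes a gap ending there. *)
Lemma spectrum_left n q E : (forall j, (0 < n j)%N) -> 0 < q -> in_cell n q ->
  - alpha <= cell_band n q -> E < q ^+ 2 ->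
  exists2 E', E < E' < q ^+ 2 & in_spectrum a alpha E'.
Proof.
move=> n0 q0 hn hq Eq; have [k0 /andP[k00 k0q] hk] := cell_left q0 hn.
pose e := Num.sqrt (Num.max E 0).
have e0 : 0 <= e by exact: sqrtr_ge0.
have e2 : E <= e ^+ 2 by rewrite sqr_sqrtr ?le_max ?lexx ?orbT.
have eq : e < q.
  rewrite -(ltr_pXn2r (ltn0Sn 1)) ?nnegrE ?(ltW q0)// sqr_sqrtr ?le_max ?lexx ?orbT//.
  by rewrite gt_max Eq exprn_gt0.
pose m := Num.max k0 e; have m0 : 0 <= m by rewrite le_max k00.
have mq : m < q by rewrite gt_max k0q.
pose k := (m + q) / 2.
have mk : m < k by rewrite /k; lra.
have kq : k < q by rewrite /k; lra.
have kpos : 0 < k by exact: le_lt_trans mk.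
have kcell : in_open_cell n k.
  by apply: hk; rewrite kq andbT (le_lt_trans _ mk)// le_max lexx.
exists (k ^+ 2).
  apply/andP; split; last by rewrite ltr_pXn2r ?nnegrE// ltW.
  apply: (le_lt_trans e2); rewrite ltr_pXn2r ?nnegrE ?(ltW kpos)//.
  by rewrite (le_lt_trans _ mk)// le_max lexx orbT.
apply/(spectrum_cell kpos kcell); apply: (le_trans hq); rewrite ler_wpM2l//.
apply: ler_sum => j _; apply: upper_band_antitone => //; first exact: ltW.
  by case/andP: (kcell j).
by case: (hn j).
Qed.

(** At the right edge of a cell the tangent is taken at 0, so the branch extends smoothly beyond the
    edge, although the band function itself jumps there. *)
Lemma cell_band_continuous n q : in_cell n q -> {for q, continuous (cell_band n)}.
Proof.
move=> hn; have p0 := pi_gt0 R; have pn0 := lt0r_neq0 p0.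
have dterm j : {for q, continuous
    (fun k : R => k * tan (pi / 2 * ((n j)%:R - k * a j / pi)))}.
  have [h1 h2] := hn j; set y : R -> R := fun k => pi / 2 * ((n j)%:R - k * a j / pi).
  have c0 : cos (y q) != 0.
    rewrite gt_eqF//; apply: cos_gt0_pihalf; apply/andP; split.
      by apply: (@lt_le_trans _ _ 0); rewrite ?oppr_lt0 ?divr_gt0// /y mulr_ge0 ?divr_ge0 ?(ltW p0)// subr_ge0.
    by rewrite /y gtr_pMr ?divr_gt0//; lra.
  have dy : is_derive q 1 y (- (a j / 2)).
    have H := derZ (pi / 2) (derB (dercst q (n j)%:R)
      (derM (derM (derid q) (dercst q (a j))) (dercst q (pi^-1)))).
    by apply: (is_derive_eq H); move: (pi) pn0 => p ?; field.
  have dt := @is_derive1_comp R (@tan R) y q _ _ (is_derive_tan c0) dy.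
  exact: der_continuous (derM (derid q) dt).
apply: cvgM; first exact: cvg_cst.
elim: (index_enum 'I_d) => [|j r ih].
  by rewrite big_nil; under eq_fun do rewrite big_nil; exact: cvg_cst.
rewrite big_cons; under eq_fun do rewrite big_cons.
by apply: cvgD; [exact: dterm|exact: ih].
Qed.

(** Convexity rules out an endpoint at or below 0, and [spectrum_left] rules out one inside an open
    cell; only cell boundaries remain. *)
Lemma gap_upper_endpoint E1 E2 : spectral_gap a alpha E1 E2 ->
  exists (j : 'I_d) (m : nat), (0 < m)%N /\ E2 = (m%:R * pi / a j) ^+ 2.
Proof.
move=> [E12 [sE1 [sE2 gap]]]; have [E20|E20] := lerP E2 0.
  exfalso; have hm : E1 < (E1 + E2) / 2 < E2 by apply/andP; split; lra.
  by apply: (gap _ hm); exact: (spectrum_convex_nonpos ha hd hm).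
pose q := Num.sqrt E2; have q0 : 0 < q by rewrite sqrtr_gt0.
have q2 : q ^+ 2 = E2 by rewrite sqr_sqrtr// ltW.
have [n [n0 hn _]] := in_cell_ceil q0.
have [[j hj]|nex] := pselect (exists j, q * a j / pi = (n j)%:R).
  exists j, (n j); split; first exact: n0.
  rewrite -hj -q2 divfK ?gt_eqF ?pi_gt0//.
  by rewrite mulfK// gt_eqF.
have hno : in_open_cell n q.
  move=> j; have [h1 h2] := hn j; rewrite h1 lt_neqAle h2 andbT.
  by apply/eqP => e; apply: nex; exists j.
have : - alpha <= cell_band n q by apply/(spectrum_cell q0 hno); rewrite q2.
move=> h; have E1q : E1 < q ^+ 2 by rewrite q2.
have [E hE sE] := spectrum_left n0 q0 hn h E1q.
by exfalso; apply: (gap E) => //; rewrite -q2.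
Qed.

Lemma gap_below n q : (forall j, (0 < n j)%N) -> 0 < q -> in_cell n q ->
  in_spectrum a alpha (q ^+ 2) ->
  (exists E1, spectral_gap a alpha E1 (q ^+ 2)) <-> cell_band n q < - alpha.
Proof.
move=> n0 q0 hn sq; split=> [[E1 [E1q [sE1 [_ gap]]]]|hq].
  rewrite ltNge; apply/negP => h.
  have [E hE sE] := spectrum_left n0 q0 hn h E1q.
  by apply: (gap E).
have [k0 /andP[k00 k0q] hk] := cell_left q0 hn.
have [e /= e0 he] : exists2 e, 0 < e & forall k, `|q - k| < e -> cell_band n k < - alpha.
  have /cvgr_lt/(_ _ hq) := cell_band_continuous hn.
  by move/nbhs_ballP => [e /= e0 he]; exists e => // k hk'; exact: he.
pose m := Num.max k0 (q - e).
have mq : m < q by rewrite gt_max k0q ltrBlDr ltrDl.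
have m0 : 0 <= m by rewrite le_max k00.
(* The supremum of [S] is the lower endpoint: continuity of the branch keeps it away from [q ^+ 2],
   and the negative point of the spectrum makes [S] nonempty. *)
pose S := [set E | in_spectrum a alpha E /\ E < q ^+ 2].
have Sub E : S E -> E <= m ^+ 2.
  move=> [sE Eq]; rewrite leNgt; apply/negP => mE.
  have E0 : 0 <= E by rewrite (le_trans _ (ltW mE))// sqr_ge0.
  pose k := Num.sqrt E; have kE : k ^+ 2 = E by rewrite sqr_sqrtr.
  have k0' : 0 <= k by exact: sqrtr_ge0.
  have mk : m < k by rewrite -(ltr_pXn2r (ltn0Sn 1)) ?nnegrE// kE.
  have kq : k < q by rewrite -(ltr_pXn2r (ltn0Sn 1)) ?nnegrE ?(ltW q0)// kE.
  have kpos : 0 < k by exact: le_lt_trans mk.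
  move: mk; rewrite gt_max => /andP[k0k qek].
  have kcell : in_open_cell n k by apply: hk; rewrite k0k.
  have : - alpha <= cell_band n k by apply/(spectrum_cell kpos kcell); rewrite kE.
  by rewrite leNgt he// gtr0_norm ?subr_gt0//; lra.
have [E' E'0 sE'] := negative_spectrum ha hd halpha.
have hS : has_sup S.
  split; first by exists E'; split=> //; rewrite (lt_trans E'0)// exprn_gt0.
  by exists (m ^+ 2) => E; exact: Sub.
have supq : sup S < q ^+ 2.
  apply: (@le_lt_trans _ _ (m ^+ 2)); first by apply: ge_sup; [case: hS|exact: Sub].
  by rewrite ltr_pXn2r ?nnegrE// ltW.
have supS E : S E -> E <= sup S by move=> SE; apply: ub_le_sup => //; case: hS.
exists (sup S); split=> //; split.
  (* Otherwise closedness would give a neighbourhood of [sup S] free of spectrum, against points of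
     [S] arbitrarily close to it. *)
  have [//|nS] := pselect (in_spectrum a alpha (sup S)).
  have [delta delta0 hdelta] := spectrum_closed ha hd nS.
  have [E SE hE] := sup_adherent delta0 hS.
  exfalso; apply: (hdelta E) => //; last by case: SE.
  have := supS E SE => h; rewrite distrC ger0_norm ?subr_ge0//; lra.
split=> // E /andP[h1 h2] sE.
by have := supS E (conj sE h2); rewrite leNgt h1.
Qed.

End Gaps.

Theorem theorem3p4 (R : realType) (d : nat) (a : 'I_d -> R) (alpha : R)
  (hd : (0 < d)%N) (ha : forall j, 0 < a j) (halpha : alpha < 0) :
  (forall E1 E2 : R, spectral_gap a alpha E1 E2 ->
     exists (j : 'I_d) (m : nat), (0 < m)%N /\ E2 = (m%:R * pi / a j) ^+ 2)
  /\
  (forall (l : 'I_d) (m : nat), (0 < m)%N ->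
     ((exists E1 : R, spectral_gap a alpha E1 ((m%:R * pi / a l) ^+ 2))
      <->
      (2 * m%:R * pi / a l) *
        \sum_(j < d) tan (pi / 2 * ((Num.ceil (m%:R * a j / a l))%:~R
                                     - m%:R * a j / a l))
      < `|alpha|)).
Proof.
split=> [E1 E2|l m m0]; first exact: gap_upper_endpoint.
have pn0 : pi != 0 :> R := lt0r_neq0 (pi_gt0 R).
have ln0 : a l != 0 := lt0r_neq0 (ha l).
set q := m%:R * pi / a l.
have q0 : 0 < q by rewrite divr_gt0// mulr_gt0 ?pi_gt0// ltr0n.
have [n [n0 hn hc]] := in_cell_ceil ha q0.
have xE j : m%:R * a j / a l = q * a j / pi.
  by rewrite /q; move: (pi) pn0 => p p0; field; rewrite p0 ln0.
(* The sine vanishes at the end of the edges of direction [l], so this energy is spectral for every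
   [alpha]. *)
have sq : in_spectrum a alpha (q ^+ 2).
  apply/(spectrum_or alpha ha hd); left; exists l; rewrite ssol_pos//.
  have -> : q * a l = m%:R * pi - 0 by rewrite /q subr0 divfK.
  by rewrite sin_natpiB sin0 mulr0 mul0r.
rewrite (gap_below ha hd halpha n0 q0 hn sq) (ltr0_norm halpha).
(* What is left is to recognize the left-limit branch at [q]: the prefactor is [2 * q], and
   [q * a j / pi] equals [m * a j / a l]. *)
suff -> : cell_band a n q = 2 * m%:R * pi / a l *
    \sum_(j < d) tan (pi / 2 * ((Num.ceil (m%:R * a j / a l))%:~R - m%:R * a j / a l)) by [].
rewrite /cell_band -mulr_sumr; have -> : 2 * m%:R * pi / a l = 2 * q by rewrite /q !mulrA.
by rewrite -mulrA; do 2!congr (_ * _); apply: eq_bigr => j _; rewrite xE hc.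
Qed.
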